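(* Let $T>0$, $p\in(1,\infty]$ and $\xi\in L^p(\mathcal F_T)^d$. Let $c_2=\frac15$, $c_\infty=\frac14$ and $c_p=\frac{p-1}{4p-1}$ for $p\in(1,\infty)\setminus\{2\}$. Then the BSDE $$Y_t=\xi+\int_t^Tf(s,Y,M)\,ds+M_T-M_t,\qquad t\in[0,T],$$ has a unique solution $(Y,M)\in\mathbb S^p\times\mathbb M^p_0$ for every driver $f:[0,T]\times\Omega\times\mathbb S^p\times\mathbb M^p_0\to\mathbb R^d$ satisfying the following conditions: (i) For all $(Y,M)\in\mathbb S^p\times\mathbb M^p_0$, $f(\cdot,Y,M)$ is progressively measurable, and $\int_0^T\|f(t,0,0)\|_p\,dt<\infty$. (ii) There exist nonnegative constants $C_1>0$ and $C_2<\dfrac{c_pC_1}{e^{C_1T}-1}$ such that $$\|f(t,Y,M)-f(t,Y',M')\|_p\le C_1\|Y-Y_0+M-(Y'-Y'_0+M')\|_{\mathbb S^p_{[0,t]}}+C_2\left(\|Y_0-Y'_0\|_p+\|M-M'\|_{\mathbb S^p}\right)$$ for all $t\in[0,T]$ and $(Y,M),(Y',M')\in\mathbb S^p\times\mathbb M^p_0$.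
   Context: Fix a finite time horizon $T$, a dimension $d\in\mathbb N$ and a filtered probability space $(\Omega,\mathcal F,\mathbb F,\mathbb P)$ whose filtration $\mathbb F=(\mathcal F_t)_{t\in[0,T]}$ satisfies the usual conditions; all martingales are taken in their RCLL (right-continuous with left limits) modification. $|\cdot|$ is the Euclidean norm. For a $d$-dimensional random vector $X$, $\|X\|_p:=(\mathbb E|X|^p)^{1/p}$ if $p<\infty$ and $\|X\|_\infty:=\operatorname{ess\,sup}_{\omega\in\Omega}|X|$. For $p\in(1,\infty]$: $L^p(\mathcal F_t)^d$ is the set of $d$-dimensional $\mathcal F_t$-measurable random vectors $X$ with $\|X\|_p<\infty$; $\mathbb S^p$ is the set of $\mathbb R^d$-valued RCLL adapted processes $(Y_t)_{0\le t\le T}$ with $\|Y\|_{\mathbb S^p}:=\|\sup_{0\le t\le T}|Y_t|\|_p<\infty$; $\mathbb S^p_0:=\{Y\in\mathbb S^p:Y_0=0\}$; $\mathbb M^p_0$ is the set of all martingales in $\mathbb S^p_0$. For an RCLL measurable process $X$, $\|X\|_{\mathbb S^p_{[0,t]}}:=\|\sup_{0\le s\le t}|X_s|\|_p$. The argument $\omega$ of $f$ is suppressed; $f(t,Y,M)$ is a random vector that may depend on $Y$ and $M$ as whole processes (random elements). A solution is a pair $(Y,M)\in\mathbb S^p\times\mathbb M^p_0$ satisfying the equation for all $t\in[0,T]$. *)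

(* Defs.v *)
From mathcomp Require Import all_boot all_order all_algebra.
From mathcomp Require Import all_classical all_reals all_analysis.

Set Implicit Arguments.
Unset Strict Implicit.
Unset Printing Implicit Defensive.
Import Order.TTheory GRing.Theory Num.Theory.
Import numFieldNormedType.Exports.

Local Open Scope classical_set_scope.
Local Open Scope ring_scope.

(* The norm `|v| that MathComp-Analysis puts on 'rV[R]_d is the max norm;
   enorm is the Euclidean one. *)
Definition enorm (R : realType) (d : nat) (v : 'rV[R]_d) : R :=
  Num.sqrt (\sum_(i < d) v ord0 i ^+ 2).

Section stochastic_processes.
Context (disp : measure_display) (Omega : measurableType disp) (R : realType).
Context (P : probability Omega R).

Definition rvec (d : nat) := Omega -> 'rV[R]_d.

(* Processes are indexed by the whole of R, but every notion below only looks
   at their values at times in [0, T]. *)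
Definition process (d : nat) := R -> Omega -> 'rV[R]_d.

Definition zero_process (d : nat) : process d := fun _ _ => 0.

Definition is_filtration (T : R) (F : R -> set (set Omega)) : Prop :=
  [/\ forall t : R, t \in `[0, T] -> sigma_algebra [set: Omega] (F t),
      forall t : R, t \in `[0, T] -> F t `<=` measurable
    & forall s t : R, 0 <= s -> s <= t -> t <= T -> F s `<=` F t].

(* Completeness is required in the strong form: P.-negligible sets are the
   arbitrary subsets of measurable P-null sets, so (Omega, P) is complete. *)
Definition usual_conditions (T : R) (F : R -> set (set Omega)) : Prop :=
  (forall A : set Omega, P.-negligible A -> F 0 A) /\
  (forall t : R, 0 <= t -> t < T -> F t = \bigcap_(s in `]t, T]) F s).

Definition measurable_wrt (d : nat) (G : set (set Omega)) (X : rvec d) : Prop :=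
  forall i : 'I_d,
    measurable_fun [set: g_sigma_algebraType G]
      (fun w : g_sigma_algebraType G => X w ord0 i).

(* Lnorm P p is the essential supremum norm when p = +oo. *)
Definition Lp_norm (d : nat) (p : \bar R) (X : rvec d) : \bar R :=
  Lnorm P p (fun w => (enorm (X w))%:E).

Definition sup_norm (d : nat) (p : \bar R) (t : R) (X : process d) : \bar R :=
  Lnorm P p (fun w => ereal_sup [set (enorm (X s w))%:E | s in `[0, t]]).

Definition Lp (d : nat) (p : \bar R) (G : set (set Omega)) : set (rvec d) :=
  [set X | measurable_wrt G X /\ (Lp_norm p X < +oo)%E].

Definition rcll (d : nat) (T : R) (x : R -> 'rV[R]_d) : Prop :=
  (forall t : R, 0 <= t -> t < T -> x s @[s --> t^'+] --> x t) /\
  (forall t : R, 0 < t -> t <= T -> cvg (x s @[s --> t^'-])).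

Definition adapted (d : nat) (T : R) (F : R -> set (set Omega))
    (X : process d) : Prop :=
  forall t : R, t \in `[0, T] -> measurable_wrt (F t) (X t).

Definition progressively_measurable (d : nat) (T : R) (F : R -> set (set Omega))
    (X : process d) : Prop :=
  forall t : R, t \in `[0, T] -> forall i : 'I_d,
    measurable_fun (`[0, t]%classic `*` [set: g_sigma_algebraType (F t)])
      (fun sw : R * g_sigma_algebraType (F t) => X sw.1 sw.2 ord0 i).

Definition integrable_rvec (d : nat) (X : rvec d) : Prop :=
  forall i : 'I_d, P.-integrable [set: Omega] (fun w => (X w ord0 i)%:E).

(* Z is a version of the conditional expectation E[X | G]. *)
Definition is_cond_exp (d : nat) (G : set (set Omega)) (X Z : rvec d) : Prop :=
  [/\ measurable_wrt G Z, integrable_rvec Z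
    & forall A, G A -> forall i : 'I_d,
        (\int[P]_(w in A) (Z w ord0 i)%:E
         = \int[P]_(w in A) (X w ord0 i)%:E)%E].

Definition martingale (d : nat) (T : R) (F : R -> set (set Omega))
    (M : process d) : Prop :=
  [/\ adapted T F M,
      forall t : R, t \in `[0, T] -> integrable_rvec (M t)
    & forall s t : R, 0 <= s -> s <= t -> t <= T ->
        is_cond_exp (F s) (M t) (M s)].

Definition Sp (d : nat) (p : \bar R) (T : R) (F : R -> set (set Omega)) :
    set (process d) :=
  [set Y | [/\ adapted T F Y, forall w, rcll T (fun t => Y t w)
             & (sup_norm p T Y < +oo)%E]].

Definition Sp0 (d : nat) (p : \bar R) (T : R) (F : R -> set (set Omega)) :
    set (process d) :=
  [set Y | Sp p T F Y /\ {ae P, forall w, Y 0 w = 0}].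

Definition Mp0 (d : nat) (p : \bar R) (T : R) (F : R -> set (set Omega)) :
    set (process d) :=
  [set M | Sp0 p T F M /\ martingale T F M].

Definition indistinguishable (d : nat) (T : R) (X Y : process d) : Prop :=
  {ae P, forall w, forall t : R, t \in `[0, T] -> X t w = Y t w}.

(* f t w Y M; only its values for t in [0, T], Y in Sp and M in Mp0 matter. *)
Definition driver (d : nat) := R -> Omega -> process d -> process d -> 'rV[R]_d.

Definition driver_at (d : nat) (f : driver d) (Y M : process d) : process d :=
  fun t w => f t w Y M.

(* The integrability clause makes the pathwise integral in the equation
   meaningful: the library's integral is total. *)
Definition bsde_solution (d : nat) (p : \bar R) (T : R)
    (F : R -> set (set Omega)) (xi : rvec d) (f : driver d)
    (Y M : process d) : Prop :=
  [/\ Sp p T F Y, Mp0 p T F M,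
      {ae P, forall w, forall i : 'I_d,
        (@lebesgue_measure R).-integrable `[0, T]
          (fun s : R => (f s w Y M ord0 i)%:E)}
    & {ae P, forall w, forall t : R, t \in `[0, T] ->
        Y t w = xi w
          + \row_(i < d) (\int[@lebesgue_measure R]_(s in `[t, T])
                            f s w Y M ord0 i)
          + M T w - M t w}].

End stochastic_processes.

Arguments zero_process {disp} Omega R d.

(* Only used for 1 < p; the value at -oo is a dummy. *)
Definition bsde_const (R : realType) (p : \bar R) : R :=
  match p with
  | EFin r => if r == 2 then 1 / 5 else (r - 1) / (4 * r - 1)
  | +oo%E => 1 / 4
  | -oo%E => 0
  end.

(* Main.v *)
Require Import Defs.
From mathcomp Require Import all_boot all_order all_algebra.
From mathcomp Require Import all_classical all_reals all_analysis.
From mathcomp Require Import measurable_realfun ess_sup_inf.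
From mathcomp Require Import ring lra.
Set Implicit Arguments.
Unset Strict Implicit.
Unset Printing Implicit Defensive.
Import Order.TTheory GRing.Theory Num.Theory.
Import numFieldNormedType.Exports.
Local Open Scope classical_set_scope.
Local Open Scope ring_scope.

(** Freeze the driver: replace f(s, Y, M) by a progressively measurable g(s)
with an integrable p-norm.  The equation is then solved explicitly.  With
X_t = - int_0^t g and N the RCLL martingale closed by V = xi - X_T, the pair
Y = N + X, M = N_0 - N is a solution ([frozen_exists]).  The solution of the
full equation is obtained from the iteration that freezes the driver at the
previous pair (Y, M), starting from (0, 0).

Two features of a frozen solution make the iteration contract
([frozen_contraction]).  First, Y_t - Y_0 + M_t = - int_0^t g, so the part of
the Lipschitz bound carrying C1 sees only the drivers, and only up to time t.
Secondly, Y_0 - M_T = xi - X_T is the terminal value of the martingale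
Y_0 - M_t, and Y_0 and M are recovered from it by conditioning; the
contraction property of conditional expectation and Doob's maximal inequality
bound the part carrying C2 by K int_0^T |g - g'|_p with K = 2 + p/(p-1)
([martingale_decomposition_bound]); for p = oo, K = 3.  The number 1/K is at
least the constant c_p of the hypothesis ([bsde_const_bound]).

Distances between drivers are measured by the least B such that
|g(s) - g'(s)|_p <= B lam e^(lam s) for every s.  A Volterra term
C1 int_0^s costs C1 B (e^(lam s) - 1), the global term costs
C2 K B (e^(lam T) - 1), and the smallness of C2 allows a lam > C1 for which
the latter is at most C1 B ([weight_exponent_exists]).  The total is at most
C1 B e^(lam s), that is, B shrinks by the factor C1 / lam < 1
([close_driver]).  The bounds hold at every time s and not only for almost
every s, so successive drivers converge almost surely at every s; their limit
g is progressively measurable, and freezing at g gives a pair (Y, M) with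
f(s, Y, M) = g(s) almost surely for every s ([fixed_point_exists]).  The same
contraction, applied to two solutions, yields uniqueness
([fixed_point_unique]).

The analytic input is built from measure theory: Minkowski's integral
inequality and Fatou's lemma for p-norms, p in (1, oo]; conditional
expectations as Radon-Nikodym derivatives; Doob's inequality for the Euclidean
norm of a vector martingale; and the existence of an RCLL version of
E[V | F_t] ([rcll_version]), from the upcrossing inequality and the usual
conditions. *)

(** * Norms of order p on a probability space *)

Lemma measurable_ereal_sup_range d (T : measurableType d) (R : realType) (f : nat -> T -> \bar R) :
  (forall n, measurable_fun [set: T] (f n)) ->
  measurable_fun [set: T] (fun w => ereal_sup (range (fun n => f n w))).
Proof.
move=> mf; rewrite (_ : (fun w => _) = (fun w => esups (fun n => f n w) 0%N)).
  exact: measurable_fun_esups.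
by apply/funext => w; congr ereal_sup; apply/seteqP; split => _ [k _ <-]; exists k.
Qed.

Section Lp_norms.
Context (disp : measure_display) (Omega : measurableType disp) (R : realType).
Context (P : probability Omega R).
Implicit Types (u v : Omega -> \bar R) (p : \bar R).
Local Open Scope ereal_scope.

Lemma measurable_poweR_comp (u : Omega -> \bar R) (r : R) :
  measurable_fun [set: Omega] u -> measurable_fun [set: Omega] (fun w => u w `^ r).
Proof. by move=> mu; exact: (measurableT_comp (measurable_poweR _) mu). Qed.

Lemma le_poweR (r : R) (x y : \bar R) : (0 < r)%R -> 0 <= x -> 0 <= y ->
  (x `^ r <= y `^ r) = (x <= y).
Proof.
move=> r0 x0 y0; apply/idP/idP => h; last first.
  by apply: gt0_ler_poweR; rewrite ?(ltW r0)// ?in_itv/= ?leey ?andbT.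
have : (x `^ r) `^ r^-1 <= (y `^ r) `^ r^-1.
  by apply: gt0_ler_poweR; rewrite ?invr_ge0 ?(ltW r0)// ?in_itv/= ?leey ?andbT ?poweR_ge0.
by rewrite -!poweRrM mulfV ?gt_eqF// !poweRe1.
Qed.

Lemma Lnormy u : Lnorm P +oo u = ess_sup P (abse \o u).
Proof. by rewrite unlock; have /= -> := @probability_setT _ _ _ P; rewrite lte01. Qed.

Lemma ge0_ae_le_Lnorm p (u v : Omega -> \bar R) : 1 < p ->
  measurable_fun [set: Omega] u -> measurable_fun [set: Omega] v ->
  (forall w, 0 <= u w) -> (forall w, 0 <= v w) ->
  {ae P, forall w, u w <= v w} -> Lnorm P p u <= Lnorm P p v.
Proof.
move=> p1 mu mv u0 v0 uv; case: p p1 => // [r r1|_].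
- rewrite unlock; have r0 : (0 < r)%R by rewrite -lte_fin (lt_trans _ r1).
  rewrite le_poweR ?invr_gt0//;
    [|by apply: integral_ge0 => w _; exact: poweR_ge0..].
  apply: ae_ge0_le_integral => //.
  + by move=> w _; exact: poweR_ge0.
  + by apply: measurable_poweR_comp; exact: measurableT_comp.
  + by move=> w _; exact: poweR_ge0.
  + by apply: measurable_poweR_comp; exact: measurableT_comp.
  + apply: filterS uv => w uvw _; by rewrite le_poweR ?abse_ge0// !gee0_abs.
- rewrite !Lnormy; apply: le_ess_sup.
  by apply: filterS uv => w uvw; rewrite /= !gee0_abs.
Qed.

Lemma ae_eq_Lnorm p (u v : Omega -> \bar R) : 1 < p ->
  measurable_fun [set: Omega] u -> measurable_fun [set: Omega] v ->
  (forall w, 0 <= u w) -> (forall w, 0 <= v w) ->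
  {ae P, forall w, u w = v w} -> Lnorm P p u = Lnorm P p v.
Proof.
move=> p1 mu mv u0 v0 uv; apply/eqP; rewrite eq_le; apply/andP; split;
  apply: ge0_ae_le_Lnorm => //; apply: filterS uv => w ->; exact: lexx.
Qed.

Lemma Lnorm_pow (r : R) u : (0 < r)%R -> (forall w, 0 <= u w) ->
  (Lnorm P r%:E u) `^ r = \int[P]_w (u w `^ r).
Proof.
move=> r0 u0; rewrite poweR_Lnorm ?gt_eqF//.
by apply: eq_integral => w _; rewrite gee0_abs.
Qed.

Lemma Lnorm_le_pow (r : R) u (c : \bar R) : (0 < r)%R -> (forall w, 0 <= u w) ->
  0 <= c -> (Lnorm P r%:E u <= c) = (\int[P]_w (u w `^ r) <= c `^ r).
Proof. by move=> r0 u0 c0; rewrite -Lnorm_pow// le_poweR// Lnorm_ge0. Qed.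

Lemma ereal_between (l : R) (x : \bar R) : l%:E < x -> exists2 y : R, (l < y)%R & y%:E < x.
Proof.
case: x => [x|_|//].
- by rewrite lte_fin => lx; exists ((l + x) / 2)%R; rewrite ?lte_fin ?midf_lt.
- by exists (l + 1)%R; rewrite ?ltry// ltrDl.
Qed.

(** Lower semicontinuity of x `^ r on [0, +oo], in the form that feeds Fatou's
lemma. *)
Lemma poweR_liminf (r : R) (x_ : (\bar R)^nat) (x : \bar R) : (0 < r)%R ->
  (forall n, 0 <= x_ n) -> 0 <= x -> x_ @ \oo --> x ->
  x `^ r <= limn_einf (fun n => x_ n `^ r).
Proof.
move=> r0 x_0 x0 cvx.
rewrite limn_einf_lim; rewrite (cvg_lim _ (@cvg_einfs_sup R (fun n => x_ n `^ r)))//.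
set L := ereal_sup _.
have L0 : 0 <= L.
  apply: le_trans (ereal_sup_ubound _); last by exists 0%N.
  by apply: le_ereal_inf_tmp => _ [k _ <-]; exact: poweR_ge0.
have -> : L = (L `^ r^-1) `^ r by rewrite -poweRrM mulVf ?gt_eqF// poweRe1.
rewrite le_poweR ?poweR_ge0//.
rewrite leNgt; apply/negP => Lx.
have Lfin : L `^ r^-1 \is a fin_num.
  by rewrite ge0_fin_numE ?poweR_ge0// (lt_le_trans Lx) ?leey.
have [y ly yx] : exists2 y : R, (fine (L `^ r^-1) < y)%R & y%:E < x.
  by apply: ereal_between; rewrite fineK.
have y0 : 0 <= y%:E.
  by rewrite lee_fin (le_trans _ (ltW ly))// fine_ge0// poweR_ge0.
have : L < y%:E `^ r.
  have -> : L = (L `^ r^-1) `^ r by rewrite -poweRrM mulVf ?gt_eqF// poweRe1.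
  by rewrite ltNge le_poweR ?poweR_ge0// -ltNge -[L `^ _]fineK.
apply/negP; rewrite -leNgt.
have /cvx[N _ HN] : nbhs x [set z | y%:E < z].
  by apply: open_nbhs_nbhs; split => //; exact: open_ereal_gt_ereal.
apply: le_trans (ereal_sup_ubound _); last by exists N.
apply: le_ereal_inf_tmp => _ [k Nk <-]; rewrite le_poweR//.
by apply/ltW/HN.
Qed.

(** Norm bounds pass to almost sure limits; for p = +oo the bound already holds
pointwise almost surely, so it needs no integral argument. *)
Lemma Lnorm_fatou p (u_ : nat -> Omega -> \bar R) u (c : \bar R) : 1 < p ->
  (forall n, measurable_fun [set: Omega] (u_ n)) -> (forall n w, 0 <= u_ n w) ->
  measurable_fun [set: Omega] u -> (forall w, 0 <= u w) ->
  {ae P, forall w, u_ n w @[n --> \oo] --> u w} ->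
  (forall n, Lnorm P p (u_ n) <= c) -> Lnorm P p u <= c.
Proof.
move=> p1 mu_ u_0 mu u0 cvgu le_c.
have c0 : 0 <= c by apply: le_trans (le_c 0%N); exact: Lnorm_ge0.
case: p p1 le_c => // [r r1|_] le_c.
- have r0 : (0 < r)%R by rewrite -lte_fin (lt_trans _ r1).
  rewrite Lnorm_le_pow//.
  have fat := @fatou _ _ _ P setT measurableT (fun n w => u_ n w `^ r).
  apply: (@le_trans _ _ (\int[P]_w limn_einf (fun n => u_ n w `^ r))).
    apply: ae_ge0_le_integral => //.
    + by move=> *; exact: poweR_ge0.
    + exact: measurable_poweR_comp.
    + move=> w _; rewrite limn_einf_lim; apply: lime_ge; first exact: is_cvg_einfs.
      by apply: nearW => n; apply: le_ereal_inf_tmp => _ [k _ <-]; exact: poweR_ge0.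
    + have -> : (fun w => limn_einf (fun n => u_ n w `^ r)) =
          (fun w => - limn_esup (fun n => - (u_ n w `^ r))).
        apply/funext => w; rewrite -limn_einfN; congr limn_einf.
        by apply/funext => n /=; rewrite oppeK.
      apply: measurableT_comp => //; apply: measurable_fun_limn_esup => n.
      by apply: measurableT_comp => //; exact: measurable_poweR_comp.
    + by apply: filterS cvgu => w cw _; exact: poweR_liminf.
  apply: (le_trans (fat _ _)).
  + by move=> n; exact: measurable_poweR_comp.
  + by move=> *; exact: poweR_ge0.
  + rewrite limn_einf_lim; apply: lime_le; first exact: is_cvg_einfs.
    apply: nearW => n; apply: le_trans (ereal_inf_lbound _) _; first by exists n => /=.
    by rewrite -Lnorm_le_pow.
- rewrite Lnormy; apply/ess_supP.
  have /ae_foralln H : forall n, \forall w \ae P, u_ n w <= c.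
    move=> n; have := le_c n; rewrite Lnormy => /ess_supP.
    by apply: filterS => w /=; rewrite gee0_abs.
  apply: filterS2 H cvgu => w Hw cw /=; rewrite gee0_abs//.
  apply: (cvge_le _ cw); exact: nearW.
Qed.

Lemma Lnorm_fin_ae p u : 1 < p -> measurable_fun [set: Omega] u ->
  (forall w, 0 <= u w) -> Lnorm P p u < +oo -> {ae P, forall w, u w < +oo}.
Proof.
move=> p1 mu u0; case: p p1 => // [r r1|_] Nu.
- have r0 : (0 < r)%R by rewrite -lte_fin (lt_trans _ r1).
  have iu : P.-integrable setT (fun w => u w `^ r).
    apply/integrableP; split; first exact: measurable_poweR_comp.
    under eq_integral do rewrite gee0_abs ?poweR_ge0//.
    by rewrite -Lnorm_pow// poweR_lty.
  have := integrable_ae measurableT iu; apply: filterS => w /(_ I).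
  by rewrite ge0_fin_numE ?poweR_ge0// => /lty_poweRy -> //; rewrite gt_eqF.
- rewrite Lnormy in Nu; have := ess_sup_ge P (abse \o u).
  by apply: filterS => w /= /le_lt_trans /(_ Nu); rewrite gee0_abs.
Qed.

Lemma Lnorm_fine p u : 1 < p -> measurable_fun [set: Omega] u ->
  (forall w, 0 <= u w) -> Lnorm P p u < +oo ->
  Lnorm P p u = Lnorm P p (fun w => (fine (u w))%:E).
Proof.
move=> p1 mu u0 Nu; apply: ae_eq_Lnorm => //.
- by apply/measurable_EFinP; exact: measurableT_comp.
- by move=> w; rewrite lee_fin fine_ge0.
- apply: filterS (Lnorm_fin_ae p1 mu u0 Nu) => w uw.
  by rewrite fineK// ge0_fin_numE.
Qed.

(** Hoelder's inequality for the pair v, J^(r-1): the conjugate exponent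
r/(r-1) turns the second norm into a power of the norm of J.  This is the
shape produced by writing J^r = J J^(r-1). *)
Lemma Lnorm_hoelder (r : R) v (J : Omega -> R) : (1 < r)%R ->
  measurable_fun [set: Omega] v -> (forall w, 0 <= v w) ->
  measurable_fun [set: Omega] J -> (forall w, (0 <= J w)%R) ->
  \int[P]_w (v w * (J w `^ (r - 1))%:E) <=
  Lnorm P r%:E v * (Lnorm P r%:E (EFin \o J)) `^ (r - 1).
Proof.
move=> r1 mv v0 mJ J0.
have r0 : (0 < r)%R by rewrite (lt_trans _ r1).
have r10 : (r - 1 != 0)%R by rewrite subr_eq0 gt_eqF.
have mJr (s : R) : measurable_fun [set: Omega] (fun w => (J w `^ s)%R).
  by apply: (measurableT_comp (measurable_powR _)).
have [NJ0|NJ0] := eqVneq (Lnorm P r%:E (EFin \o J)) 0.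
  rewrite NJ0 poweR0r// mule0.
  have /Lnorm_eq0_eq0 : measurable_fun [set: Omega] (EFin \o J) by exact/measurable_EFinP.
  move=> /(_ P r%:E); rewrite lte_fin => /(_ r0 NJ0) aeJ.
  rewrite (ae_eq_integral (cst 0)) ?integral0//.
    apply: emeasurable_funM => //; exact/measurable_EFinP.
  apply: filterS aeJ => w /(_ I) /= [->] _; rewrite powR0// mule0//.
have [Nv|Nv] := eqVneq (Lnorm P r%:E v) +oo.
  by rewrite Nv gt0_mulye ?leey// poweR_gt0// lt0e NJ0 Lnorm_ge0.
have {}Nv : Lnorm P r%:E v < +oo by rewrite ltey.
have mfv : measurable_fun [set: Omega] (fun w => fine (v w)) by exact: measurableT_comp.
pose q := (r / (r - 1))%R.
have := @hoelder _ _ _ P (fun w => fine (v w)) (fun w => J w `^ (r - 1))%R r q mfv (mJr _) r0.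
have r1gt0 : (0 < r - 1)%R by rewrite subr_gt0.
have -> : (r^-1 + q^-1 = 1)%R by rewrite /q invf_div; field; rewrite ?gt_eqF.
rewrite divr_gt0// => /(_ isT erefl).
rewrite Lnorm1 -Lnorm_fine//; move=> H.
rewrite (_ : \int[P]_w _ = \int[P]_x `|(((fun w => fine (v w)) \* (fun w => J w `^ (r - 1))) x)%R%:E|); last first.
  apply: ae_eq_integral => //.
  - by apply: emeasurable_funM => //; exact/measurable_EFinP.
  - apply: measurableT_comp => //; apply/measurable_EFinP; exact: measurable_funM.
  - apply: filterS (Lnorm_fin_ae _ mv v0 Nv) => // w vw _ /=.
    rewrite -{1}(@fineK _ (v w)) ?ge0_fin_numE// ger0_norm//.
    by rewrite mulr_ge0 ?powR_ge0// fine_ge0.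
apply: (le_trans H); rewrite lee_wpmul2l ?Lnorm_ge0//.
rewrite unlock.
under eq_integral => w _ do rewrite /= (ger0_norm (powR_ge0 _ _)) -powRrM /q mulrC divfK//.
under [in leRHS]eq_integral => w _ do rewrite /= (ger0_norm (J0 _)).
by rewrite -poweRrM invf_div mulrC.
Qed.

Lemma L1_le_Lnorm p u : 1 < p -> measurable_fun [set: Omega] u ->
  (forall w, 0 <= u w) -> \int[P]_w u w <= Lnorm P p u.
Proof.
move=> p1 mu u0; case: p p1 => // [r r1|_].
- have := @Lnorm_hoelder r u (cst 1%R) r1 mu u0.
  under eq_integral do rewrite /= powR1 mule1.
  have -> : EFin \o cst 1%R = cst 1 :> (Omega -> \bar R) by [].
  rewrite Lnorm_cst1; have /= -> := @probability_setT _ _ _ P.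
  rewrite !poweR1r mule1.
  by apply.
- rewrite Lnormy.
  have h : {ae P, forall w, setT w -> u w <= ess_sup P (abse \o u)}.
    by have := ess_sup_ge P (abse \o u); apply: filterS => w; rewrite /= gee0_abs.
  apply: (le_trans (ae_ge0_le_integral measurableT _ _ _ _ h)) => //.
  + move=> w _; apply: ess_sup_gee; last by apply: nearW => w' /=; exact: abse_ge0.
    by have /= -> := @probability_setT _ _ _ P; rewrite lte01.
  + by rewrite integral_cst//; have /= -> := @probability_setT _ _ _ P; rewrite mule1.
Qed.

Lemma Lnorm_eq0_ae p u : 1 < p -> measurable_fun [set: Omega] u ->
  (forall w, 0 <= u w) -> Lnorm P p u <= 0 -> {ae P, forall w, u w = 0}.
Proof.
move=> p1 mu u0 Nu; have {Nu}N0 : Lnorm P p u = 0.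
  by apply/eqP; rewrite eq_le Nu Lnorm_ge0.
have := @Lnorm_eq0_eq0 _ _ _ P u p mu (lt_trans lte01 p1) N0.
by apply: filterS => w /(_ I).
Qed.

Lemma Lnorm_triangle p u v : 1 < p ->
  measurable_fun [set: Omega] u -> measurable_fun [set: Omega] v ->
  (forall w, 0 <= u w) -> (forall w, 0 <= v w) ->
  Lnorm P p (fun w => u w + v w) <= Lnorm P p u + Lnorm P p v.
Proof.
move=> p1 mu mv u0 v0.
have [->|Nu] := eqVneq (Lnorm P p u) +oo.
  by rewrite addye ?leey// gt_eqF// (lt_le_trans _ (Lnorm_ge0 _ _ _)).
have [->|Nv] := eqVneq (Lnorm P p v) +oo.
  by rewrite addey ?leey// gt_eqF// (lt_le_trans _ (Lnorm_ge0 _ _ _)).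
have {}Nu : Lnorm P p u < +oo by rewrite ltey.
have {}Nv : Lnorm P p v < +oo by rewrite ltey.
have mf : measurable_fun [set: Omega] (fine \o u) by exact: measurableT_comp.
have mg : measurable_fun [set: Omega] (fine \o v) by exact: measurableT_comp.
have := @eminkowski _ _ _ P _ _ p mf mg (ltW p1).
rewrite (Lnorm_fine p1 mu u0 Nu) (Lnorm_fine p1 mv v0 Nv); apply: le_trans.
apply: ge0_ae_le_Lnorm => //.
- exact: emeasurable_funD.
- by apply/measurable_EFinP; exact: measurable_funD.
- by move=> w; exact: adde_ge0.
- by move=> w; rewrite lee_fin addr_ge0// fine_ge0.
- apply: filterS2 (Lnorm_fin_ae p1 mu u0 Nu) (Lnorm_fin_ae p1 mv v0 Nv) => w uw vw.
  by rewrite /= EFinD !fineK// ge0_fin_numE.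
Qed.

(** Truncations are bounded real functions, hence have finite norms that can be
cancelled, and increase to u. *)
Definition trunc u (n : nat) (w : Omega) : R := fine (mine (u w) n%:R%:E).

Lemma trunc_ge0 u n w : 0 <= u w -> (0 <= trunc u n w)%R.
Proof. by move=> u0; rewrite fine_ge0// le_min u0 lee_fin ler0n. Qed.

Lemma truncE u n w : 0 <= u w -> (trunc u n w)%:E = mine (u w) n%:R%:E.
Proof.
move=> u0; rewrite fineK// ge0_fin_numE ?le_min ?u0 ?lee_fin//=.
by rewrite gt_min ltry orbT.
Qed.

Lemma trunc_le u n w : 0 <= u w -> (trunc u n w)%:E <= u w.
Proof. by move=> u0; rewrite truncE// ge_min lexx. Qed.

Lemma trunc_bounded u n w : 0 <= u w -> (trunc u n w <= n%:R)%R.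
Proof. by move=> u0; rewrite -lee_fin truncE// ge_min lexx orbT. Qed.

Lemma measurable_trunc u n : measurable_fun [set: Omega] u ->
  measurable_fun [set: Omega] (trunc u n).
Proof. by move=> mu; apply: measurableT_comp => //; exact: measurable_mine. Qed.

Lemma cvg_trunc u w : 0 <= u w -> (trunc u n w)%:E @[n --> \oo] --> u w.
Proof.
have cvg_mine (x : \bar R) : 0 <= x -> mine x n%:R%:E @[n --> \oo] --> x.
  case: x => [x|_|//].
  - move=> _; apply: cvg_near_cst; near=> n; rewrite min_l// lee_fin.
    by near: n; exact: nbhs_infty_ger.
  - apply/cvgeyPge => A; near=> n; rewrite min_r ?leey// lee_fin.
    by near: n; exact: nbhs_infty_ger.
by move=> u0; under eq_cvg do rewrite truncE//; exact: cvg_mine.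
Unshelve. all: by end_near. Qed.

(** If a quantity x satisfies x^r <= c x^(r-1) and is finite, then x <= c.
Truncation supplies the finiteness, and Fatou's lemma removes it. *)
Lemma Lnorm_bootstrap (r : R) u (c : \bar R) : (1 < r)%R ->
  measurable_fun [set: Omega] u -> (forall w, 0 <= u w) -> 0 <= c ->
  (forall n, \int[P]_w (trunc u n w `^ r)%:E <=
     c * (Lnorm P r%:E (EFin \o trunc u n)) `^ (r - 1)) ->
  Lnorm P r%:E u <= c.
Proof.
move=> r1 mu u0 c0 H; have r0 : (0 < r)%R by rewrite (lt_trans _ r1).
apply: (@Lnorm_fatou r%:E (fun n => EFin \o trunc u n)) => //.
- by move=> n; apply/measurable_EFinP; exact: measurable_trunc.
- by move=> n w; rewrite lee_fin trunc_ge0.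
- by apply: nearW => w /=; exact: cvg_trunc.
move=> n; have {H} := H n; set x := Lnorm _ _ _.
have -> : \int[P]_w (trunc u n w `^ r)%:E = x `^ r.
  by rewrite Lnorm_pow//= => w; rewrite lee_fin trunc_ge0.
have x0 : 0 <= x by exact: Lnorm_ge0.
have [->//|xn0] := eqVneq x 0.
case: c c0 => [c|_|//] c0; last by rewrite leey.
have xfin : x < +oo.
  rewrite (@le_lt_trans _ _ n%:R%:E) ?ltry//.
  rewrite Lnorm_le_pow//; last by move=> w; rewrite lee_fin trunc_ge0.
  apply: (@le_trans _ _ (\int[P]_w cst (n%:R%:E `^ r) w)).
    apply: ge0_le_integral => //.
    + by move=> w _; exact: poweR_ge0.
    + by apply: measurable_poweR_comp; apply/measurable_EFinP; exact: measurable_trunc.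
    + by move=> w _; rewrite le_poweR ?lee_fin ?trunc_ge0// trunc_bounded.
  by rewrite integral_cst//; have /= -> := @probability_setT _ _ _ P; rewrite mule1.
have : x \is a fin_num by rewrite ge0_fin_numE.
case: x x0 xn0 xfin => // x; rewrite lee_fin eqe => x0 xn0 _ _.
have xgt0 : (0 < x)%R by rewrite lt_neqAle eq_sym xn0.
rewrite !poweR_EFin -EFinM !lee_fin -(@mulr_powRB1 _ x r)// ler_pM2r//.
exact: powR_gt0.
Qed.

(** The integral of a nonnegative function is a supremum over the simple
functions below it, so it is monotone without any measurability.  This allows
integrating s |-> |g(s)|_p without discussing its measurability. *)
Lemma ge0_le_integral_nomeas d1 (T1 : measurableType d1)
    (m : {measure set T1 -> \bar R}) (D : set T1) (f g : T1 -> \bar R) :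
  (forall x, D x -> 0 <= f x) -> (forall x, D x -> f x <= g x) ->
  \int[m]_(x in D) f x <= \int[m]_(x in D) g x.
Proof.
move=> f0 fg; rewrite integral_mkcond [leRHS]integral_mkcond.
have f0D x : 0 <= (f \_ D) x by rewrite patchE; case: ifPn => // /[!inE]; auto.
have fgD x : (f \_ D) x <= (g \_ D) x.
  by rewrite !patchE; case: ifPn => // /[!inE]; auto.
rewrite !ge0_integralTE//; last by move=> x; exact: le_trans (fgD x).
by apply: le_ereal_sup => _ [k kf <-]; exists k => // x; exact: le_trans (fgD x).
Qed.

(** For finite p, write H^r = H H^(r-1) with H the inner integral, exchange
the integrals, apply Hoelder under the outer one and cancel by
[Lnorm_bootstrap].  For p = +oo, test H against the indicator of the set where
it exceeds the right-hand side. *)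
Lemma Lnorm_minkowski_integral d1 (T1 : measurableType d1)
    (m : {sigma_finite_measure set T1 -> \bar R}) (D : set T1) p
    (h : T1 * Omega -> \bar R) : 1 < p -> measurable D ->
  measurable_fun [set: T1 * Omega] h -> (forall z, 0 <= h z) ->
  Lnorm P p (fun w => \int[m]_(s in D) h (s, w)) <=
  \int[m]_(s in D) Lnorm P p (fun w => h (s, w)).
Proof.
move=> p1 mD mh0 h00.
pose h' (z : T1 * Omega) := h z * (\1_D z.1)%:E.
have mh : measurable_fun [set: T1 * Omega] h'.
  apply: emeasurable_funM => //; apply/measurable_EFinP.
  apply: (measurableT_comp (measurable_indic mD)) => //; exact: measurable_fst.
have h0 z : 0 <= h' z by rewrite mule_ge0// lee_fin.
have hE w : \int[m]_(s in D) h (s, w) = \int[m]_s h' (s, w).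
  rewrite integral_mkcond; apply: eq_integral => s _.
  by rewrite /h' /patch/= indicE; case: (s \in D); rewrite ?mule1 ?mule0.
have hN : \int[m]_(s in D) Lnorm P p (fun w => h (s, w)) = \int[m]_s Lnorm P p (fun w => h' (s, w)).
  rewrite integral_mkcond; apply: eq_integral => s _.
  rewrite /h' /patch/= indicE; case: (s \in D).
    by apply: eq_Lnorm => w; rewrite mule1.
  transitivity (Lnorm P p (cst 0)); last by apply: eq_Lnorm => w; rewrite mule0.
  by rewrite Lnorm0// gt_eqF// (lt_trans _ p1).
under [X in Lnorm _ _ X]eq_fun do rewrite hE.
rewrite hN.
have mH : measurable_fun [set: Omega] (fun w => \int[m]_s h' (s, w)).
  exact: (measurable_fun_fubini_tonelli_G h').
have mhs s : measurable_fun [set: Omega] (fun w => h' (s, w)).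
  by apply: measurableT_comp => //; exact: measurable_pair1.
have int0 : 0 <= \int[m]_s Lnorm P p (fun w => h' (s, w)).
  by apply: integral_ge0 => s _; exact: Lnorm_ge0.
have tonelli (W : Omega -> R) : measurable_fun [set: Omega] W -> (forall w, 0 <= W w)%R ->
    \int[P]_w ((\int[m]_s h' (s, w)) * (W w)%:E) = \int[m]_s \int[P]_w (h' (s, w) * (W w)%:E).
  move=> mW W0; rewrite (fubini_tonelli (fun z => h' z * (W z.2)%:E)) /=.
  - apply: eq_integral => w _; rewrite ge0_integralZr// ?lee_fin//.
    by apply: measurableT_comp => //; exact: measurable_pair2.
  - apply: emeasurable_funM => //; apply/measurable_EFinP.
    by apply: measurableT_comp => //; exact: measurable_snd.
  - by move=> z; rewrite mule_ge0// lee_fin.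
case: p p1 hN int0 => // [r r1|_] hN int0.
- have r0 : (0 < r)%R by rewrite -lte_fin (lt_trans _ r1).
  have mN : measurable_fun [set: T1] (fun s => Lnorm P r%:E (fun w => h' (s, w))).
    have -> : (fun s => Lnorm P r%:E (fun w => h' (s, w))) =
        (fun s => (\int[P]_w (h' (s, w) `^ r)) `^ r^-1).
      apply/funext => s; rewrite unlock; congr (_ `^ _).
      by apply: eq_integral => w _; rewrite gee0_abs.
    apply: (measurableT_comp (measurable_poweR _)).
    apply: (measurable_fun_fubini_tonelli_F (fun z => h' z `^ r)).
      exact: (measurableT_comp (measurable_poweR _)).
    by move=> z; exact: poweR_ge0.
  apply: Lnorm_bootstrap => //.
    by move=> w; exact: integral_ge0.
  move=> n; set H := fun w => \int[m]_s h' (s, w).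
  have H0 w : 0 <= H w by exact: integral_ge0.
  have mJ := measurable_trunc n mH.
  have mJr (a : R) : measurable_fun [set: Omega] (fun w => (trunc H n w `^ a)%R).
    by apply: (measurableT_comp (measurable_powR _)).
  apply: (@le_trans _ _ (\int[P]_w (H w * (trunc H n w `^ (r - 1))%:E))).
    apply: ge0_le_integral => //.
    + by move=> w _; rewrite lee_fin powR_ge0.
    + exact/measurable_EFinP.
    + by apply: emeasurable_funM => //; exact/measurable_EFinP.
    + move=> w _; rewrite -mulr_powRB1 ?trunc_ge0// EFinM lee_wpmul2r ?lee_fin ?powR_ge0//.
      exact: trunc_le.
  rewrite tonelli//; last by move=> w; exact: powR_ge0.
  rewrite -ge0_integralZr//; [|by move=> *; exact: Lnorm_ge0|exact: poweR_ge0].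
  apply: ge0_le_integral => //.
  + by move=> s _; apply: integral_ge0 => w _; rewrite mule_ge0// lee_fin powR_ge0.
  + apply: (measurable_fun_fubini_tonelli_F (fun z => h' z * (trunc H n z.2 `^ (r - 1))%:E)).
      apply: emeasurable_funM => //; apply/measurable_EFinP.
      by apply: (measurableT_comp (mJr _)); exact: measurable_snd.
    by move=> z; rewrite mule_ge0// lee_fin powR_ge0.
  + apply: emeasurable_funM => //; exact: measurable_cst.
  + by move=> s _; apply: Lnorm_hoelder => // w; exact: trunc_ge0.
- set c := \int[m]_s _ in int0 *.
  have [->|cfin] := eqVneq c +oo; first exact: leey.
  have {}cfin : c \is a fin_num by rewrite ge0_fin_numE// ltey.
  set H := fun w => \int[m]_s h' (s, w).
  have H0 w : 0 <= H w by exact: integral_ge0.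
  rewrite Lnormy; apply/lee_addgt0Pr => e e0; apply/ess_supP.
  pose A := [set w | c + e%:E < H w].
  have mA : measurable A.
    by rewrite -[A]setTI; exact: emeasurable_fun_o_infty.
  have PAfin : P A \is a fin_num by exact: fin_num_measure.
  have PA0 : 0 <= P A by [].
  suff PA : P A = 0.
    exists A; split => // w /= /negP; rewrite -ltNge /A/=.
    by rewrite gee0_abs.
  apply/eqP; rewrite eq_le PA0 andbT leNgt; apply/negP => PApos.
  have mI : measurable_fun [set: Omega] (\1_A : Omega -> R) by exact: measurable_indic.
  have lower : (c + e%:E) * P A <= \int[P]_w (H w * (\1_A w)%:E).
    rewrite -[in leLHS](setIT A) -integral_indic// -ge0_integralZl//; last 2 first.
    - exact/measurable_EFinP.
    - by rewrite adde_ge0// lee_fin ltW.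
    apply: ge0_le_integral => //.
    - by move=> w _; rewrite mule_ge0 ?lee_fin// adde_ge0// lee_fin ltW.
    - by apply: emeasurable_funM => //; exact/measurable_EFinP.
    - by apply: emeasurable_funM => //; exact/measurable_EFinP.
    - move=> w _; rewrite indicE; case: (boolP (w \in A)) => [|_]; last by rewrite !mule0.
      by rewrite inE /A/= !mule1 => /ltW.
  have upper : \int[P]_w (H w * (\1_A w)%:E) <= c * P A.
    have PAE : P A = (fine (P A))%:E by rewrite fineK.
    have PAgt0 : (0 < fine (P A))%R by rewrite -lte_fin -PAE.
    rewrite tonelli// PAE -lee_pdivrMr// -ge0_integralZr//; last 3 first.
    - apply: (measurable_fun_fubini_tonelli_F (fun z => h' z * (\1_A z.2)%:E)).
        apply: emeasurable_funM => //; apply/measurable_EFinP.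
        by apply: (measurableT_comp mI); exact: measurable_snd.
      by move=> z; rewrite mule_ge0// lee_fin.
    - by move=> s _; apply: integral_ge0 => w _; rewrite mule_ge0// lee_fin.
    - by rewrite lee_fin invr_ge0 ltW.
    apply: ge0_le_integral_nomeas => [s _|s _].
      rewrite mule_ge0 ?lee_fin ?invr_ge0 ?(ltW PAgt0)//.
      by apply: integral_ge0 => w _; rewrite mule_ge0// lee_fin.
    rewrite lee_pdivrMr// -PAE Lnormy.
    rewrite -[in leRHS](setIT A) -integral_indic// -ge0_integralZl//; last 2 first.
    - exact/measurable_EFinP.
    - by rewrite -Lnormy Lnorm_ge0.
    apply: ae_ge0_le_integral => //.
    - by move=> w _; rewrite mule_ge0// lee_fin.
    - by apply: emeasurable_funM => //; exact/measurable_EFinP.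
    - by move=> w _; rewrite mule_ge0 ?lee_fin// -Lnormy Lnorm_ge0.
    - by apply: emeasurable_funM => //; exact/measurable_EFinP.
    - have := ess_sup_ge P (abse \o (fun w => h' (s, w))); apply: filterS => w /= hw _.
      by rewrite lee_wpmul2r ?lee_fin// (le_trans _ hw)//= gee0_abs.
  have := le_trans lower upper; rewrite leNgt => /negP; apply.
  by rewrite lte_pmul2r// lteDl.
Qed.

(** The common last step of the contraction property of conditional expectation
and of Doob's inequality. *)
Lemma Lnorm_le_truncated (r D : R) u v : (1 < r)%R -> (0 <= D)%R ->
  measurable_fun [set: Omega] u -> (forall w, 0 <= u w) ->
  measurable_fun [set: Omega] v -> (forall w, 0 <= v w) ->
  (forall n, \int[P]_w (trunc u n w `^ r)%:E <=
     D%:E * \int[P]_w (v w * (trunc u n w `^ (r - 1))%:E)) ->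
  Lnorm P r%:E u <= D%:E * Lnorm P r%:E v.
Proof.
move=> r1 D0 mu u0 mv v0 H; apply: Lnorm_bootstrap => //.
  by rewrite mule_ge0 ?lee_fin ?Lnorm_ge0.
move=> n; apply: (le_trans (H n)); rewrite -muleA lee_wpmul2l ?lee_fin//.
apply: Lnorm_hoelder => //; first exact: measurable_trunc.
by move=> w; exact: trunc_ge0.
Qed.

End Lp_norms.

(** * The Euclidean norm *)

Section euclidean_norm.
Context (R : realType) (d : nat).
Implicit Types u v : 'rV[R]_d.

Lemma enorm_ge0 u : 0 <= enorm u.
Proof. exact: sqrtr_ge0. Qed.

Lemma sqr_enorm u : enorm u ^+ 2 = \sum_(i < d) u ord0 i ^+ 2.
Proof. by rewrite sqr_sqrtr// sumr_ge0// => i _; exact: sqr_ge0. Qed.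

Lemma abs_le_enorm u i : `|u ord0 i| <= enorm u.
Proof.
rewrite -sqrtr_sqr ler_wsqrtr// (bigD1 i)//= lerDl sumr_ge0// => j _.
exact: sqr_ge0.
Qed.

Lemma enorm_eq0 u : enorm u = 0 -> u = 0.
Proof.
move=> u0; apply/rowP => i; rewrite mxE; apply/eqP; rewrite -normr_le0.
by rewrite (le_trans (abs_le_enorm u i))// u0.
Qed.

Lemma enorm0 : enorm (0 : 'rV[R]_d) = 0.
Proof. by rewrite /enorm big1 ?sqrtr0// => i _; rewrite mxE expr0n. Qed.

Lemma enormN u : enorm (- u) = enorm u.
Proof. by rewrite /enorm; congr Num.sqrt; apply: eq_bigr => i _; rewrite mxE sqrrN. Qed.

(** Cauchy-Schwarz, by summing 2ab <= c b^2 + a^2/c with the constant c that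
balances the two sides. *)
Lemma dot_le_enorm u v : \sum_(i < d) u ord0 i * v ord0 i <= enorm u * enorm v.
Proof.
have [u0|u0] := eqVneq (enorm u) 0.
  by rewrite u0 mul0r big1// => i _; rewrite (enorm_eq0 u0) mxE mul0r.
have [v0|v0] := eqVneq (enorm v) 0.
  by rewrite v0 mulr0 big1// => i _; rewrite (enorm_eq0 v0) mxE mulr0.
have ugt0 : 0 < enorm u by rewrite lt_neqAle eq_sym u0 enorm_ge0.
have vgt0 : 0 < enorm v by rewrite lt_neqAle eq_sym v0 enorm_ge0.
rewrite -ler_pdivrMr// -(ler_pM2l (ltr0n R 2)).
have -> : 2%:R * enorm u = enorm u / enorm v ^+ 2 * enorm v ^+ 2 + (enorm u)^-1 * enorm u ^+ 2.
  by field; rewrite u0 v0.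
set c := enorm u / enorm v ^+ 2; rewrite !sqr_enorm !mulr_sumr -big_split/= mulr_suml mulr_sumr; apply: ler_sum => i _.
set a := u _ _; set b := v _ _; rewrite -subr_ge0.
have -> : c * b ^+ 2 + (enorm u)^-1 * a ^+ 2 - 2%:R * (a * b / enorm v) =
  enorm u * (b / enorm v - a / enorm u) ^+ 2 by rewrite /c; field; rewrite u0 v0.
by rewrite mulr_ge0 ?sqr_ge0// enorm_ge0.
Qed.

Lemma enormD u v : enorm (u + v) <= enorm u + enorm v.
Proof.
rewrite -(@ler_pXn2r _ 2) ?nnegrE ?addr_ge0 ?enorm_ge0//.
rewrite sqrrD sqr_enorm.
have -> : \sum_(i < d) (u + v) ord0 i ^+ 2 =
   enorm u ^+ 2 + (\sum_(i < d) u ord0 i * v ord0 i) *+ 2 + enorm v ^+ 2.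
  rewrite !sqr_enorm -sumrMnl -!big_split/=; apply: eq_bigr => i _.
  by rewrite mxE sqrrD.
by rewrite lerD2r lerD2l lerMn2r dot_le_enorm orbT.
Qed.

Lemma enorm_le_sum u : enorm u <= \sum_(i < d) `|u ord0 i|.
Proof.
rewrite -(@ler_pXn2r _ 2) ?nnegrE ?enorm_ge0 ?sumr_ge0//.
rewrite sqr_enorm.
elim: (index_enum _) => [|i s IH]; first by rewrite !big_nil expr0n.
rewrite !big_cons sqrrD; apply: (@le_trans _ _ (`|u ord0 i| ^+ 2 + (\sum_(j <- s) `|u ord0 j|) ^+ 2)).
  by rewrite lerD// real_normK// num_real.
rewrite -addrA lerD2l lerDr mulrn_wge0// mulr_ge0// sumr_ge0//.
Qed.

Lemma measurable_enorm d' (T : measurableType d') (D : set T) (X : T -> 'rV[R]_d) :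
  (forall i, measurable_fun D (fun w => X w ord0 i)) ->
  measurable_fun D (fun w => enorm (X w)).
Proof.
move=> mX.
have mS : measurable_fun D (fun w => \sum_(i < d) X w ord0 i ^+ 2).
  by apply: measurable_sum => i; exact: measurable_funX.
by apply: (measurableT_comp _ mS); apply: continuous_measurable_fun; exact: sqrt_continuous.
Qed.

Lemma integrable_enorm d' (T : measurableType d') (m : {measure set T -> \bar R})
    (D : set T) (X : T -> 'rV[R]_d) : measurable D ->
  (forall i, m.-integrable D (fun w => (X w ord0 i)%:E)) ->
  m.-integrable D (fun w => (enorm (X w))%:E).
Proof.
move=> mD iX.
have := @integrable_sum _ _ _ m D mD _ (index_enum 'I_d) xpredT (fun i w => `|X w ord0 i|%:E).
move=> /(_ (fun i _ => integrable_norm (iX i)))/le_integrable; apply => //.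
- apply/measurable_EFinP; apply: measurable_enorm => i.
  apply/measurable_EFinP; exact: measurable_int (iX i).
- move=> w _; rewrite sumEFin !abse_EFin lee_fin !ger0_norm ?enorm_ge0 ?sumr_ge0//.
  exact: enorm_le_sum.
Qed.

End euclidean_norm.

(** * Conditional expectation *)

Section sub_sigma_algebra.
Context (disp : measure_display) (Omega : measurableType disp) (R : realType).
Context (P : probability Omega R).
Implicit Types (G H : set (set Omega)).

(** Measurability with respect to G for functions with values in any measurable
space; [measurable_wrt] is this property for the coordinates of a vector. *)
Definition mwrt d' (U : sigmaRingType d') G (X : Omega -> U) :=
  measurable_fun [set: g_sigma_algebraType G] (X : g_sigma_algebraType G -> U).

Lemma mwrt_sub d' (U : sigmaRingType d') G H (X : Omega -> U) :
  sigma_algebra [set: Omega] G -> sigma_algebra [set: Omega] H -> G `<=` H ->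
  mwrt G X -> mwrt H X.
Proof.
move=> sG sH GH mX _ B mB; have := mX measurableT B mB.
rewrite /measurable/= !sigma_algebra_id//; exact: GH.
Qed.

Lemma mwrtP d' (U : measurableType d') G (X : Omega -> U) :
  sigma_algebra [set: Omega] G ->
  mwrt G X <-> (forall B, measurable B -> G (X @^-1` B)).
Proof.
move=> sG; split=> [mX B mB|H _ B mB].
  by have := mX measurableT B mB; rewrite setTI /measurable/= sigma_algebra_id.
by rewrite setTI /measurable/= sigma_algebra_id//; exact: H.
Qed.

Lemma mwrt_measurable d' (U : measurableType d') G (X : Omega -> U) :
  sigma_algebra [set: Omega] G -> G `<=` measurable ->
  mwrt G X -> measurable_fun [set: Omega] X.
Proof. by move=> sG mG /(mwrtP _ sG) H _ B mB; rewrite setTI; exact/mG/H. Qed.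

Lemma integrable_bounded_mul (h X : Omega -> R) (K : R) :
  measurable_fun [set: Omega] h -> (forall w, `|h w| <= K) ->
  P.-integrable setT (EFin \o X) -> P.-integrable setT (fun w => (h w * X w)%:E).
Proof.
move=> mh hK iX.
have mX : measurable_fun [set: Omega] X by apply/measurable_EFinP; exact: measurable_int iX.
apply: (le_integrable measurableT _ _ (integrableZl measurableT K iX)) => //.
  by apply/measurable_EFinP; exact: measurable_funM.
move=> w _ /=; rewrite lee_fin !normrM ler_wpM2r// (le_trans (hK w))//.
exact: ler_norm.
Qed.

(** The scalar counterpart of [is_cond_exp]. *)
Definition cexp G (X Z : Omega -> R) :=
  [/\ mwrt G Z, P.-integrable setT (EFin \o Z)
    & forall A, G A -> (\int[P]_(w in A) (Z w)%:E = \int[P]_(w in A) (X w)%:E)%E].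

Section with_G.
Context (G : set (set Omega)) (sG : sigma_algebra [set: Omega] G)
  (mG : G `<=` measurable).

Let id_G : Omega -> g_sigma_algebraType G := idfun.

Lemma sigma_algebraT : G [set: Omega].
Proof. by case: sG => G0 GC _; rewrite -[setT]setD0; exact: GC. Qed.

Lemma measurable_id_G : measurable_fun [set: Omega] id_G.
Proof.
move=> _ B; rewrite setTI /measurable/= sigma_algebra_id// => GB; exact: mG.
Qed.

(** The integral of X is a charge dominated by P; Radon-Nikodym is applied to
the images of both on the space whose measurable sets are those of G, so that
the density is G-measurable. *)
Lemma cexp_exists (X : Omega -> R) : P.-integrable setT (EFin \o X) ->
  exists Z, cexp G X Z.
Proof.
move=> iX.
pose m_mixin := isMeasurableFun.Build _ _ _ _ _ measurable_id_G.
pose idm : {mfun Omega >-> g_sigma_algebraType G} :=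
  MeasurableFun.Pack (MeasurableFun.Class m_mixin).
pose PG : probability (g_sigma_algebraType G) R := distribution P idm.
pose nu : {charge set (g_sigma_algebraType G) -> \bar R} :=
  measure_function_pushforward__canonical__charge_Charge (induced_charge iX) measurable_id_G.
have nuPG : nu `<< PG.
  apply/null_content_dominatesP => A mA PA0.
  rewrite /nu/= /pushforward /induced_charge.
  apply: null_set_integral.
  - by rewrite -[_ @^-1` _]setTI; exact: measurable_id_G.
  - apply: measurable_funTS; exact: (measurable_int P).
  - exact: PA0.
have [f [ffin fint fE]] : exists f : g_sigma_algebraType G -> \bar R,
    [/\ (forall x, f x \is a fin_num), PG.-integrable [set: g_sigma_algebraType G] f &
    forall A, measurable A -> nu A = (\int[PG]_(x in A) f x)%E].
  exists (Radon_Nikodym nu PG); split.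
  - by move=> x; exact: Radon_Nikodym_fin_num.
  - exact: Radon_Nikodym_integrable.
  - by move=> A mA; exact: Radon_Nikodym_integral.
have mf : measurable_fun [set: g_sigma_algebraType G] f by exact: (measurable_int PG).
have fintP : P.-integrable setT f.
  apply/integrableP; split; first exact: (mwrt_measurable sG mG mf).
  case/integrableP : fint => _.
  by rewrite ge0_integral_pushforward//; exact: measurableT_comp.
exists (fine \o f); split.
- exact: measurableT_comp.
- by rewrite (_ : EFin \o (fine \o f) = f)//; apply/funext => w /=; rewrite fineK.
- move=> A GA.
  have mA : (@measurable _ (g_sigma_algebraType G)) A by rewrite /measurable/= sigma_algebra_id.
  have -> : (\int[P]_(w in A) (X w)%:E = nu A)%E by [].
  rewrite fE// integral_pushforward//.
    by apply: eq_integral => w _ /=; rewrite fineK.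
  by apply: integrableS fintP => //; exact: mG.
Qed.

Import HBNNSimple.

(** Test functions pass from indicators to simple functions, to bounded
nonnegative functions by dominated convergence, and to bounded functions by
adding the constant K. *)
Lemma cexp_mul (X Z h : Omega -> R) (K : R) : P.-integrable setT (EFin \o X) ->
  cexp G X Z -> mwrt G h -> (forall w, `|h w| <= K) ->
  (\int[P]_w (h w * Z w)%:E = \int[P]_w (h w * X w)%:E)%E.
Proof.
move=> iX [mZ iZ ZX].
have ind A : G A -> (\int[P]_w (\1_A w * Z w)%:E = \int[P]_w (\1_A w * X w)%:E)%E.
  move=> GA; have E Y : (\int[P]_w (\1_A w * Y w)%:E = \int[P]_(w in A) (Y w)%:E)%E.
    rewrite [RHS]integral_mkcond; apply: eq_integral => w _.
    by rewrite /patch indicE; case: ifPn; rewrite ?mul1r ?mul0r.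
  by rewrite !E ZX.
have simple (f : {nnsfun (g_sigma_algebraType G) >-> R}) :
    (\int[P]_w (f w * Z w)%:E = \int[P]_w (f w * X w)%:E)%E.
  pose s : seq R := finmap.enum_fset (fset_set (range f)).
  have Gf y : G (f @^-1` [set y]).
    by apply: (mwrtP (f : Omega -> R) sG).1; [exact: measurable_funPT|exact: measurable_set1].
  have E Y : P.-integrable setT (EFin \o Y) ->
     (\int[P]_w (f w * Y w)%:E = \sum_(y <- s) y%:E * \int[P]_w (\1_(f @^-1` [set y]) w * Y w)%:E)%E.
    move=> iY.
    have iI y : P.-integrable setT (fun w => (\1_(f @^-1` [set y]) w * Y w)%:E).
      apply: (@integrable_bounded_mul _ _ 1) => //.
        by apply: measurable_indic; exact: mG.
      by move=> w; rewrite indicE; case: (_ \in _); rewrite ?normr1 ?normr0.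
    under eq_integral.
      move=> w _; rewrite fimfunE fsbig_finite//= mulr_suml -sumEFin.
      under eq_bigr do rewrite -mulrA EFinM.
      over.
    rewrite /= integral_sum//; last by move=> y; exact: integrableZl.
    by apply: eq_bigr => y _; rewrite integralZl.
  rewrite !E//; apply: eq_bigr => y _; rewrite ind//.
have nneg (g : Omega -> R) : mwrt G g -> (forall w, 0 <= g w <= K + K)%R ->
   (\int[P]_w (g w * Z w)%:E = \int[P]_w (g w * X w)%:E)%E.
  move=> mg g0.
  have mgE : measurable_fun [set: g_sigma_algebraType G] (EFin \o g) by exact/measurable_EFinP.
  pose a := nnsfun_approx measurableT mgE.
  have a_g n w : (0 <= a n w <= g w)%R.
    apply/andP; split; first exact: fun_ge0.
    rewrite -lee_fin.
    have gE0 w' : [set: g_sigma_algebraType G] w' -> (0 <= (EFin \o g) w')%E.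
      by rewrite lee_fin; case/andP: (g0 w').
    apply: (cvge_ge _ (cvg_nnsfun_approx measurableT mgE gE0 (I : setT w))).
    exists n => // k /= nk; rewrite lee_fin.
    by have /lefP := nd_nnsfun_approx measurableT mgE nk; exact.
  have cvgY Y : P.-integrable setT (EFin \o Y) ->
      (\int[P]_w (a n w * Y w)%:E @[n --> \oo] --> \int[P]_w (g w * Y w)%:E)%E.
    move=> iY.
    have mY : measurable_fun [set: Omega] Y by apply/measurable_EFinP; exact: (measurable_int P).
    have mgO : measurable_fun [set: Omega] g by exact: mwrt_measurable mg.
    have := @dominated_convergence _ _ _ P setT measurableT
      (fun n w => (a n w * Y w)%:E) (fun w => (g w * Y w)%:E) (fun w => ((K + K) * `|Y w|)%:E).
    case => //.
    - move=> n; apply/measurable_EFinP; apply: measurable_funM => //.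
      apply: (mwrt_measurable sG mG); exact: measurable_funPT.
    - by apply/measurable_EFinP; exact: measurable_funM.
    - apply: nearW => w _.
      have gE0 w' : [set: g_sigma_algebraType G] w' -> (0 <= (EFin \o g) w')%E.
        by rewrite lee_fin; case/andP: (g0 w').
      exact: (cvgeZr (y := (Y w)%:E) _ (cvg_nnsfun_approx measurableT mgE gE0 (I : setT w))).
    - by apply: (integrableZl measurableT (K + K) (integrable_norm iY)).
    - apply: nearW => w n _ /=; rewrite lee_fin normrM ler_wpM2r//.
      by case/andP: (a_g n w) => a0 ag; rewrite ger0_norm// (le_trans ag)//; case/andP: (g0 w).
  have := cvgY _ iX; have := cvgY _ iZ.
  under eq_cvg do rewrite simple.
  by move=> c1 c2; have := cvg_unique _ c1 c2; apply.
move=> mh hK.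
have iC Y : P.-integrable setT (EFin \o Y) -> P.-integrable setT (fun w => (h w * Y w)%:E).
  by move=> iY; apply: integrable_bounded_mul iY => //; exact: mwrt_measurable mh.
have K0 : (0 <= K)%R by exact: le_trans (hK point).
have := nneg (fun w => h w + K)%R.
have E Y : P.-integrable setT (EFin \o Y) ->
   (\int[P]_w ((h w + K) * Y w)%:E = \int[P]_w (h w * Y w)%:E + K%:E * \int[P]_w (Y w)%:E)%E.
  move=> iY; under eq_integral do rewrite mulrDl EFinD.
  rewrite integralD//; [|exact: iC|exact: (integrableZl measurableT K iY)].
  by congr (_ + _)%E; rewrite -integralZl.
rewrite !E// => H.
rewrite (ZX _ sigma_algebraT) in H.
have fK : (K%:E * \int[P]_w (X w)%:E \is a fin_num)%E.
  by rewrite fin_numM// integrable_fin_num.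
rewrite -[LHS](addeK _ fK) H ?addeK//.
- by apply: measurable_funD => //; exact: mh.
- move=> w; have := hK w; rewrite ler_norml => /andP[h1 h2].
  by rewrite -lerBlDr sub0r h1 lerD2r.
Qed.

Context (d : nat).
Implicit Types X Z : rvec Omega R d.

Lemma measurable_rvec_enorm X : integrable_rvec P X ->
  measurable_fun [set: Omega] (fun w => enorm (X w)).
Proof.
move=> iX; apply: measurable_enorm => i; apply/measurable_EFinP.
exact: measurable_int (iX i).
Qed.

Lemma is_cond_exp_cexp X Z i : is_cond_exp P G X Z ->
  cexp G (fun w => X w ord0 i) (fun w => Z w ord0 i).
Proof. by case=> mZ iZ ZX; split; [exact: mZ|exact: iZ|move=> A GA; exact: ZX]. Qed.

Lemma mwrt_enorm Z : measurable_wrt G Z -> mwrt G (fun w => enorm (Z w)).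
Proof. by move=> mZ; exact: measurable_enorm. Qed.

(** Conditional Jensen for the Euclidean norm, in integrated form.  As
|Z| = <Z/|Z|, Z> and Z/|Z| is bounded and G-measurable, Z may be replaced by X
in the scalar product, and <Z/|Z|, X> <= |X|. *)
Lemma cond_exp_enorm_le X Z (h : Omega -> R) (K : R) : integrable_rvec P X ->
  is_cond_exp P G X Z -> mwrt G h -> (forall w, 0 <= h w <= K) ->
  (\int[P]_w (h w * enorm (Z w))%:E <= \int[P]_w (h w * enorm (X w))%:E)%E.
Proof.
move=> iX ZX mh hK; have [mZ iZ _] := ZX.
have mhO : measurable_fun [set: Omega] h by exact: mwrt_measurable mh.
have iE (Y : rvec Omega R d) : integrable_rvec P Y -> P.-integrable setT (fun w => (h w * enorm (Y w))%:E).
  move=> iY; apply: (@integrable_bounded_mul _ _ K) => //; last exact: (integrable_enorm measurableT iY).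
  by move=> w; have /andP[h0 hk] := hK w; rewrite ger0_norm.
(* Where Z vanishes the quotient is 0 by convention, and both sides are 0. *)
pose c i w := h w * (Z w ord0 i / enorm (Z w)).
have cK i w : `|c i w| <= K.
  have /andP[h0 hk] := hK w; rewrite /c normrM ger0_norm// (le_trans _ hk)//.
  rewrite ler_piMr// normrM normfV (ger0_norm (enorm_ge0 _)).
  have [->|Z0] := eqVneq (enorm (Z w)) 0; first by rewrite invr0 mulr0.
  rewrite ler_pdivrMr ?mul1r ?abs_le_enorm//.
  by rewrite lt_neqAle eq_sym Z0 enorm_ge0.
have mc i : mwrt G (c i).
  apply: measurable_funM => //; apply: measurable_funM; first exact: mZ.
  under eq_fun do rewrite -powR_inv1 ?enorm_ge0//.
  apply: (measurableT_comp (measurable_powR _)); exact: mwrt_enorm.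
have mcO i : measurable_fun [set: Omega] (c i) by exact: mwrt_measurable (mc i).
have ic i (Y : rvec Omega R d) : integrable_rvec P Y -> P.-integrable setT (fun w => (c i w * Y w ord0 i)%:E).
  by move=> iY; apply: (@integrable_bounded_mul _ _ K) => //; exact: iY.
have -> : (\int[P]_w (h w * enorm (Z w))%:E = \int[P]_w \sum_(i < d) (c i w * Z w ord0 i)%:E)%E.
  apply: eq_integral => w _; rewrite sumEFin; congr EFin.
  have [Z0|Z0] := eqVneq (enorm (Z w)) 0.
    by rewrite Z0 mulr0 big1// => i _; rewrite (enorm_eq0 Z0) mxE mulr0.
  under eq_bigr do rewrite /c -mulrA; rewrite -mulr_sumr; congr (_ * _).
  apply: (mulIf Z0); rewrite -expr2 sqr_enorm mulr_suml; apply: eq_bigr => i _.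
  by field.
rewrite integral_sum//; last by move=> i; exact: ic.
under eq_bigr.
  move=> i _; rewrite (cexp_mul (iX i) (is_cond_exp_cexp i ZX) (mc i) (cK i)).
  over.
rewrite -integral_sum//; last by move=> i; exact: ic.
apply: le_integral => //.
- by apply: integrable_sum => // i _; exact: ic.
- exact: iE.
move=> w _; rewrite sumEFin lee_fin.
have /andP[h0 _] := hK w.
under eq_bigr do rewrite /c -!mulrA; rewrite -mulr_sumr ler_wpM2l//.
under eq_bigr do rewrite mulrCA; rewrite -mulr_sumr.
have [->|Z0] := eqVneq (enorm (Z w)) 0; first by rewrite invr0 mul0r enorm_ge0.
by rewrite mulrC ler_pdivrMr ?lt_neqAle 1?eq_sym ?Z0 ?enorm_ge0// mulrC dot_le_enorm.
Qed.

(** For finite p the weight in [cond_exp_enorm_le] is a truncation of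
|Z|^(p-1); for p = +oo it is the indicator of the set where |Z| exceeds the
norm of X. *)
Lemma Lnorm_cond_exp_le p X Z : (1 < p)%E -> integrable_rvec P X ->
  is_cond_exp P G X Z -> (Lp_norm P p Z <= Lp_norm P p X)%E.
Proof.
move=> p1 iX ZX; have [mZ iZ _] := ZX.
have mZ' := measurable_rvec_enorm iZ; have mX' := measurable_rvec_enorm iX.
have mEZ : measurable_fun [set: Omega] (EFin \o (fun w => enorm (Z w))) by exact/measurable_EFinP.
have mEX : measurable_fun [set: Omega] (EFin \o (fun w => enorm (X w))) by exact/measurable_EFinP.
rewrite /Lp_norm; case: p p1 => // [r r1|_].
- have r0 : 0 < r by rewrite -lte_fin (lt_trans _ r1).
  rewrite -[leRHS]mul1e; apply: Lnorm_le_truncated => //.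
  + by move=> w; rewrite lee_fin enorm_ge0.
  + by move=> w; rewrite lee_fin enorm_ge0.
  move=> n; rewrite mul1e; set J := trunc _ n.
  have J0 w : 0 <= J w by rewrite trunc_ge0// lee_fin enorm_ge0.
  have Jn w : J w <= n%:R by rewrite trunc_bounded// lee_fin enorm_ge0.
  have mJ : mwrt G J.
    apply: measurableT_comp => //; apply: measurable_mine => //.
    by apply/measurable_EFinP; exact: mwrt_enorm.
  have mJO : measurable_fun [set: Omega] J by exact: mwrt_measurable mJ.
  have mJr : mwrt G (fun w => J w `^ (r - 1)).
    by apply: (measurableT_comp (measurable_powR _)); exact: mJ.
  apply: (@le_trans _ _ (\int[P]_w (J w `^ (r - 1) * enorm (Z w))%:E)%E).
    apply: ge0_le_integral => //.
    + by move=> w _; rewrite lee_fin powR_ge0.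
    + by apply/measurable_EFinP; apply: (measurableT_comp (measurable_powR _)).
    + apply/measurable_EFinP/measurable_funM => //.
      exact: mwrt_measurable mJr.
    + move=> w _; rewrite lee_fin -mulr_powRB1// mulrC ler_wpM2l ?powR_ge0//.
      by rewrite -lee_fin trunc_le// lee_fin enorm_ge0.
  rewrite [leRHS](_ : _ = \int[P]_w (J w `^ (r - 1) * enorm (X w))%:E)%E; last first.
    by apply: eq_integral => w _; rewrite muleC.
  apply: (@cond_exp_enorm_le _ _ _ (n%:R `^ (r - 1))) => // w.
  by rewrite powR_ge0/= ge0_ler_powR ?nnegrE// subr_ge0 ltW.
- rewrite !Lnormy; set c := ess_sup _ (_ \o (fun w => (enorm (X w))%:E)).
  have c0 : (0 <= c)%E by rewrite /c -Lnormy Lnorm_ge0.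
  have [->|cfin] := eqVneq c +oo%E; first exact: leey.
  have {}cfin : c \is a fin_num by rewrite ge0_fin_numE// ltey.
  apply/lee_addgt0Pr => e e0; apply/ess_supP.
  pose A := [set w | fine c + e < enorm (Z w)].
  have GA : G A.
    have -> : A = (fun w => enorm (Z w)) @^-1` `]fine c + e, +oo[%classic.
      by apply/seteqP; split => w /=; rewrite /A /= in_itv/= andbT.
    by apply: (mwrtP _ sG).1; [exact: mwrt_enorm|exact: measurable_itv].
  have mA := mG GA.
  suff PA : P A = 0%E.
    exists A; split => // w /= /negP; rewrite -ltNge /A/=.
    by rewrite ger0_norm ?enorm_ge0// -[c]fineK// lte_fin.
  have mI : mwrt G (\1_A : Omega -> R).
    by apply: measurable_indic; rewrite /measurable/= sigma_algebra_id.
  have mIO : measurable_fun [set: Omega] (\1_A : Omega -> R) by exact: measurable_indic.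
  have IntA (a : R) : 0 <= a -> (a%:E * P A = \int[P]_w (a%:E * (\1_A w)%:E))%E.
    move=> a0; rewrite ge0_integralZl//; last exact/measurable_EFinP.
    by rewrite integral_indic// setIT.
  have c0' : 0 <= fine c by rewrite fine_ge0.
  have h1 : ((fine c + e)%:E * P A <= \int[P]_w (\1_A w * enorm (Z w))%:E)%E.
    rewrite IntA; last by rewrite addr_ge0// ltW.
    apply: ge0_le_integral => //.
    + by move=> w _; rewrite lee_fin mulr_ge0 ?addr_ge0// ltW.
    + by apply: emeasurable_funM => //; exact/measurable_EFinP.
    + by apply/measurable_EFinP; exact: measurable_funM.
    + move=> w _; rewrite lee_fin indicE; case: (boolP (w \in A)) => [|_]; last by rewrite mulr0 mul0r.
      by rewrite inE /A/= mulr1 mul1r => /ltW.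
  have h2 : (\int[P]_w (\1_A w * enorm (X w))%:E <= (fine c)%:E * P A)%E.
    rewrite IntA//; apply: ae_ge0_le_integral => //.
    + by move=> w _; rewrite lee_fin mulr_ge0// enorm_ge0.
    + by apply/measurable_EFinP; exact: measurable_funM.
    + by move=> w _; rewrite lee_fin mulr_ge0.
    + by apply: emeasurable_funM => //; exact/measurable_EFinP.
    + have := ess_sup_ge P (abse \o (fun w => (enorm (X w))%:E)); rewrite -/c.
      apply: filterS => w /=; rewrite ger0_norm ?enorm_ge0// -[c]fineK// lee_fin => h _.
      by rewrite lee_fin mulrC ler_wpM2r.
  have h3 : ((fine c + e)%:E * P A <= (fine c)%:E * P A)%E.
    apply: (le_trans h1); apply: le_trans h2; apply: (@cond_exp_enorm_le _ _ _ 1) => // w.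
    by rewrite indicE; case: (_ \in _); rewrite ?lexx ?ler01.
  apply/eqP; rewrite eq_le measure_ge0// andbT leNgt; apply/negP => PA0.
  have : P A \is a fin_num by exact: fin_num_measure.
  move: PA0 h3; case: (P A) => [a| |]//; rewrite lte_fin -!EFinM lee_fin => a0 + _.
  by rewrite ler_pM2r// gerDl leNgt e0.
Qed.

End with_G.
End sub_sigma_algebra.

(** * Doob's maximal inequality *)

(** One step of a pathwise proof of Doob's inequality: m is the running maximum,
truncated at K, and s the new value of the submartingale.  If the maximum
moves, then m' <= s, and the claim is Young's inequality for m' m^(r-1). *)
Lemma doob_pathwise (R : realType) (r m s K : R) : 1 < r -> 0 <= m -> 0 <= s -> 0 <= K ->
  let m' := Num.max m (Num.min s K) in
  (1 - r^-1) * m' `^ r + s * m `^ (r - 1) <= (1 - r^-1) * m `^ r + s * m' `^ (r - 1).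
Proof.
move=> r1 m0 s0 K0 /=; set m' := Num.max _ _.
have r0 : 0 < r by rewrite (lt_trans _ r1).
have r10 : 0 < r - 1 by rewrite subr_gt0.
have [mm'|mm'] := leP (Num.min s K) m; first by rewrite /m' max_l.
have m'E : m' = Num.min s K by rewrite /m' max_r// ltW.
have m's : m' <= s by rewrite m'E ge_min lexx.
have mm : m <= m' by rewrite m'E ltW.
have m'0 : 0 <= m' by rewrite (le_trans m0).
have q0 : 0 < r / (r - 1) by rewrite divr_gt0.
have := @conjugate_powR R m' (m `^ (r - 1)) r (r / (r - 1)) m'0 (powR_ge0 _ _) r0 q0.
have -> : r^-1 + (r / (r - 1))^-1 = 1 by rewrite invf_div; field; rewrite ?gt_eqF.
move=> /(_ erefl); rewrite -powRrM (_ : (r - 1) * (r / (r - 1)) = r); last by field; rewrite gt_eqF.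
rewrite (_ : m `^ r / (r / (r - 1)) = (1 - r^-1) * m `^ r); last by rewrite invf_div; field; rewrite gt_eqF.
move=> young.
have h : m' * (m' `^ (r - 1) - m `^ (r - 1)) <= s * (m' `^ (r - 1) - m `^ (r - 1)).
  by rewrite ler_wpM2r// subr_ge0 ge0_ler_powR ?nnegrE// ltW.
have e := mulr_powRB1 m'0 r0.
have e1 : m' `^ r / r = r^-1 * m' `^ r by rewrite mulrC.
rewrite mulrBr e in h; rewrite e1 in young.
set x := m' `^ r in h young *; set y := m `^ r in young *.
lra.
Qed.

Definition doob_const (R : realType) (p : \bar R) : R :=
  if p is r%:E then r / (r - 1) else 1.

Lemma foldl_max_min (R : realType) (K a : R) (f : R -> R) (ts : seq R) : 0 <= K -> 0 <= a <= K ->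
  foldl (fun a t => Num.max a (Num.min (f t) K)) a ts =
  Num.max a (Num.min (\big[Num.max/0]_(t <- ts) f t) K).
Proof.
move=> K0; elim: ts a => [|t ts IH] a /andP[a0 aK] /=.
  by rewrite big_nil min_l// max_l.
rewrite IH; last by rewrite le_max a0/= ge_max aK ge_min lexx orbT.
rewrite big_cons -maxA; congr Num.max.
by rewrite -min_maxl.
Qed.

Section doob.
Context (disp : measure_display) (Omega : measurableType disp) (R : realType).
Context (P : probability Omega R) (T : R) (F : R -> set (set Omega)).
Hypothesis hF : is_filtration T F.
Context (d : nat) (V : rvec Omega R d) (x : process Omega R d).
Hypothesis iV : integrable_rvec P V.
Hypothesis Vx : forall t, t \in `[0, T] -> is_cond_exp P (F t) V (x t).

Let sF t : t \in `[0, T] -> sigma_algebra [set: Omega] (F t).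
Proof. by case: hF => H _ _; exact: H. Qed.
Let mF t : t \in `[0, T] -> F t `<=` measurable.
Proof. by case: hF => _ H _; exact: H. Qed.
Let leF s t : s \in `[0, T] -> t \in `[0, T] -> s <= t -> F s `<=` F t.
Proof.
by case: hF => _ _ H; rewrite !in_itv/= => /andP[s0 _] /andP[_ tT] st; exact: H.
Qed.

Lemma cond_exp_tower s t : s \in `[0, T] -> t \in `[0, T] -> s <= t ->
  is_cond_exp P (F s) (x t) (x s).
Proof.
move=> hs ht st; have [ms ims es] := Vx hs; have [mt imt et] := Vx ht.
split => // A FA i; rewrite es// et//; exact: (leF hs ht st).
Qed.

Let ix t : t \in `[0, T] -> integrable_rvec P (x t).
Proof. by move=> /Vx[]. Qed.

Let mx t : t \in `[0, T] -> mwrt (F t) (fun w => enorm (x t w)).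
Proof. by move=> /Vx[m _ _]; exact: mwrt_enorm. Qed.

(** Induction over the times still to come.  The hypothesis on (t, m) is the
inequality to be proved with the final value replaced by the current one;
[doob_pathwise] propagates it to the next time, and conditioning replaces
x t by the later x t', at the end by V. *)
Lemma doob_running_max (r K : R) (ts : seq R) : 1 < r -> 0 <= K ->
  forall t (m : Omega -> R), path <=%R t ts -> all (fun t => t \in `[0, T]) (t :: ts) ->
  mwrt (F t) m -> (forall w, 0 <= m w <= K) ->
  ((1 - r^-1)%:E * \int[P]_w (m w `^ r)%:E <= \int[P]_w (m w `^ (r - 1) * enorm (x t w))%:E)%E ->
  let m' w := foldl (fun a t => Num.max a (Num.min (enorm (x t w)) K)) (m w) ts in
  ((1 - r^-1)%:E * \int[P]_w (m' w `^ r)%:E <= \int[P]_w (m' w `^ (r - 1) * enorm (V w))%:E)%E.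
Proof.
move=> r1 K0; have r0 : 0 < r by rewrite (lt_trans _ r1).
have r10 : 0 < r - 1 by rewrite subr_gt0.
have c0 : 0 <= 1 - r^-1 by rewrite subr_ge0 invf_le1// ltW.
have pK (m : R) : 0 <= m <= K -> 0 <= m `^ (r - 1) <= K `^ (r - 1).
  by move=> /andP[m0 mK]; rewrite powR_ge0/= ge0_ler_powR ?nnegrE// ltW.
have mp t (m : Omega -> R) s : mwrt (F t) m -> mwrt (F t) (fun w => m w `^ s).
  by move=> mm; apply: (measurableT_comp (measurable_powR _)); exact: mm.
elim: ts => [|t' ts IH] t m /=.
  move=> _ /andP[ht _] mm mK H; apply: (le_trans H).
  apply: (cond_exp_enorm_le (sF ht) (mF ht) iV (Vx ht) (K := K `^ (r - 1))).
    exact: mp.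
  by move=> w; exact: pK.
move=> /andP[tt' pts] /and3P[ht ht' hts] mm mK H.
pose m1 w := Num.max (m w) (Num.min (enorm (x t' w)) K).
have m1K w : 0 <= m1 w <= K.
  have /andP[m0 mk] := mK w.
  by rewrite le_max m0/= ge_max mk ge_min lexx orbT.
have mm' : mwrt (F t') m by apply: mwrt_sub (leF ht ht' tt') mm; exact: sF.
have mm1 : mwrt (F t') m1.
  apply: measurable_maxr => //; apply: measurable_minr => //.
  exact: mx.
apply: (IH t' m1) => //; first by rewrite /= ht'.
have mO (g : Omega -> R) : mwrt (F t') g -> measurable_fun [set: Omega] g.
  by move=> mg; exact: (mwrt_measurable (sF ht') (mF ht') mg).
have mxO := mO _ (mx ht').
have mmO s := mO _ (mp _ _ s mm'). have mm1O s := mO _ (mp _ _ s mm1).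
have iE (g : Omega -> R) : mwrt (F t') g -> (forall w, 0 <= g w <= K `^ (r - 1)) ->
    P.-integrable setT (fun w => (g w * enorm (x t' w))%:E).
  move=> mg gK; apply: (@integrable_bounded_mul _ _ _ _ _ _ (K `^ (r - 1))).
  - exact: mO.
  - by move=> w; have /andP[g0 gk] := gK w; rewrite ger0_norm.
  - exact: (integrable_enorm measurableT (ix ht')).
set a := (\int[P]_w (m w `^ (r - 1) * enorm (x t' w))%:E)%E.
have afin : a \is a fin_num.
  by apply: integrable_fin_num => //; apply: iE; [exact: mp|move=> w; exact: pK].
rewrite -(leeD2rE _ _ afin).
have Hm : (((1 - r^-1)%:E * \int[P]_w (m w `^ r)%:E) <= a)%E.
  apply: (le_trans H).
  apply: (cond_exp_enorm_le (sF ht) (mF ht) (ix ht') (cond_exp_tower ht ht' tt') (K := K `^ (r - 1))).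
    exact: mp.
  by move=> w; exact: pK.
rewrite [leRHS]addeC; apply: (@le_trans _ _ (((1 - r^-1)%:E * \int[P]_w (m w `^ r)%:E) +
   \int[P]_w (m1 w `^ (r - 1) * enorm (x t' w))%:E)%E); last exact: leeD2r.
have E (g h : Omega -> R) : mwrt (F t') g -> mwrt (F t') h ->
   (forall w, 0 <= g w <= K) -> (forall w, 0 <= h w <= K) ->
   ((1 - r^-1)%:E * \int[P]_w (g w `^ r)%:E + \int[P]_w (h w `^ (r - 1) * enorm (x t' w))%:E =
    \int[P]_w ((1 - r^-1) * g w `^ r + enorm (x t' w) * h w `^ (r - 1))%:E)%E.
  move=> mg mh gK hK; rewrite -ge0_integralZl//; last 2 first.
  - by apply/measurable_EFinP; apply: mO; exact: mp.
  - by move=> w _; rewrite lee_fin powR_ge0.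
  rewrite -ge0_integralD//.
  - by apply: eq_integral => w _; rewrite EFinD EFinM [enorm _ * _]mulrC.
  - by move=> w _; rewrite lee_fin mulr_ge0// powR_ge0.
  - by apply: emeasurable_funM => //; apply/measurable_EFinP; apply: mO; exact: mp.
  - by move=> w _; rewrite lee_fin mulr_ge0 ?powR_ge0 ?enorm_ge0.
  - by apply/measurable_EFinP/measurable_funM => //; apply: mO; exact: mp.
rewrite !E//; apply: ge0_le_integral => //.
- by move=> w _; rewrite lee_fin addr_ge0// mulr_ge0// ?powR_ge0 ?enorm_ge0.
- apply/measurable_EFinP/measurable_funD; apply: measurable_funM;
    first [exact: measurable_cst|exact: mm1O|exact: mmO|exact: mxO].
- apply/measurable_EFinP/measurable_funD; apply: measurable_funM;
    first [exact: measurable_cst|exact: mm1O|exact: mmO|exact: mxO].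
- move=> w _; rewrite lee_fin; apply: doob_pathwise => //.
    by case/andP: (mK w).
  exact: enorm_ge0.
Qed.

Let mxO t : t \in `[0, T] -> measurable_fun [set: Omega] (fun w => enorm (x t w)).
Proof. by move=> /ix; exact: measurable_rvec_enorm. Qed.

(** The running maximum is started at time 0 with the value 0; sorting the times
does not change their maximum. *)
Lemma doob_list (r : R) (ts : seq R) : 0 <= T -> 1 < r -> all (fun t => t \in `[0, T]) ts ->
  (Lnorm P r%:E (fun w => (\big[Num.max/0]_(t <- ts) enorm (x t w))%:E) <=
   (r / (r - 1))%:E * Lp_norm P r%:E V)%E.
Proof.
move=> T0 r1 hts; have r0 : 0 < r by rewrite (lt_trans _ r1).
have r10 : 0 < r - 1 by rewrite subr_gt0.
have m0 w : 0 <= \big[Num.max/0]_(t <- ts) enorm (x t w) by exact: bigmax_ge_id.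
have mmax : measurable_fun [set: Omega] (fun w => \big[Num.max/0]_(t <- ts) enorm (x t w)).
  elim: ts hts {m0} => [_|t ts IH /= /andP[ht hts]]; first by under eq_fun do rewrite big_nil; exact: measurable_cst.
  under eq_fun do rewrite big_cons; apply: measurable_maxr; first exact: mxO.
  exact: IH.
apply: Lnorm_le_truncated => //.
- by rewrite divr_ge0// ltW.
- exact/measurable_EFinP.
- by apply/measurable_EFinP; exact: measurable_rvec_enorm.
- by move=> w; rewrite lee_fin enorm_ge0.
move=> n.
have truncE w : trunc (fun w => (\big[Num.max/0]_(t <- ts) enorm (x t w))%:E) n w =
  foldl (fun a t => Num.max a (Num.min (enorm (x t w)) n%:R)) 0 (sort <=%R ts).
  rewrite foldl_max_min ?lexx//= max_r; last by rewrite le_min bigmax_ge_id/=.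
  by rewrite /trunc -EFin_min/= (perm_big (sort <=%R ts))//= perm_sym perm_sort.
have := @doob_running_max r n%:R (sort <=%R ts) r1 (ler0n _ _) 0 (cst 0).
have -> : path <=%R 0 (sort <=%R ts).
  rewrite (path_sortedE le_trans) sort_sorted ?andbT//; last exact: le_total.
  rewrite all_sort; apply: sub_all hts => t; rewrite in_itv/=.
  by case/andP.
move=> /(_ isT); rewrite [all _ _]/= all_sort hts in_itv/= lexx T0/=.
move=> /(_ isT (measurable_cst _)).
have -> : (\int[P]_w (cst 0 w `^ r)%:E = 0)%E.
  by under eq_integral do rewrite /= powR0 ?gt_eqF//; rewrite integral0.
rewrite mule0 => /(_ (fun w => _)) H; have {H} := H _ _.
move=> H; set J := trunc _ n.
have {}H : ((1 - r^-1)%:E * \int[P]_w (J w `^ r)%:E <=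
    \int[P]_w (J w `^ (r - 1) * enorm (V w))%:E)%E.
  rewrite (_ : J = fun w => foldl (fun a t => Num.max a (Num.min (enorm (x t w)) n%:R)) 0 (sort <=%R ts)).
    apply: H => [|]; first exact: ler0n.
    by apply: integral_ge0 => w _; rewrite lee_fin mulr_ge0 ?powR_ge0 ?enorm_ge0.
  by apply/funext => w; rewrite -truncE.
move: H; set I1 := integral _ _ _; set I2 := integral _ _ _ => H.
rewrite (_ : integral _ _ _ = I2); last by apply: eq_integral => w _; rewrite muleC.
have -> : I1 = ((r / (r - 1))%:E * ((1 - r^-1)%:E * I1))%E.
  rewrite muleA -EFinM (_ : _ * _ = 1) ?mul1e//; field; by rewrite !gt_eqF.
by rewrite lee_wpmul2l// lee_fin divr_ge0// ltW.
Qed.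

Theorem doob_countable (p : \bar R) (e : nat -> R) : 0 <= T -> (1 < p)%E ->
  (forall n, e n \in `[0, T]) ->
  (Lnorm P p (fun w => ereal_sup (range (fun n => (enorm (x (e n) w))%:E))) <=
   (doob_const p)%:E * Lp_norm P p V)%E.
Proof.
move=> T0 p1 he.
have msup : measurable_fun [set: Omega] (fun w => ereal_sup (range (fun n => (enorm (x (e n) w))%:E))).
  by apply: measurable_ereal_sup_range => n; apply/measurable_EFinP; exact: mxO.
have sup0 w : (0 <= ereal_sup (range (fun n => (enorm (x (e n) w))%:E)))%E.
  by apply: (@le_trans _ _ (enorm (x (e 0%N) w))%:E); [rewrite lee_fin enorm_ge0|apply: ereal_sup_ubound; exists 0%N].
case: p p1 => // [r r1|_].
- pose m n w := \big[Num.max/0]_(t <- [seq e i | i <- iota 0 n]) enorm (x t w).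
  have mm n : measurable_fun [set: Omega] (m n).
    rewrite /m; elim: (iota 0 n) => [|k ks IH] /=; first by under eq_fun do rewrite big_nil; exact: measurable_cst.
    under eq_fun do rewrite big_cons; apply: measurable_maxr; last exact: IH.
    exact: mxO.
  apply: (@Lnorm_fatou _ _ _ _ _ (fun n w => (m n w)%:E)) => //.
  + by move=> n; exact/measurable_EFinP.
  + by move=> n w; rewrite lee_fin; exact: bigmax_ge_id.
  + apply: nearW => w.
    have -> : ereal_sup (range (fun n => (enorm (x (e n) w))%:E)) = ereal_sup (range (fun n => (m n w)%:E)).
      apply/eqP; rewrite eq_le; apply/andP; split; apply: ge_ereal_sup => _ [n _ <-].
        apply: (@le_trans _ _ (m n.+1 w)%:E); last by apply: ereal_sup_ubound; exists n.+1.
        rewrite lee_fin /m; apply: (le_bigmax_seq _ (e n)) => //.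
        by apply/map_f; rewrite mem_iota leq0n add0n ltnSn.
      + rewrite /m big_map; apply: (big_ind (fun y => (y%:E <= _)%E)) => //.
          by move=> a b ha hb; rewrite EFin_max ge_max ha hb.
        by move=> i _; apply: ereal_sup_ubound; exists i.
    apply: ereal_nondecreasing_cvgn => a b ab; rewrite lee_fin /m.
    rewrite big_seq; apply: bigmax_le => [|_ /mapP[i ia ->]]; first exact: bigmax_ge_id.
    apply: (le_bigmax_seq _ (e i)) => //; apply: map_f; move: ia.
    by rewrite !mem_iota !leq0n !add0n => /leq_trans; exact.
  + move=> n; apply: doob_list => //.
    by apply/allP => _ /mapP[i _ ->].
- rewrite mul1e /Lp_norm Lnormy; apply/ess_supP.
  have : forall n, {ae P, forall w, ((enorm (x (e n) w))%:E <= Lp_norm P +oo V)%E}.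
    move=> n; have := Lnorm_cond_exp_le (sF (he n)) (mF (he n)) (ltey 1%E) iV (Vx (he n)).
    rewrite {1}/Lp_norm Lnormy => /ess_supP; apply: filterS => w /=.
    by rewrite ger0_norm// enorm_ge0.
  move=> /ae_foralln; apply: filterS => w hw /=.
  by rewrite gee0_abs//; apply: ge_ereal_sup => _ [n _ <-].
Qed.

End doob.

(** * Upcrossings *)

Section sigma_algebra_closure.
Context (T : pointedType) (G : set (set T)) (sG : sigma_algebra [set: T] G).

Lemma sigma_algebra_measurableP (A : set T) :
  G A <-> (@measurable _ (g_sigma_algebraType G)) A.
Proof. by rewrite /measurable/= sigma_algebra_id. Qed.

Lemma sigma_algebra_setI A B : G A -> G B -> G (A `&` B).
Proof. by move=> /sigma_algebra_measurableP ? /sigma_algebra_measurableP ?; apply/sigma_algebra_measurableP/measurableI. Qed.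

Lemma sigma_algebra_setC A : G A -> G (~` A).
Proof. by move=> /sigma_algebra_measurableP ?; apply/sigma_algebra_measurableP/measurableC. Qed.

End sigma_algebra_closure.

Section upcrossings.
Context (R : realType) (a b : R).
Hypothesis ab : a < b.

(** The number of completed upcrossings of [a, b]: holding is true while the
sequence has been at or below a and has not yet reached b. *)
Fixpoint upcross (holding : bool) (l : seq R) : nat :=
  if l is x :: l' then
    if holding then if b <= x then (upcross false l').+1 else upcross true l'
    else upcross (x <= a) l'
  else 0%N.

Lemma upcross_state l : (upcross false l <= upcross true l <= (upcross false l).+1)%N.
Proof.
elim: l => [|x l IH]//=; have /andP[h1 h2] := IH.
have [bx|xb] := leP b x.
  by rewrite leNgt (lt_le_trans ab bx)/= leqnSn leqnn.
by case: (x <= a); rewrite ?h1 ?h2 ?leqnn ?leqnSn.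
Qed.

Lemma upcross_cons st x l : (upcross st l <= upcross st (x :: l))%N.
Proof.
have /andP[h1 h2] := upcross_state l.
case: st => /=; first by case: ifP.
by case: (x <= a); rewrite ?h1.
Qed.

(** Refining a grid of times can only increase the count. *)
Lemma upcross_subseq st l1 l2 : subseq l1 l2 -> (upcross st l1 <= upcross st l2)%N.
Proof.
elim: l2 l1 st => [|y l2 IH] l1 st; first by rewrite subseq0 => /eqP->.
case: l1 => [//|x l1]; rewrite [subseq _ _]/=; case: eqP => [->|_] sub.
  by case: st => /=; [case: ifP => _; rewrite ?ltnS IH|rewrite IH].
exact: leq_trans (IH _ _ sub) (upcross_cons _ _ _).
Qed.

End upcrossings.

Section expected_upcrossings.
Context (disp : measure_display) (Omega : measurableType disp) (R : realType).
Context (P : probability Omega R) (T : R) (F : R -> set (set Omega)).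
Hypothesis hF : is_filtration T F.
Context (V : Omega -> R) (x : R -> Omega -> R).
Hypothesis iV : P.-integrable setT (EFin \o V).
Hypothesis Vx : forall t, t \in `[0, T] -> cexp P (F t) V (x t).
Context (a b : R).
Hypothesis ab : a < b.

Let sF t : t \in `[0, T] -> sigma_algebra [set: Omega] (F t).
Proof. by case: hF => H _ _; exact: H. Qed.
Let mF t : t \in `[0, T] -> F t `<=` measurable.
Proof. by case: hF => _ H _; exact: H. Qed.
Let leF s t : s \in `[0, T] -> t \in `[0, T] -> s <= t -> F s `<=` F t.
Proof.
by case: hF => _ _ H; rewrite !in_itv/= => /andP[s0 _] /andP[_ tT] st; exact: H.
Qed.
Let mx t : t \in `[0, T] -> measurable_fun [set: Omega] (x t).
Proof. by move=> ht; have [m _ _] := Vx ht; exact: mwrt_measurable (sF ht) (mF ht) m. Qed.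
Let mV : measurable_fun [set: Omega] V.
Proof. by apply/measurable_EFinP; exact: (measurable_int P). Qed.

Let U st ts w : R := (upcross a b st [seq x t w | t <- ts])%:R.

Lemma measurable_upcross st ts : all (fun t => t \in `[0, T]) ts ->
  measurable_fun [set: Omega] (U st ts).
Proof.
elim: ts st => [|t ts IH] st /=; first by move=> _; exact: measurable_cst.
move=> /andP[ht hts].
have mle (c : R) : measurable_fun [set: Omega] (fun w => x t w <= c).
  by apply: measurable_fun_ler => //; exact: mx.
have mge (c : R) : measurable_fun [set: Omega] (fun w => c <= x t w).
  by apply: measurable_fun_ler => //; exact: mx.
case: st; rewrite /U /=.
- have -> : (fun w => (if b <= x t w then (upcross a b false [seq x i w | i <- ts]).+1
     else upcross a b true [seq x i w | i <- ts])%:R) =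
     (fun w => if b <= x t w then 1 + U false ts w else U true ts w) :> (Omega -> R).
    by apply/funext => w; case: ifP => //; rewrite /U -natr1 addrC.
  apply: measurable_fun_ifT => //; last exact: IH.
  by apply: measurable_funD => //; exact: IH.
- have -> : (fun w => (upcross a b (x t w <= a) [seq x i w | i <- ts])%:R) =
     (fun w => if x t w <= a then U true ts w else U false ts w) :> (Omega -> R).
    by apply/funext => w; case: ifP.
  by apply: measurable_fun_ifT => //; exact: IH.
Qed.

Let pos w := Num.max 0 (V w - a).
Let neg w := Num.max 0 (a - V w).

Let integrable_pos : P.-integrable setT (EFin \o pos).
Proof.
have iVa : P.-integrable setT (EFin \o (fun w => V w - a)).
  exact: (integrableB measurableT iV (finite_measure_integrable_cst P a measurableT)).
apply: (le_integrable measurableT _ _ iVa) => //.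
  by apply/measurable_EFinP/measurable_maxr => //; exact: measurable_funB.
move=> w _ /=; rewrite lee_fin ger0_norm ?le_max ?lexx//.
by rewrite ge_max normr_ge0 ler_norm.
Qed.

Let integrable_neg : P.-integrable setT (EFin \o neg).
Proof.
have iVa : P.-integrable setT (EFin \o (fun w => V w - a)).
  exact: (integrableB measurableT iV (finite_measure_integrable_cst P a measurableT)).
apply: (le_integrable measurableT _ _ iVa) => //.
  by apply/measurable_EFinP/measurable_maxr => //; exact: measurable_funB.
move=> w _ /=; rewrite lee_fin ger0_norm ?le_max ?lexx//.
by rewrite ge_max normr_ge0 distrC ler_norm.
Qed.

Let pos_neg B : measurable B ->
  (\int[P]_(w in B) (pos w)%:E + a%:E * P B = \int[P]_(w in B) (neg w)%:E + \int[P]_(w in B) (V w)%:E)%E.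
Proof.
move=> mB.
have iS g : P.-integrable setT g -> P.-integrable B g by exact: integrableS.
rewrite -integral_cst// -!integralD//; try exact: iS.
  apply: eq_integral => w _; rewrite -!EFinD; congr EFin; rewrite /pos /neg.
  have [h|h] := leP (V w) a.
    by rewrite max_l ?subr_le0// max_r ?subr_ge0// add0r subrK.
  by rewrite max_r ?subr_ge0 ?(ltW h)// max_l ?subr_le0 ?(ltW h)// add0r subrK.
by apply: iS; exact: finite_measure_integrable_cst.
Qed.

Let split_int (g : Omega -> R) A S : measurable A -> measurable S ->
  measurable_fun [set: Omega] g -> (forall w, 0 <= g w) ->
  (\int[P]_(w in A) (g w)%:E = \int[P]_(w in A `&` S) (g w)%:E + \int[P]_(w in A `&` ~` S) (g w)%:E)%E.
Proof.
move=> mA mS mg g0; rewrite -ge0_integral_setU//.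
- by rewrite -setIUr setUv setIT.
- exact: measurableI.
- by apply: measurableI => //; exact: measurableC.
- by apply: measurable_funTS; exact/measurable_EFinP.
- by move=> w _; rewrite lee_fin.
- by apply/disj_set2P; rewrite setIACA setICr setI0.
Qed.

(** The upcrossing inequality, by induction on the times, for both states at
once: the state changes on an event known at the next time, where V may be
traded for x; the gain b - a comes from selling at b what was bought at a.
The event A makes the induction possible, since it is split at every step. *)
Lemma expected_upcross ts t A : path <=%R t ts -> all (fun t => t \in `[0, T]) (t :: ts) -> F t A ->
  ((b - a)%:E * \int[P]_(w in A) (U false ts w)%:E <= \int[P]_(w in A) (neg w)%:E)%E /\
  ((b - a)%:E * \int[P]_(w in A) (U true ts w)%:E <= \int[P]_(w in A) (pos w)%:E)%E.
Proof.
have ba0 : 0 <= b - a by rewrite subr_ge0 ltW.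
elim: ts t A => [|t' ts IH] t A /=.
  move=> _ _ _; rewrite !integral0 mule0; split; apply: integral_ge0 => w _;
    by rewrite lee_fin le_max lexx.
move=> /andP[tt' pts] /and3P[ht ht' hts] FA.
have FA' := leF ht ht' tt' FA.
have mA := mF ht FA.
have mU st := measurable_upcross st hts.
have U0 st ts' w : 0 <= U st ts' w by exact: ler0n.
have [mx' ix' Vx'] := Vx ht'.
have FI S : F t' S -> F t' (A `&` S).
  by move=> FS; exact: (sigma_algebra_setI (sF ht') FA' FS).
have FN S : F t' S -> F t' (~` S) by move=> FS; exact: (sigma_algebra_setC (sF ht') FS).
have {}IH S : F t' S ->
  ((b - a)%:E * \int[P]_(w in S) (U false ts w)%:E <= \int[P]_(w in S) (neg w)%:E)%E /\
  ((b - a)%:E * \int[P]_(w in S) (U true ts w)%:E <= \int[P]_(w in S) (pos w)%:E)%E.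
  by apply: IH => //=; rewrite ht'.
have mpos : measurable_fun [set: Omega] pos.
  by apply: measurable_maxr => //; exact: measurable_funB.
have mneg : measurable_fun [set: Omega] neg.
  by apply: measurable_maxr => //; exact: measurable_funB.
have pos0 w : 0 <= pos w by rewrite le_max lexx.
have neg0 w : 0 <= neg w by rewrite le_max lexx.
have mF' S : F t' S -> measurable S by exact: mF.
have fin g S : P.-integrable setT g -> F t' S -> (\int[P]_(w in S) g w)%E \is a fin_num.
  move=> ig FS; apply: integrable_fin_num => //; first exact: mF'.
  by apply: integrableS ig => //; exact: mF'.
have int0 (g : Omega -> R) S : (forall w, 0 <= g w) -> (0 <= \int[P]_(w in S) (g w)%:E)%E.
  by move=> g0; apply: integral_ge0 => w _; rewrite lee_fin.
have FPfin S : F t' S -> P S \is a fin_num by move=> FS; apply: fin_num_measure; exact: mF'.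
have Vcst S (c : R) : F t' S -> (\int[P]_(w in S) cst c%:E w = c%:E * P S)%E.
  by move=> FS; rewrite integral_cst//; exact: mF'.
have icst (c : R) : P.-integrable setT (cst c%:E) by exact: finite_measure_integrable_cst.
split.
- pose S := x t' @^-1` `]-oo, a]%classic.
  have FS : F t' S by apply: (mwrtP _ (sF ht')).1 => //; exact: measurable_itv.
  have FAS := FI _ FS; have FAN := FI _ (FN _ FS).
  rewrite (split_int mA (mF' _ FS) (measurable_upcross (ts := t' :: ts) false _))//; last by rewrite /= ht'.
  rewrite (_ : integral _ (A `&` S) _ = \int[P]_(w in A `&` S) (U true ts w)%:E)%E; last first.
    by apply: eq_integral => w; rewrite inE /S/= in_itv/= /U/= => -[_ ->].
  rewrite (_ : integral _ (A `&` ~` S) (fun w => (U false (t' :: ts) w)%:E) =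
     \int[P]_(w in A `&` ~` S) (U false ts w)%:E)%E; last first.
    by apply: eq_integral => w; rewrite inE /S/= in_itv/= /U/= => -[_ /negP/negbTE ->].
  rewrite ge0_muleDr; [|exact: int0|exact: int0].
  rewrite (split_int mA (mF' _ FS) mneg)//; apply: leeD; last exact: (IH _ FAN).1.
  apply: (le_trans (IH _ FAS).2).
  have VaP : (\int[P]_(w in A `&` S) (V w)%:E <= a%:E * P (A `&` S))%E.
    rewrite -Vx'// -Vcst//; apply: le_integral.
    - exact: mF'.
    - by apply: integrableS ix' => //; exact: mF'.
    - by apply: integrableS (icst a) => //; exact: mF'.
    - by move=> w; rewrite inE => -[_]; rewrite /S/= in_itv/= lee_fin.
  have := pos_neg (mF' _ FAS).
  have := fin _ _ integrable_pos FAS; have := fin _ _ integrable_neg FAS.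
  have := fin _ _ iV FAS; have := FPfin _ FAS.
  move: VaP => /=; move: (P _) (integral _ _ _) (integral _ _ _) (integral _ _ _).
  move=> [p| |]// [v| |]// [n| |]// [q| |]//.
  by rewrite -!EFinM -!EFinD !lee_fin => + _ _ _ _ [] => ? ?; lra.
- pose S := x t' @^-1` `[b, +oo[%classic.
  have FS : F t' S by apply: (mwrtP _ (sF ht')).1 => //; exact: measurable_itv.
  have FAS := FI _ FS; have FAN := FI _ (FN _ FS).
  rewrite (split_int mA (mF' _ FS) (measurable_upcross (ts := t' :: ts) true _))//; last by rewrite /= ht'.
  rewrite (_ : integral _ (A `&` S) _ = P (A `&` S) + \int[P]_(w in A `&` S) (U false ts w)%:E)%E; last first.
    rewrite -[P _]mul1e -Vcst// -ge0_integralD//; [|exact: mF'|by move=> w _; rewrite lee_fin|].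
      by apply: eq_integral => w; rewrite inE /S/= in_itv/= andbT /U/= => -[_ ->]; rewrite -EFinD -natr1 addrC.
    by apply: measurable_funTS; exact/measurable_EFinP.
  rewrite (_ : integral _ (A `&` ~` S) (fun w => (U true (t' :: ts) w)%:E) =
     \int[P]_(w in A `&` ~` S) (U true ts w)%:E)%E; last first.
    by apply: eq_integral => w; rewrite inE /S/= in_itv/= andbT /U/= => -[_ /negP/negbTE ->].
  rewrite ge0_muleDr; [|by rewrite adde_ge0//; exact: int0|exact: int0].
  rewrite (split_int mA (mF' _ FS) mpos)//; apply: leeD; last exact: (IH _ FAN).2.
  rewrite ge0_muleDr//; last exact: int0.
  apply: le_trans (leeD2l _ (IH _ FAS).1) _.
  have VaP : (b%:E * P (A `&` S) <= \int[P]_(w in A `&` S) (V w)%:E)%E.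
    rewrite -Vx'// -Vcst//; apply: le_integral.
    - exact: mF'.
    - by apply: integrableS (icst b) => //; exact: mF'.
    - by apply: integrableS ix' => //; exact: mF'.
    - by move=> w; rewrite inE => -[_]; rewrite /S/= in_itv/= andbT lee_fin.
  have := pos_neg (mF' _ FAS).
  have := fin _ _ integrable_pos FAS; have := fin _ _ integrable_neg FAS.
  have := fin _ _ iV FAS; have := FPfin _ FAS.
  move: VaP => /=; move: (P _) (integral _ _ _) (integral _ _ _) (integral _ _ _).
  move=> [p| |]// [v| |]// [n| |]// [q| |]//.
  by rewrite -!EFinM -!EFinD !lee_fin => + _ _ _ _ [] => ? ?; lra.
Qed.

Definition grid (e : nat -> R) (k : nat) : seq R := sort <=%R [seq e i | i <- iota 0 k].

Lemma grid_subseq e k l : (k <= l)%N -> subseq (grid e k) (grid e l).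
Proof.
move=> kl; apply: subseq_sort_le; apply: map_subseq.
by rewrite -(subnKC kl) iotaD; exact: prefix_subseq.
Qed.

(** The expected number of upcrossings along the finite grids has a common bound,
so the increasing limit of the counts is almost surely finite. *)
Lemma ae_upcross_bounded (e : nat -> R) : 0 <= T -> (forall n, e n \in `[0, T]) ->
  {ae P, forall w, exists N, forall k, (upcross a b false [seq x t w | t <- grid e k] <= N)%N}.
Proof.
move=> T0 he.
have hall k : all (fun t => t \in `[0, T]) (grid e k).
  by rewrite all_sort; apply/allP => _ /mapP[i _ ->].
have hpath k : path <=%R 0 (grid e k).
  rewrite (path_sortedE le_trans) sort_sorted ?andbT//; last exact: le_total.
  by apply: sub_all (hall k) => t; rewrite in_itv/= => /andP[].
have mono w : {homo (fun k => (U false (grid e k) w)%:E) : k l / (k <= l)%N >-> (k <= l)%E}.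
  by move=> k l kl; rewrite lee_fin ler_nat; apply: upcross_subseq => //; exact/map_subseq/grid_subseq.
have mUk k := measurable_upcross false (hall k).
pose Uoo w := limn (fun k => (U false (grid e k) w)%:E).
have mUoo : measurable_fun [set: Omega] Uoo.
  apply: (emeasurable_fun_cvg (fun k w => (U false (grid e k) w)%:E)) => [k|w _].
    exact/measurable_EFinP.
  exact: ereal_nondecreasing_is_cvgn.
have Uoo_ge k w : ((U false (grid e k) w)%:E <= Uoo w)%E.
  apply: lime_ge; first exact: ereal_nondecreasing_is_cvgn.
  by exists k => // l kl; exact: mono.
have h0 : 0 \in `[0, T] by rewrite in_itv/= lexx T0.
have intU : (\int[P]_w Uoo w < +oo)%E.
  rewrite /Uoo monotone_convergence//; last 2 first.
  - by move=> k; exact/measurable_EFinP.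
  - by move=> k w _; rewrite lee_fin.
  apply: (@le_lt_trans _ _ (((b - a)^-1)%:E * \int[P]_w (neg w)%:E)%E).
    apply: lime_le.
      apply: ereal_nondecreasing_is_cvgn => k l kl; apply: ge0_le_integral => //.
      - by move=> w _; rewrite lee_fin.
      - exact/measurable_EFinP.
      - exact/measurable_EFinP.
      - by move=> w _; exact: mono.
    apply: nearW => k; rewrite lee_pdivlMl ?subr_gt0//.
    have FT : F 0 setT by apply: sigma_algebraT (sF h0).
    have hallk : all (fun t => t \in `[0, T]) (0 :: grid e k) by rewrite /= h0 hall.
    by have [] := expected_upcross (hpath k) hallk FT.
  rewrite lte_mul_pinfty ?lee_fin ?invr_ge0 ?subr_ge0 ?(ltW ab)//.
  exact: (integrable_lty measurableT integrable_neg).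
have iUoo : P.-integrable setT Uoo.
  apply/integrableP; split => //; move: intU; under eq_integral do rewrite -[Uoo _]gee0_abs ?(le_trans _ (Uoo_ge 0%N _)) ?lee_fin//.
  by [].
have := integrable_ae measurableT iUoo; apply: filterS => w /(_ I) fw.
exists (Num.truncn (fine (Uoo w))).+1 => k.
have := Uoo_ge k w; rewrite -[Uoo w]fineK// lee_fin => h.
rewrite -(@ler_nat R); apply: (le_trans h); apply: ltW.
exact: truncnS_gt.
Qed.

End expected_upcrossings.

(** * Regularization along a dense set of times *)

Section regularization.
Context (R : realType).
Implicit Types (W : R -> set R) (x : R -> R).

(** W d stands for the dense times within distance d of a given time, on one of
its sides.  The limit is the upper limit l of x; values below l - e at arbitrarily small
distance would force an oscillation between two rationals a < b, with
l - e < a and b < l. *)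
Lemma no_oscillation_limit W x (B : R) :
  (forall d, 0 < d -> W d !=set0) ->
  (forall d d', 0 < d -> d <= d' -> W d `<=` W d') ->
  (forall d s, 0 < d -> W d s -> `|x s| <= B) ->
  (forall a b : rat, a < b ->
    ~ ((forall d, 0 < d -> exists2 s, W d s & x s <= ratr a) /\
       (forall d, 0 < d -> exists2 s, W d s & ratr b <= x s))) ->
  exists l, forall e, 0 < e -> exists2 d, 0 < d & forall s, W d s -> `|x s - l| <= e.
Proof.
move=> W0 Wmono WB noosc.
pose S := [set y | forall d, 0 < d -> exists2 s, W d s & y <= x s].
have SB : S (- B).
  move=> d d0; have [s Ws] := W0 _ d0; exists s => //.
  by have := WB _ _ d0 Ws; rewrite ler_norml => /andP[].
have Sub : ubound S B.
  move=> y Sy; have [s Ws ys] := Sy _ ltr01; apply: (le_trans ys).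
  by have := WB _ _ ltr01 Ws; rewrite ler_norml => /andP[].
have supS : has_sup S by split; [exists (- B)|exists B].
pose l := sup S; exists l => e e0.
have [d1 d10 H1] : exists2 d, 0 < d & forall s, W d s -> x s <= l + e.
  apply/not_exists2P => H.
  have : S (l + e).
    move=> d d0; have [//|/existsNP[s /not_implyP[Ws /negP]]] := H d.
    by rewrite -ltNge => /ltW h; exists s.
  by move/(ub_le_sup (ex_intro _ B Sub)); rewrite gerDl leNgt e0.
have [y Sy yl] : exists2 y, S y & l - e / 2 < y.
  by apply: sup_gt; [exists (- B)|rewrite ltrBlDr ltrDl divr_gt0].
have [a /andP[a1 a2]] : exists a : rat, l - e < ratr a < l - e / 2.
  have := @rat_in_itvoo R (l - e) (l - e / 2); rewrite ltrD2l ltrN2 => /(_ _)[].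
    by rewrite ltr_pdivrMr// mulr_natr mulr2n ltrDl.
  by move=> q; rewrite in_itv/=; exists q.
have [b /andP[b1 b2]] : exists b : rat, (ratr a : R) < ratr b < y.
  have := @rat_in_itvoo R (ratr a) y (lt_trans a2 yl).
  by case=> q; rewrite in_itv/=; exists q.
have ab : a < b by rewrite -(ltr_rat R).
have [d2 d20 H2] : exists2 d, 0 < d & forall s, W d s -> l - e <= x s.
  apply/not_exists2P => H; apply: (noosc _ _ ab); split => d d0.
    have [//|/existsNP[s /not_implyP[Ws /negP]]] := H d.
    by rewrite -ltNge => h; exists s => //; rewrite ltW// (lt_trans h).
  by have [s Ws ys] := Sy _ d0; exists s => //; rewrite (le_trans _ ys)// ltW.
exists (Num.min d1 d2); first by rewrite lt_min d10.
move=> s Ws; have m0 : 0 < Num.min d1 d2 by rewrite lt_min d10.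
rewrite ler_distl H2/= ?H1//.
  by apply: Wmono Ws => //; rewrite ge_min lexx.
by apply: Wmono Ws => //; rewrite ge_min lexx orbT.
Qed.

Lemma sorted_lt_subseq_grid (e : nat -> R) (L : seq R) : sorted <%R L ->
  (forall s, s \in L -> exists i, e i = s) -> exists k, subseq L (grid e k).
Proof.
move=> sL eL.
have [k Lk] : exists k, {subset L <= [seq e i | i <- iota 0 k]}.
  elim: L eL {sL} => [|s L IH] eL; first by exists 0%N.
  have [|k Lk] := IH; first by move=> s' hs'; apply: eL; rewrite inE hs' orbT.
  have [|i ei] := eL s; first by rewrite inE eqxx.
  exists (maxn k i.+1) => s'; rewrite inE => /predU1P[->|/Lk/mapP[j]].
    by rewrite -ei; apply: map_f; rewrite mem_iota leq0n/= add0n leq_max ltnSn orbT.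
  rewrite mem_iota leq0n add0n/= => jk ->; apply: map_f.
  by rewrite mem_iota leq0n add0n/= leq_max jk.
exists k; rewrite /grid; set G := [seq e i | i <- _] in Lk *.
have -> : L = [seq s <- undup (sort <=%R G) | s \in L].
  apply: (@irr_sorted_eq _ <%R) => //.
  - exact: lt_trans.
  - apply: sorted_filter; first exact: lt_trans.
    rewrite lt_sorted_uniq_le undup_uniq/=.
    by apply: (subseq_sorted le_trans (undup_subseq _)); apply: sort_sorted; exact: le_total.
  - move=> s; rewrite mem_filter mem_undup mem_sort.
    by case: (boolP (s \in L)) => // /Lk ->.
apply: subseq_trans (undup_subseq _); exact: filter_subseq.
Qed.

Context (T : R) (e : nat -> R).
Hypothesis T0 : 0 < T.
Hypothesis he : forall n, e n \in `[0, T].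
Hypothesis dense_e : forall a b, 0 <= a -> a < b -> b <= T -> exists i, a < e i < b.

Let right_nbhs t d := [set s | (exists i, e i = s) /\ t < s < t + d].
Let left_nbhs t d := [set s | (exists i, e i = s) /\ t - d < s < t].

(** Oscillation at t+ produces arbitrarily many upcrossings; the list is built
backwards in time, each new pair of points being placed closer to t than all
the previous ones. *)
Lemma upcross_right (a b : R) x t N : a < b ->
  (forall d, 0 < d -> exists2 s, right_nbhs t d s & x s <= a) ->
  (forall d, 0 < d -> exists2 s, right_nbhs t d s & b <= x s) ->
  forall d, 0 < d -> exists L, [/\ sorted <%R L, forall s, s \in L -> right_nbhs t d s
    & (N <= upcross a b false (map x L))%N].
Proof.
move=> ab Ha Hb; elim: N => [|N IH] d d0; first by exists [::].
have [L [sL LN NL]] := IH _ d0.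
have [d1 [d10 d1d dL]] : exists d1, [/\ 0 < d1, d1 <= d & forall h L', L = h :: L' -> t + d1 = h].
  case: L LN {sL NL} => [_|h L /(_ h)]; first by exists d.
  rewrite inE eqxx => /(_ isT) [_ /andP[th hd]]; exists (h - t); split.
  - by rewrite subr_gt0.
  - by rewrite lerBlDl ltW.
  - by move=> _ _ [<- _]; rewrite addrC subrK.
have [r [ir /andP[tr rd]] br] := Hb _ d10.
have [s [is_ /andP[ts sr]] sa] : exists2 s, right_nbhs t (r - t) s & x s <= a.
  by apply: Ha; rewrite subr_gt0.
rewrite addrC subrK in sr.
have rd' : r < t + d by rewrite (lt_le_trans rd)// lerD2l.
exists [:: s, r & L]; split.
- rewrite /= sr/=; case: L sL dL {LN NL} => // h L /= -> /(_ _ _ erefl) <-.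
  by rewrite andbT.
- move=> z; rewrite !inE => /or3P[/eqP->|/eqP->|/LN//].
    by split => //; rewrite ts (lt_trans sr).
  by split => //; rewrite tr.
- by rewrite /= sa/= br.
Qed.

Lemma upcross_left (a b : R) x t N : a < b ->
  (forall d, 0 < d -> exists2 s, left_nbhs t d s & x s <= a) ->
  (forall d, 0 < d -> exists2 s, left_nbhs t d s & b <= x s) ->
  forall d, 0 < d -> exists L, [/\ sorted <%R L, forall s, s \in L -> left_nbhs t d s
    & (N <= upcross a b false (map x L))%N].
Proof.
move=> ab Ha Hb; elim: N => [|N IH] d d0; first by exists [::].
have [s [is_ /andP[ds st]] sa] := Ha _ d0.
have [r [ir /andP[sr rt]] br] : exists2 r, left_nbhs t (t - s) r & b <= x r.
  by apply: Hb; rewrite subr_gt0.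
rewrite subKr in sr.
have tr0 : 0 < t - r by rewrite subr_gt0.
have [L [sL LN NL]] := IH _ tr0.
have LN' z : z \in L -> r < z < t by move=> /LN[_]; rewrite subKr.
exists [:: s, r & L]; split.
- rewrite /= sr/=; case: L sL LN' {LN NL} => // h L /= -> /(_ h).
  by rewrite inE eqxx andbT => /(_ isT)/andP[].
- move=> z; rewrite !inE => /or3P[/eqP->|/eqP->|zL].
  + by split => //; rewrite ds.
  + by split => //; rewrite (lt_trans ds)//.
  + have [iz _] := LN _ zL; have /andP[rz zt] := LN' _ zL.
    by split => //; rewrite zt andbT (lt_trans ds)// (lt_trans sr).
- by rewrite /= sa/= br.
Qed.

Context (x : R -> R) (B : R).
Hypothesis xB : forall n, `|x (e n)| <= B.
Hypothesis xU : forall a b : rat, a < b ->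
  exists N, forall k, (upcross (ratr a) (ratr b) false (map x (grid e k)) <= N)%N.

Lemma right_limit_exists t : 0 <= t -> t < T ->
  exists l, forall eps, 0 < eps -> exists2 d, 0 < d & forall s, right_nbhs t d s -> `|x s - l| <= eps.
Proof.
move=> t0 tT; apply: (@no_oscillation_limit (right_nbhs t) x B).
- move=> d d0; have [||i /andP[h1 h2]] := @dense_e t (Num.min T (t + d)) t0.
  + by rewrite lt_min tT ltrDl.
  + by rewrite ge_min lexx.
  exists (e i); split; first by exists i.
  by move: h2; rewrite lt_min h1 => /andP[].
- move=> d d' d0 dd' s [si /andP[h1 h2]]; split => //.
  by rewrite h1/= (lt_le_trans h2)// lerD2l.
- by move=> d s d0 [[i <-] _].
- move=> a b ab [Ha Hb]; have [N HN] := xU ab.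
  have abR : (ratr a : R) < ratr b by rewrite ltr_rat.
  have [L [sL LN NL]] := upcross_right N.+1 abR Ha Hb ltr01.
  have [k Lk] : exists k, subseq L (grid e k).
    by apply: sorted_lt_subseq_grid => // s /LN[].
  have := leq_trans (upcross_subseq abR false (map_subseq x Lk)) (HN k).
  by move/(leq_trans NL); rewrite ltnn.
Qed.

Lemma left_limit_exists t : 0 < t -> t <= T ->
  exists l, forall eps, 0 < eps -> exists2 d, 0 < d & forall s, left_nbhs t d s -> `|x s - l| <= eps.
Proof.
move=> t0 tT; apply: (@no_oscillation_limit (left_nbhs t) x B).
- move=> d d0; have [| |//|i /andP[h1 h2]] := @dense_e (Num.max 0 (t - d)) t.
  + by rewrite le_max lexx.
  + by rewrite gt_max t0 ltrBlDr ltrDl.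
  exists (e i); split; first by exists i.
  by move: h1; rewrite gt_max h2 andbT => /andP[].
- move=> d d' d0 dd' s [si /andP[h1 h2]]; split => //.
  by rewrite h2 andbT (le_lt_trans _ h1)// lerB.
- by move=> d s d0 [[i <-] _].
- move=> a b ab [Ha Hb]; have [N HN] := xU ab.
  have abR : (ratr a : R) < ratr b by rewrite ltr_rat.
  have [L [sL LN NL]] := upcross_left N.+1 abR Ha Hb ltr01.
  have [k Lk] : exists k, subseq L (grid e k).
    by apply: sorted_lt_subseq_grid => // s /LN[].
  have := leq_trans (upcross_subseq abR false (map_subseq x Lk)) (HN k).
  by move/(leq_trans NL); rewrite ltnn.
Qed.

(** y is the right limit of x along the dense times.  It is right-continuous
because right limits are limits of x at nearby dense times, and its left limit
is that of x.  The value at T, which has no time to its right, is x T. *)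
Lemma regularization : exists y : R -> R,
  [/\ y T = x T,
      forall t, 0 <= t -> t < T -> forall eps, 0 < eps ->
        exists2 d, 0 < d & forall i, t < e i < t + d -> `|x (e i) - y t| <= eps,
      forall t, 0 <= t -> t < T -> y s @[s --> t^'+] --> y t
    & forall t, 0 < t -> t <= T -> cvg (y s @[s --> t^'-])].
Proof.
have /choice[l hl] : forall t : R, exists l : R, 0 <= t -> t < T -> forall eps : R, 0 < eps ->
   exists2 d : R, 0 < d & forall s, right_nbhs t d s -> `|x s - l| <= eps.
  move=> t.
  have [t0|t0] := boolP (0 <= t); last by exists 0.
  have [tT|tT] := boolP (t < T); last by exists 0.
  by have [l hl] := right_limit_exists t0 tT; exists l.
pose y t := if t < T then l t else x T.
(* By density, y s is a limit of values x (e i) with e i slightly above s. *)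
have y_close s u c eps : 0 <= s -> s < T -> s < u -> (forall i, s < e i < u -> `|x (e i) - c| <= eps) ->
    `|y s - c| <= eps.
  move=> s0 sT su H; apply/ler_addgt0Pr => eta eta0.
  have [d d0 Hd] := hl _ s0 sT _ eta0.
  have [||i /andP[h1 h2]] := @dense_e s (Num.min T (Num.min u (s + d))) s0.
  - by rewrite !lt_min sT su ltrDl.
  - by rewrite ge_min lexx.
  move: h2; rewrite !lt_min => /and3P[_ iu id].
  have hH : `|x (e i) - c| <= eps by apply: H; rewrite h1.
  have hl' : `|x (e i) - l s| <= eta by apply: Hd; split; [exists i|rewrite h1].
  rewrite /y sT (_ : l s - c = (x (e i) - c) - (x (e i) - l s)); last by ring.
  by rewrite (le_trans (ler_normB _ _))// lerD.
exists y; split.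
- by rewrite /y ltxx.
- move=> t t0 tT eps eps0; rewrite /y tT; have [d d0 Hd] := hl _ t0 tT _ eps0.
  by exists d => // i hi; apply: Hd; split => //; exists i.
- move=> t t0 tT; have -> : y t = l t by rewrite /y tT.
  apply/cvgrPdist_le => eps eps0.
  have [d d0 Hd] := hl _ t0 tT _ eps0.
  near=> s; rewrite distrC.
  have ts : t < s by near: s; exact: nbhs_right_gt.
  apply: (y_close s (t + d)).
  + by rewrite (le_trans t0)// ltW.
  + by near: s; exact: nbhs_right_lt.
  + by near: s; apply: nbhs_right_lt; rewrite ltrDl.
  + by move=> i /andP[h1 h2]; apply: Hd; split; [exists i|rewrite (lt_trans ts)].
- move=> t t0 tT; have [c hc] := left_limit_exists t0 tT.
  apply/cvg_ex; exists c; apply/cvgrPdist_le => eps eps0.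
  have [d d0 Hd] := hc _ eps0.
  near=> s; rewrite distrC.
  have st : s < t by near: s; exact: nbhs_left_lt.
  apply: (y_close s t) => //.
  + by apply: ltW; near: s; exact: nbhs_left_gt.
  + by rewrite (lt_le_trans st).
  + move=> i /andP[h1 h2]; apply: Hd; split; first by exists i.
    rewrite h2 andbT (lt_trans _ h1)//; near: s; apply: nbhs_left_gt.
    by rewrite ltrBlDr ltrDl.
Unshelve. all: by end_near. Qed.

End regularization.

(** * RCLL adapted processes *)

Section row_convergence.
Context (R : realType) (d : nat).

(** The topology of row vectors is that of coordinatewise convergence. *)
Lemma cvg_rowP (I : Type) (G : set_system I) (FG : Filter G) (x : I -> 'rV[R]_d) (v : 'rV[R]_d) :
  (forall i, x s ord0 i @[s --> G] --> v ord0 i) <-> x s @[s --> G] --> v.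
Proof.
split=> [H U [B HB BU]|H i].
  apply: (@filterS _ _ _ [set s | forall i, B ord0 i (x s ord0 i)]).
    by move=> s /= Bs; apply: BU => /= i j; rewrite (ord1 i).
  by apply: filter_forall => i; exact: H.
exact: (cvg_comp _ _ H (@coord_continuous R 1 d ord0 i v)).
Qed.

Lemma enorm_cvg (I : Type) (G : set_system I) (FG : Filter G) (x : I -> 'rV[R]_d) (v : 'rV[R]_d) :
  x s @[s --> G] --> v -> enorm (x s) @[s --> G] --> enorm v.
Proof.
move=> /cvg_rowP H.
have Hs : (\sum_(i < d) x s ord0 i ^+ 2) @[s --> G] --> \sum_(i < d) v ord0 i ^+ 2.
  elim: (index_enum _) => [|i r IH].
    by rewrite big_nil; under eq_cvg do rewrite big_nil; exact: cvg_cst.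
  rewrite big_cons; under eq_cvg do rewrite big_cons; apply: cvgD => //.
  by rewrite expr2; under eq_cvg do rewrite expr2; apply: cvgM; exact: H.
exact: (cvg_comp _ _ Hs (@sqrt_continuous R _)).
Qed.

End row_convergence.

Section dense_times.
Context (R : realType) (T : R).
Hypothesis T0 : 0 < T.

(** The rationals, clamped to [0, 1] and rescaled to [0, T]. *)
Definition dense_time (n : nat) : R :=
  if @unpickle rat n is Some q then T * Num.max 0 (Num.min 1 (ratr q)) else T.

Lemma dense_timeP n : dense_time n \in `[0, T].
Proof.
rewrite /dense_time; case: unpickle => [q|]; last by rewrite in_itv/= lexx ltW.
rewrite in_itv/= mulr_ge0 ?(ltW T0) ?le_max ?lexx//=.
by rewrite ler_piMr ?(ltW T0)// ge_max ler01 ge_min lexx.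
Qed.

Lemma dense_timeT : exists n, dense_time n = T.
Proof.
exists (pickle (1 : rat)); rewrite /dense_time pickleK.
by rewrite rmorph1 minxx max_r ?mulr1.
Qed.

Lemma dense_time_dense a b : 0 <= a -> a < b -> b <= T -> exists i, a < dense_time i < b.
Proof.
move=> a0 ab bT.
have abT : a / T < b / T by rewrite ltr_pM2r ?invr_gt0.
have [q] := rat_in_itvoo abT.
rewrite in_itv/= => /andP[aq qb].
exists (pickle q); rewrite /dense_time pickleK.
have q0 : 0 <= ratr q :> R by rewrite ltW// (le_lt_trans _ aq)// divr_ge0// ltW.
have q1 : ratr q <= 1 :> R by rewrite ltW// (lt_le_trans qb)// ler_pdivrMr// mul1r.
rewrite min_r// max_r// mulrC -ltr_pdivrMr// aq/=.
by rewrite -ltr_pdivlMr.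
Qed.

End dense_times.

Section rcll_processes.
Context (disp : measure_display) (Omega : measurableType disp) (R : realType).
Context (P : probability Omega R) (T : R) (F : R -> set (set Omega)).
Hypotheses (T0 : 0 < T) (hF : is_filtration T F).
Context (d : nat).
Implicit Types (X Y : process Omega R d) (x y : R -> 'rV[R]_d).

Let sF t : t \in `[0, T] -> sigma_algebra [set: Omega] (F t).
Proof. by case: hF => H _ _; exact: H. Qed.
Let mF t : t \in `[0, T] -> F t `<=` measurable.
Proof. by case: hF => _ H _; exact: H. Qed.

Lemma rcllD x y : rcll T x -> rcll T y -> rcll T (fun t => x t + y t).
Proof.
move=> [x1 x2] [y1 y2]; split=> t t0 tT.
  by apply: cvgD; [exact: x1|exact: y1].
by apply: is_cvgD; [exact: x2|exact: y2].
Qed.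

Lemma rcllN x : rcll T x -> rcll T (fun t => - x t).
Proof.
move=> [x1 x2]; split=> t t0 tT; first by apply: cvgN; exact: x1.
by apply: is_cvgN; exact: x2.
Qed.

Lemma rcll_cst (v : 'rV[R]_d) : rcll T (fun=> v).
Proof. by split=> t _ _; [exact: cvg_cst|exact: is_cvg_cst]. Qed.

Definition sup_path X (t : R) (w : Omega) : \bar R :=
  ereal_sup [set (enorm (X s w))%:E | s in `[0, t]].

(** Right-continuity reduces the supremum over an interval to countably many
times, which makes it measurable; capping the dense times at t keeps the
endpoint t itself among them. *)
Lemma rcll_sup x t : rcll T x -> t \in `[0, T] ->
  ereal_sup [set (enorm (x s))%:E | s in `[0, t]] =
  ereal_sup (range (fun n => (enorm (x (Num.min (dense_time T n) t)))%:E)).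
Proof.
move=> [xr _] /[!in_itv]/= /andP[t0 tT].
apply/eqP; rewrite eq_le; apply/andP; split; apply: ge_ereal_sup => _ [s /= hs <-]; last first.
  apply: ereal_sup_ubound; exists (Num.min (dense_time T s) t) => //=.
  have := dense_timeP T0 s; rewrite !in_itv/= => /andP[d0 _].
  by rewrite le_min d0 t0 ge_min lexx orbT.
move: hs; rewrite in_itv/= => /andP[s0]; rewrite le_eqVlt => /predU1P[->|st].
  have [n nT] := dense_timeT T.
  by apply: ereal_sup_ubound; exists n => //; rewrite nT min_r.
have sT : s < T by rewrite (lt_le_trans st).
have /cvgrPdist_lt cvgs := enorm_cvg (at_right_proper_filter s) (xr s s0 sT).
apply/lee_addgt0Pr => eps eps0.
have /cvgs := eps0; rewrite near_withinE => /nbhs_ballP[e /= e0 He].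
have [||i /andP[si]] := @dense_time_dense R T T0 s (Num.min t (s + e)) s0.
- by rewrite lt_min st ltrDl.
- by rewrite ge_min tT.
rewrite lt_min => /andP[it ie].
have := He (dense_time T i); rewrite /ball/= => /(_ _ si) H.
have {}H : `|enorm (x s) - enorm (x (dense_time T i))| < eps.
  by apply: H; rewrite distrC gtr0_norm ?subr_gt0// ltrBlDl.
apply: (@le_trans _ _ ((enorm (x (dense_time T i)))%:E + eps%:E)%E).
  by rewrite -EFinD lee_fin; move: H; rewrite ltr_distl => /andP[_ /ltW]; lra.
rewrite leeD2r//; apply: ereal_sup_ubound; exists i => //.
by rewrite min_l// ltW.
Qed.

Lemma measurable_adapted X t : adapted T F X -> t \in `[0, T] ->
  forall i, measurable_fun [set: Omega] (fun w => X t w ord0 i).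
Proof.
move=> aX ht i; have mX := aX t ht i.
exact: (mwrt_measurable (sF ht) (mF ht) mX).
Qed.

Lemma measurable_rcll_sup X t : adapted T F X -> (forall w, rcll T (fun t => X t w)) ->
  t \in `[0, T] ->
  measurable_fun [set: Omega] (sup_path X t).
Proof.
move=> aX rX ht.
rewrite (_ : sup_path X t = fun w => ereal_sup (range (fun n => (enorm (X (Num.min (dense_time T n) t) w))%:E))).
  apply: measurable_ereal_sup_range => n; apply/measurable_EFinP.
  apply: measurable_enorm => i; apply: measurable_adapted => //.
  have := dense_timeP T0 n; move: ht; rewrite !in_itv/= => /andP[t0 tT] /andP[d0 dT].
  by rewrite le_min d0 t0/= ge_min tT orbT.
by apply/funext => w; exact: rcll_sup.
Qed.

Lemma sup_path_ge0 X (t : R) w : 0 <= t -> (0 <= sup_path X t w)%E.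
Proof.
move=> t0; apply: (@le_trans _ _ (enorm (X 0 w))%:E); first by rewrite lee_fin enorm_ge0.
by apply: ereal_sup_ubound; exists 0 => //=; rewrite in_itv/= lexx.
Qed.

Lemma adaptedD X Y : adapted T F X -> adapted T F Y -> adapted T F (fun t w => X t w + Y t w).
Proof.
move=> aX aY t ht i; under eq_fun do rewrite mxE.
by apply: measurable_funD; [exact: aX|exact: aY].
Qed.

Lemma adaptedN X : adapted T F X -> adapted T F (fun t w => - X t w).
Proof.
move=> aX t ht i; under eq_fun do rewrite mxE.
by apply: measurableT_comp => //; exact: aX.
Qed.

Lemma adapted_cst0 X : adapted T F X -> adapted T F (fun t w => X 0 w).
Proof.
move=> aX t ht i; have h0 : 0 \in `[0, T] by rewrite in_itv/= lexx ltW.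
have := aX 0 h0 i; apply: mwrt_sub; [exact: sF|exact: sF|].
by case: hF => _ _; move: ht; rewrite in_itv/= => /andP[? ?] ?; auto.
Qed.

Definition rcll_adapted X := adapted T F X /\ forall w, rcll T (fun t => X t w).

Lemma rcll_adaptedD X Y : rcll_adapted X -> rcll_adapted Y -> rcll_adapted (fun t w => X t w + Y t w).
Proof. by move=> [aX rX] [aY rY]; split; [exact: adaptedD|move=> w; exact: rcllD]. Qed.

Lemma rcll_adaptedN X : rcll_adapted X -> rcll_adapted (fun t w => - X t w).
Proof. by move=> [aX rX]; split; [exact: adaptedN|move=> w; exact: rcllN]. Qed.

Lemma rcll_adaptedB X Y : rcll_adapted X -> rcll_adapted Y -> rcll_adapted (fun t w => X t w - Y t w).
Proof. by move=> hX hY; exact: (rcll_adaptedD hX (rcll_adaptedN hY)). Qed.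

Lemma rcll_adapted_cst0 X : rcll_adapted X -> rcll_adapted (fun t w => X 0 w).
Proof. by move=> [aX rX]; split; [exact: adapted_cst0|move=> w; exact: rcll_cst]. Qed.

Lemma sup_norm_triangle p t X Y : (1 < p)%E -> t \in `[0, T] -> rcll_adapted X -> rcll_adapted Y ->
  (sup_norm P p t (fun t w => X t w + Y t w)%R <= sup_norm P p t X + sup_norm P p t Y)%E.
Proof.
move=> p1 ht hX hY; have [aX rX] := hX; have [aY rY] := hY.
have [aXY rXY] := rcll_adaptedD hX hY.
have t0 : 0 <= t by move: ht; rewrite in_itv/= => /andP[].
apply: le_trans (@Lnorm_triangle _ _ _ P _ (sup_path X t) (sup_path Y t) p1 _ _ _ _); last 4 first.
- exact: (measurable_rcll_sup aX rX ht).
- exact: (measurable_rcll_sup aY rY ht).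
- by move=> w; exact: sup_path_ge0.
- by move=> w; exact: sup_path_ge0.
rewrite -[X in (X <= _)%E]/(Lnorm P p (sup_path (fun t w => X t w + Y t w) t)).
apply: ge0_ae_le_Lnorm => //.
- exact: (measurable_rcll_sup aXY rXY ht).
- by apply: emeasurable_funD; exact: measurable_rcll_sup.
- by move=> w; exact: sup_path_ge0.
- by move=> w; rewrite adde_ge0// sup_path_ge0.
apply: nearW => w; apply: ge_ereal_sup => _ [s hs <-].
apply: (@le_trans _ _ ((enorm (X s w))%:E + (enorm (Y s w))%:E)%E).
  by rewrite -EFinD lee_fin enormD.
by apply: leeD; apply: ereal_sup_ubound; exists s.
Qed.

Lemma sup_normN p t X : sup_norm P p t (fun t w => - X t w) = sup_norm P p t X.
Proof.
by apply: eq_Lnorm => w; congr ereal_sup; apply: eq_imagel => s _; rewrite enormN.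
Qed.

Lemma sup_norm_mono p s t X : (1 < p)%E -> s \in `[0, T] -> t \in `[0, T] -> s <= t ->
  rcll_adapted X -> (sup_norm P p s X <= sup_norm P p t X)%E.
Proof.
move=> p1 hs ht st [aX rX].
have s0 : 0 <= s by move: hs; rewrite in_itv/= => /andP[].
rewrite /sup_norm -/(sup_path X s) -/(sup_path X t).
apply: ge0_ae_le_Lnorm => //.
- exact: measurable_rcll_sup.
- exact: measurable_rcll_sup.
- by move=> w; exact: sup_path_ge0.
- by move=> w; exact/sup_path_ge0/(le_trans s0).
apply: nearW => w; apply: le_ereal_sup => _ [u /= hu <-]; exists u => //=.
by move: hu; rewrite !in_itv/= => /andP[-> /le_trans]; exact.
Qed.

Lemma Lp_norm_le_sup_norm p s t X : (1 < p)%E -> s \in `[0, t] -> t \in `[0, T] ->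
  rcll_adapted X -> (Lp_norm P p (X s) <= sup_norm P p t X)%E.
Proof.
move=> p1 hs ht [aX rX].
have t0 : 0 <= t by move: ht; rewrite in_itv/= => /andP[].
have hs' : s \in `[0, T] by move: hs ht; rewrite !in_itv/= => /andP[-> st] /andP[_]; exact: le_trans.
apply: ge0_ae_le_Lnorm => //.
- by apply/measurable_EFinP/measurable_enorm => i; exact: measurable_adapted.
- exact: measurable_rcll_sup.
- by move=> w; rewrite lee_fin enorm_ge0.
- by move=> w; exact: sup_path_ge0.
by apply: nearW => w; apply: ereal_sup_ubound; exists s.
Qed.

Lemma Sp_rcll_adapted p X : Sp P p T F X -> rcll_adapted X.
Proof. by case. Qed.

Lemma SpP p X : rcll_adapted X -> (sup_norm P p T X < +oo)%E -> Sp P p T F X.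
Proof. by move=> [aX rX] ?; split. Qed.

Lemma SpD p X Y : (1 < p)%E -> Sp P p T F X -> Sp P p T F Y ->
  Sp P p T F (fun t w => X t w + Y t w).
Proof.
move=> p1 hX hY; have raX := Sp_rcll_adapted hX; have raY := Sp_rcll_adapted hY.
have hT : T \in `[0, T] by rewrite in_itv/= lexx ltW.
apply: SpP; first exact: (rcll_adaptedD raX raY).
apply: le_lt_trans (sup_norm_triangle p1 hT raX raY) _.
by rewrite lte_add_pinfty//; [case: hX|case: hY].
Qed.

Lemma SpN p X : Sp P p T F X -> Sp P p T F (fun t w => - X t w).
Proof.
move=> hX; apply: SpP; first exact: (rcll_adaptedN (Sp_rcll_adapted hX)).
by rewrite sup_normN; case: hX.
Qed.

Lemma SpB p X Y : (1 < p)%E -> Sp P p T F X -> Sp P p T F Y ->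
  Sp P p T F (fun t w => X t w - Y t w).
Proof. by move=> p1 hX hY; exact: (SpD p1 hX (SpN hY)). Qed.

Lemma Sp_cst0 p X : (1 < p)%E -> Sp P p T F X -> Sp P p T F (fun _ w => X 0 w).
Proof.
move=> p1 [aX rX fX]; have hT : T \in `[0, T] by rewrite in_itv/= lexx ltW.
have [aX0 rX0] : rcll_adapted (fun _ w => X 0 w) by exact: rcll_adapted_cst0.
apply: SpP => //; apply: le_lt_trans fX; apply: ge0_ae_le_Lnorm => //.
- exact: (measurable_rcll_sup aX0 rX0 hT).
- exact: (measurable_rcll_sup aX rX hT).
- by move=> w; rewrite -/(sup_path (fun _ w => X 0 w) T w) sup_path_ge0// ltW.
- by move=> w; rewrite -/(sup_path X T w) sup_path_ge0// ltW.
apply: nearW => w; apply: ge_ereal_sup => _ [s _ <-].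
by apply: ereal_sup_ubound; exists 0 => //=; rewrite in_itv/= lexx ltW.
Qed.

End rcll_processes.

(** * RCLL martingales closed by their terminal value *)

Lemma doob_const_ge0 (R : realType) (p : \bar R) : (1 < p)%E -> 0 <= doob_const p.
Proof.
rewrite /doob_const; case: p => // r; rewrite lte_fin => r1.
by rewrite divr_ge0 ?subr_ge0// ltW// (lt_trans _ r1).
Qed.

Section rcll_martingales.
Context (disp : measure_display) (Omega : measurableType disp) (R : realType).
Context (P : probability Omega R) (T : R) (F : R -> set (set Omega)).
Hypotheses (T0 : 0 < T) (hF : is_filtration T F) (hFuc : usual_conditions P T F).
Context (d : nat) (p : \bar R).
Hypothesis p1 : (1 < p)%E.

Let sF t : t \in `[0, T] -> sigma_algebra [set: Omega] (F t).
Proof. by case: hF => H _ _; exact: H. Qed.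
Let mF t : t \in `[0, T] -> F t `<=` measurable.
Proof. by case: hF => _ H _; exact: H. Qed.
Let leF s t : s \in `[0, T] -> t \in `[0, T] -> s <= t -> F s `<=` F t.
Proof.
by case: hF => _ _ H; rewrite !in_itv/= => /andP[s0 _] /andP[_ tT] st; exact: H.
Qed.
Let h0 : 0 \in `[0, T]. Proof. by rewrite in_itv/= lexx ltW. Qed.
Let hT : T \in `[0, T]. Proof. by rewrite in_itv/= lexx ltW. Qed.

(** Completeness of the filtration: modifying a variable on a negligible set does
not affect its measurability at any time. *)
Lemma negligible_F t A : t \in `[0, T] -> P.-negligible A -> F t A.
Proof.
move=> ht nA; have := (hFuc).1 A nA; apply: leF => //.
by move: ht; rewrite in_itv/= => /andP[].
Qed.

Lemma ae_eq_mwrt d' (U : measurableType d') t (X Y : Omega -> U) : t \in `[0, T] ->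
  {ae P, forall w, X w = Y w} -> mwrt (F t) Y -> mwrt (F t) X.
Proof.
move=> ht XY /(mwrtP _ (sF ht)) mY; apply/(mwrtP _ (sF ht)) => B mB.
pose Z := [set w | X w <> Y w].
have nZ : P.-negligible Z by exact: XY.
have -> : X @^-1` B = (Y @^-1` B `&` ~` Z) `|` (X @^-1` B `&` Z).
  apply/seteqP; split => [w Xw|w [[Yw /contrapT e]|[]//]].
    by have [e|e] := pselect (X w = Y w); [left; split; rewrite /= -?e//|right].
  by rewrite /= e.
have sFt := sF ht.
apply/(sigma_algebra_measurableP sFt)/measurableU; apply/(sigma_algebra_measurableP sFt).
- apply: (sigma_algebra_setI sFt); first exact: mY.
  by apply: (sigma_algebra_setC sFt); exact: negligible_F.
- apply: negligible_F => //; apply: negligibleS nZ; exact: subIsetr.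
Qed.

Lemma Lp_integrable (V : rvec Omega R d) : measurable_wrt (F T) V ->
  (Lp_norm P p V < +oo)%E -> integrable_rvec P V.
Proof.
move=> mV NV i.
have mVi j : measurable_fun [set: Omega] (fun w => V w ord0 j).
  exact: (mwrt_measurable (sF hT) (mF hT) (mV j)).
apply/integrableP; split; first exact/measurable_EFinP.
have mE : measurable_fun [set: Omega] (fun w => (enorm (V w))%:E).
  by apply/measurable_EFinP; exact: measurable_enorm.
apply: le_lt_trans NV; apply: le_trans (L1_le_Lnorm P p1 mE _); last first.
  by move=> w; rewrite lee_fin enorm_ge0.
apply: ge0_le_integral => //.
- by apply: measurableT_comp => //; exact/measurable_EFinP.
- by move=> w _; rewrite lee_fin abs_le_enorm.
Qed.

Lemma is_cond_exp_ae G (X Z Z' : rvec Omega R d) : G `<=` measurable ->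
  is_cond_exp P G X Z -> measurable_wrt G Z' ->
  (forall i, measurable_fun [set: Omega] (fun w => Z' w ord0 i)) ->
  {ae P, forall w, Z' w = Z w} -> is_cond_exp P G X Z'.
Proof.
move=> mG [mZ iZ eZ] mZ' mZO aeZ.
have mZi i : measurable_fun [set: Omega] (fun w => (Z w ord0 i)%:E) by exact: (measurable_int P (iZ i)).
have mZi' i : measurable_fun [set: Omega] (fun w => (Z' w ord0 i)%:E) by exact/measurable_EFinP.
split => // [i|A GA i].
  apply/integrableP; split => //; have /integrableP[_] := iZ i; apply: le_lt_trans.
  apply: ae_ge0_le_integral => //; try exact: measurableT_comp.
  by apply: filterS aeZ => w ->.
have mA := mG _ GA; rewrite -eZ//; apply: ae_eq_integral => //.
- exact: measurable_funTS.
- exact: measurable_funTS.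
- by apply: filterS aeZ => w ->.
Qed.

Lemma is_cond_expB G (X X' Z Z' : rvec Omega R d) : G `<=` measurable ->
  integrable_rvec P X -> integrable_rvec P X' ->
  is_cond_exp P G X Z -> is_cond_exp P G X' Z' ->
  is_cond_exp P G (fun w => X w - X' w) (fun w => Z w - Z' w).
Proof.
move=> mG iX iX' [mZ iZ eZ] [mZ' iZ' eZ'].
have E (U U' : rvec Omega R d) i : (fun w => ((U w - U' w) ord0 i)%:E) =
    ((fun w => (U w ord0 i)%:E) \- (fun w => (U' w ord0 i)%:E))%E.
  by apply/funext => w; rewrite !mxE.
split=> [i|i|A GA i].
- under eq_fun do rewrite !mxE.
  by apply: measurable_funB; [exact: mZ|exact: mZ'].
- by rewrite E; apply: integrableB.
have mA := mG _ GA.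
have iA h : P.-integrable [set: Omega] h -> P.-integrable A h.
  exact: (integrableS measurableT mA).
by rewrite !E !integralB//; try (exact: iA); rewrite eZ// eZ'.
Qed.

Lemma is_cond_exp_id (t : R) (X : rvec Omega R d) : integrable_rvec P X ->
  measurable_wrt (F t) X -> is_cond_exp P (F t) X X.
Proof. by []. Qed.

Lemma cond_exp_exists (V : rvec Omega R d) t : t \in `[0, T] -> integrable_rvec P V ->
  exists Z, is_cond_exp P (F t) V Z.
Proof.
move=> ht iV.
have /choice[Z hZ] : forall i : 'I_d, exists Z, cexp P (F t) (fun w => V w ord0 i) Z.
  by move=> i; apply: cexp_exists (iV i); [exact: sF|exact: mF].
exists (fun w => \row_i Z i w).
have E i : (fun w => (\row_i Z i w) ord0 i) = Z i by apply/funext => w; rewrite mxE.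
split.
- by move=> i; have [mZ _ _] := hZ i; rewrite /measurable_wrt E.
- by move=> i; have [_ + _] := hZ i; rewrite -(E i).
- move=> A FA i; have [_ _ eZ] := hZ i; rewrite -eZ//.
  by apply: eq_integral => w _; rewrite mxE.
Qed.

Local Notation e := (dense_time T).

(** Choose any version x t of E[V | F_t], with x T = V.  Almost surely its
restriction to a countable dense set of times is bounded, by Doob, and has
finitely many upcrossings of every rational interval; on this event let N be
its regularization, elsewhere 0.  Right-continuity of the filtration makes N
adapted, and dominated convergence along times decreasing to t identifies N t
as a conditional expectation. *)
Theorem rcll_version (V : rvec Omega R d) : measurable_wrt (F T) V ->
  (Lp_norm P p V < +oo)%E -> exists N : process Omega R d,
  [/\ rcll_adapted T F N, forall t, t \in `[0, T] -> is_cond_exp P (F t) V (N t)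
    & {ae P, forall w, N T w = V w}].
Proof.
move=> mV NV; have iV := Lp_integrable mV NV.
have [x [xT Vx]] : exists x : process Omega R d, x T = V /\
    forall t, t \in `[0, T] -> is_cond_exp P (F t) V (x t).
  have /choice[z hz] : forall t, exists Z, t \in `[0, T] -> is_cond_exp P (F t) V Z.
    move=> t; have [ht|ht] := boolP (t \in `[0, T]); last by exists V.
    by have [Z hZ] := cond_exp_exists ht iV; exists Z.
  exists (fun t => if t == T then V else z t); rewrite eqxx; split => // t ht.
  by case: eqP => [tT|_]; [split => //; rewrite tT|exact: hz].
pose S w := ereal_sup (range (fun n => (enorm (x (e n) w))%:E)).
have he n : e n \in `[0, T] by exact: dense_timeP.
have mx t : t \in `[0, T] -> forall i, measurable_fun [set: Omega] (fun w => x t w ord0 i).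
  by move=> ht i; have [m _ _] := Vx t ht; exact: (mwrt_measurable (sF ht) (mF ht) (m i)).
have mS : measurable_fun [set: Omega] S.
  apply: measurable_ereal_sup_range => n; apply/measurable_EFinP.
  by apply: measurable_enorm => i; exact: mx.
have S0 w : (0 <= S w)%E.
  by apply: (@le_trans _ _ (enorm (x (e 0%N) w))%:E); [rewrite lee_fin enorm_ge0|apply: ereal_sup_ubound; exists 0%N].
have D0 : (0 <= (doob_const p)%:E)%E by rewrite lee_fin doob_const_ge0.
have NS : (Lnorm P p S < +oo)%E.
  apply: le_lt_trans (doob_countable hF iV Vx (ltW T0) p1 he) _.
  by rewrite lte_mul_pinfty.
have iS : P.-integrable setT S.
  apply/integrableP; split => //; under eq_integral do rewrite gee0_abs//.
  exact: le_lt_trans (L1_le_Lnorm P p1 mS S0) NS.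
(* Q w says that the path w can be regularized; N picks such a path. *)
pose Q w := exists y : R -> 'rV[R]_d, [/\ y T = x T w, rcll T y &
   forall t : R, 0 <= t -> t < T -> forall i (eps : R), 0 < eps ->
      exists2 dl : R, 0 < dl & forall n, t < e n < t + dl -> `|x (e n) w ord0 i - y t ord0 i| <= eps].
have aeQ : {ae P, forall w, Q w}.
  have aeU : {ae P, forall w, forall i : 'I_d, forall n,
      if @unpickle (rat * rat)%type n is Some (a, b) then a < b ->
        exists N, forall k, (upcross (ratr a) (ratr b) false [seq x t w ord0 i | t <- grid e k] <= N)%N
      else True}.
    apply: filter_forall => i; apply: ae_foralln => n.
    case: unpickle => [[a b]|]; last exact: nearW.
    have [ab|ab] := boolP (a < b); last by apply: nearW => w.
    have abR : (ratr a : R) < ratr b by rewrite ltr_rat.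
    have := ae_upcross_bounded hF (iV i) (fun t ht => is_cond_exp_cexp i (Vx t ht)) abR (ltW T0) he.
    by apply: filterS => w.
  apply: filterS2 aeU (Lnorm_fin_ae p1 mS S0 NS) => w hU Sfin.
  have xB i n : `|x (e n) w ord0 i| <= fine (S w).
    rewrite (le_trans (abs_le_enorm _ _))// -lee_fin fineK ?ge0_fin_numE//.
    by apply: ereal_sup_ubound; exists n.
  have xU i (a b : rat) : a < b -> exists N, forall k,
      (upcross (ratr a) (ratr b) false (map (fun t => x t w ord0 i) (grid e k)) <= N)%N.
    by move=> ab; have := hU i (pickle (a, b)); rewrite pickleK; exact.
  have /choice[y hy] := fun i => regularization (@dense_time_dense R T T0) (xB i) (xU i).
  exists (fun t => \row_i y i t); split.
  - by apply/rowP => i; rewrite mxE; have [->] := hy i.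
  - split=> t t0 tT.
      apply/cvg_rowP => i; rewrite mxE; under eq_cvg do rewrite mxE.
      by have [_ _ h _] := hy i; exact: h.
    have /choice[l hl] : forall i : 'I_d, exists l : R, y i s @[s --> t^'-] --> l.
      by move=> i; have [_ _ _ h] := hy i; have /cvg_ex := h t t0 tT.
    apply/cvg_ex; exists (\row_i l i); apply/cvg_rowP => i.
    by rewrite mxE; under eq_cvg do rewrite mxE; exact: hl.
  - move=> t t0 tT i eps eps0; have [_ h _ _] := hy i.
    have [dl dl0 Hd] := h t t0 tT eps eps0.
    by exists dl => // n /Hd; rewrite mxE.
pose N (t : R) w : 'rV[R]_d := if pselect (Q w) is left q then projT1 (cid q) t else 0.
have NQ w : Q w -> [/\ N T w = x T w, rcll T (fun t => N t w) &
   forall t : R, 0 <= t -> t < T -> forall i (eps : R), 0 < eps ->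
      exists2 dl : R, 0 < dl & forall n, t < e n < t + dl -> `|x (e n) w ord0 i - N t w ord0 i| <= eps].
  by rewrite /N; case: pselect => // q _; case: cid.
have aeNT : {ae P, forall w, N T w = V w}.
  by apply: filterS aeQ => w /NQ[-> _ _]; rewrite xT.
have approx (t u : R) : 0 <= t -> t < u -> u <= T -> exists k : nat -> nat,
    (forall n, t < e (k n) < u) /\
    forall w, Q w -> forall i, x (e (k n)) w ord0 i @[n --> \oo] --> N t w ord0 i.
  move=> t0 tu uT.
  have /choice[k hk] : forall n : nat, exists k, t < e k < Num.min u (t + n.+1%:R^-1).
    move=> n; have n0 : 0 < n.+1%:R^-1 :> R by rewrite invr_gt0.
    apply: (dense_time_dense T0 t0); first by rewrite lt_min tu ltrDl.
    by rewrite ge_min uT.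
  exists k; split=> [n|w Qw i].
    by have := hk n; rewrite lt_min => /and3P[-> ->].
  have [_ _ H] := NQ w Qw.
  apply/cvgrPdist_le => eps eps0; have [dl dl0 Hd] := H t t0 (lt_le_trans tu uT) i eps eps0.
  near=> n; rewrite distrC; apply: Hd.
  have := hk n; rewrite lt_min => /and3P[-> _ /lt_le_trans]; apply.
  rewrite lerD2l; apply: ltW; near: n; exact: near_infty_natSinv_lt (PosNum dl0).
have hN (t : R) : 0 <= t -> t < T -> forall i (u : R), t < u -> u <= T ->
    mwrt (F u) (fun w => N t w ord0 i).
  move=> t0 tT i u tu uT; have [k [hk kN]] := approx t u t0 tu uT.
  have hu : u \in `[0, T] by rewrite in_itv/= uT andbT ltW// (le_lt_trans t0).
  pose a n (w : Omega) : R := if pselect (Q w) then x (e (k n)) w ord0 i else 0.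
  apply: (@measurable_fun_cvg _ (g_sigma_algebraType (F u)) _ setT a (fun w => N t w ord0 i)).
    move=> n; have [m _ _] := Vx (e (k n)) (he _).
    have mu : mwrt (F u) (fun w => x (e (k n)) w ord0 i).
      apply: mwrt_sub (m i); [exact: sF|exact: sF|].
      by apply: leF => //; case/andP: (hk n) => _ /ltW.
    apply: (ae_eq_mwrt hu _ mu); apply: filterS aeQ => w Qw.
    by rewrite /a; case: pselect.
  move=> w _; rewrite /a; case: (pselect (Q w)) => Qw; first exact: kN.
  rewrite (_ : N t w ord0 i = 0); last by rewrite /N; case: pselect => //; rewrite mxE.
  exact: cvg_cst.
have aN : adapted T F N.
  move=> t; rewrite in_itv/= => /andP[t0]; rewrite le_eqVlt => /predU1P[->|tT] i.
    apply: (@ae_eq_mwrt _ _ T _ (fun w => V w ord0 i)) => //.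
      by apply: filterS aeNT => w ->.
    exact: mV.
  have ht : t \in `[0, T] by rewrite in_itv/= t0 ltW.
  apply/(mwrtP _ (sF ht)) => B mB.
  rewrite (hFuc.2 t t0 tT) => u /=; rewrite in_itv/= => /andP[tu uT].
  have hu : u \in `[0, T] by rewrite in_itv/= uT andbT ltW// (le_lt_trans t0).
  by have /(mwrtP _ (sF hu)) := hN t t0 tT i u tu uT; exact.
have cN t : t \in `[0, T] -> is_cond_exp P (F t) V (N t).
  move=> ht; have := ht; rewrite in_itv/= => /andP[t0].
  rewrite le_eqVlt => /predU1P[tT|tT].
    rewrite tT; apply: (is_cond_exp_ae (mF hT) (Vx T hT)).
    + exact: aN.
    + by move=> i; apply: (mwrt_measurable (sF hT) (mF hT)); exact: aN.
    + by rewrite xT.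
  have [k [hk kN]] := approx t T t0 tT (lexx T).
  have mN i : measurable_fun [set: Omega] (fun w => (N t w ord0 i)%:E).
    by apply/measurable_EFinP; apply: (mwrt_measurable (sF ht) (mF ht)); exact: aN.
  have dom A i : measurable A -> [/\ P.-integrable A (fun w => (N t w ord0 i)%:E),
      (\int[P]_(w in A) `|(x (e (k n)) w ord0 i)%:E - (N t w ord0 i)%:E| @[n --> \oo] --> 0)%E &
      (\int[P]_(w in A) (x (e (k n)) w ord0 i)%:E @[n --> \oo] --> \int[P]_(w in A) (N t w ord0 i)%:E)%E].
    move=> mA; apply: (@dominated_convergence _ _ _ P A mA (fun n w => (x (e (k n)) w ord0 i)%:E)
      (fun w => (N t w ord0 i)%:E) S).
    + by move=> n; apply: measurable_funTS; apply/measurable_EFinP; exact: mx.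
    + exact: measurable_funTS.
    + apply: filterS aeQ => w Qw _; apply: cvg_EFin; last exact: kN.
      exact: nearW.
    + exact: (integrableS measurableT mA _ iS).
    + apply: nearW => w n _; apply: (@le_trans _ _ (enorm (x (e (k n)) w))%:E).
        by rewrite lee_fin abs_le_enorm.
      by apply: ereal_sup_ubound; exists (k n).
  split; first exact: aN.
    by move=> i; have [] := dom setT i measurableT.
  move=> A FA i; have mA := mF ht FA; have [_ _ c1] := dom A i mA.
  have c2 : (\int[P]_(w in A) (x (e (k n)) w ord0 i)%:E @[n --> \oo] --> \int[P]_(w in A) (V w ord0 i)%:E)%E.
    apply: cvg_near_cst; apply: nearW => n; have [_ _ eV] := Vx (e (k n)) (he _); apply: eV.
    by apply: (leF ht (he _)) FA; apply: ltW; case/andP: (hk n).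
  exact: (cvg_unique _ c1 c2).
exists N; split => //; split => // w.
have [Qw|nQ] := pselect (Q w); first by have [] := NQ w Qw.
have -> : (fun t => N t w) = fun=> 0 by apply/funext => t; rewrite /N; case: pselect.
exact: rcll_cst.
Unshelve. all: by end_near. Qed.

Lemma martingale_cond_exp (M : process Omega R d) t : martingale P T F M ->
  t \in `[0, T] -> is_cond_exp P (F t) (M T) (M t).
Proof. by move=> [_ _ H]; rewrite in_itv/= => /andP[t0 tT]; exact: H. Qed.

Lemma cond_exp_martingale (V : rvec Omega R d) (N : process Omega R d) :
  adapted T F N -> (forall t, t \in `[0, T] -> is_cond_exp P (F t) V (N t)) ->
  martingale P T F N.
Proof.
move=> aN cN; split => // [t ht|s t s0 st tT]; first by have [] := cN t ht.
have hs : s \in `[0, T] by rewrite in_itv/= s0 (le_trans st).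
have ht : t \in `[0, T] by rewrite in_itv/= tT (le_trans s0).
have [ms ims es] := cN s hs; have [_ _ et] := cN t ht.
by split => // A FA i; rewrite es// et//; exact: (leF hs ht st).
Qed.

Lemma sup_norm_cond_exp (V : rvec Omega R d) (N : process Omega R d) :
  integrable_rvec P V -> rcll_adapted T F N ->
  (forall t, t \in `[0, T] -> is_cond_exp P (F t) V (N t)) ->
  (sup_norm P p T N <= (doob_const p)%:E * Lp_norm P p V)%E.
Proof.
move=> iV [aN rN] cN.
have he n : e n \in `[0, T] by exact: dense_timeP.
apply: le_trans (doob_countable hF iV cN (ltW T0) p1 he).
rewrite /sup_norm; under [X in Lnorm _ _ X]eq_fun => w do rewrite (rcll_sup T0 (rN w) hT).
rewrite le_eqVlt; apply/orP; left; apply/eqP; apply: eq_Lnorm => w.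
congr ereal_sup; apply: eq_imagel => n _; rewrite min_l//.
by have := he n; rewrite in_itv/= => /andP[].
Qed.

(** N t = (Y 0 - Y' 0) - (M t - M' t) is a martingale with N 0 = Y 0 - Y' 0, so
the initial difference has norm at most that of N T, and M - M' = N 0 - N is
bounded by Doob's inequality: 1 + 1 + doob_const. *)
Lemma martingale_decomposition_bound (Y Y' M M' : process Omega R d) :
  Sp P p T F Y -> Mp0 P p T F M -> Sp P p T F Y' -> Mp0 P p T F M' ->
  (Lp_norm P p (fun w => Y 0 w - Y' 0 w)%R + sup_norm P p T (fun s w => M s w - M' s w)%R <=
   (2 + doob_const p)%:E * Lp_norm P p (fun w => (Y 0 w - M T w) - (Y' 0 w - M' T w))%R)%E.
Proof.
move=> hY [[hM M0] mM] hY' [[hM' M0'] mM'].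
pose N (t : R) w := (Y 0 w - Y' 0 w) - (M t w - M' t w).
have raY := Sp_rcll_adapted hY; have raY' := Sp_rcll_adapted hY'.
have raM := Sp_rcll_adapted hM; have raM' := Sp_rcll_adapted hM'.
have raD := rcll_adapted_cst0 T0 hF (rcll_adaptedB raY raY').
have raMM := rcll_adaptedB raM raM'.
have raN : rcll_adapted T F N by exact: (rcll_adaptedB raD raMM).
have iD : integrable_rvec P (fun w => Y 0 w - Y' 0 w).
  have mD : measurable_wrt (F T) (fun w => Y 0 w - Y' 0 w) by exact: (raD.1 T hT).
  apply: Lp_integrable mD _.
  apply: le_lt_trans (Lp_norm_le_sup_norm P T0 hF p1 h0 hT (rcll_adaptedB raY raY')) _.
  by case: (SpB T0 hF p1 hY hY').
have iM t : t \in `[0, T] -> integrable_rvec P (M t) by case: mM => _ H _; exact: H.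
have iM' t : t \in `[0, T] -> integrable_rvec P (M' t) by case: mM' => _ H _; exact: H.
have cN (t : R) : t \in `[0, T] -> is_cond_exp P (F t) (N T) (N t).
  move=> ht; apply: (is_cond_expB (mF ht) iD).
  - by case: (is_cond_expB (mF hT) (iM T hT) (iM' T hT) (martingale_cond_exp mM hT)
      (martingale_cond_exp mM' hT)).
  - exact: (is_cond_exp_id iD (raD.1 t ht)).
  - exact: (is_cond_expB (mF ht) (iM T hT) (iM' T hT) (martingale_cond_exp mM ht)
      (martingale_cond_exp mM' ht)).
have iN (t : R) : t \in `[0, T] -> integrable_rvec P (N t) by move=> /cN[].
have N0 : {ae P, forall w, N 0 w = Y 0 w - Y' 0 w}.
  by apply: filterS2 M0 M0' => w e1 e2; rewrite /N e1 e2 subrr subr0.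
have NTE : (fun w => (Y 0 w - M T w) - (Y' 0 w - M' T w)) = N T.
  by apply/funext => w; rewrite /N; apply/rowP => i; rewrite !mxE; ring.
rewrite NTE.
have b0 : (Lp_norm P p (fun w => Y 0%R w - Y' 0%R w)%R <= Lp_norm P p (N T))%E.
  apply: le_trans (Lnorm_cond_exp_le (sF h0) (mF h0) p1 (iN T hT) (cN 0 h0)).
  rewrite le_eqVlt; apply/orP; left; apply/eqP; apply: ae_eq_Lnorm => //.
  + by apply/measurable_EFinP/measurable_enorm => i; exact: (measurable_adapted hF raD.1 h0).
  + by apply/measurable_EFinP/measurable_enorm => i; exact: (measurable_adapted hF raN.1 h0).
  + by move=> w; rewrite lee_fin enorm_ge0.
  + by move=> w; rewrite lee_fin enorm_ge0.
  + by apply: filterS N0 => w ->.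
have supD : sup_norm P p T (fun _ w => Y 0 w - Y' 0 w) = Lp_norm P p (fun w => Y 0 w - Y' 0 w).
  apply: eq_Lnorm => w; apply/eqP; rewrite eq_le; apply/andP; split.
    by apply: ge_ereal_sup => _ [s _ <-].
  by apply: ereal_sup_ubound; exists 0.
have bM : (sup_norm P p T (fun s w => M s w - M' s w)%R <=
    Lp_norm P p (fun w => Y 0%R w - Y' 0%R w)%R + (doob_const p)%:E * Lp_norm P p (N T))%E.
  rewrite (_ : (fun s w => M s w - M' s w) = fun s w => (Y 0 w - Y' 0 w) + - N s w); last first.
    by apply/funext => s; apply/funext => w; apply/rowP => i; rewrite !mxE; ring.
  apply: le_trans (sup_norm_triangle P T0 hF p1 hT raD (rcll_adaptedN raN)) _.
  by rewrite sup_normN supD leeD2l//; exact: (sup_norm_cond_exp (iN T hT) raN cN).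
have n0 : (0 <= Lp_norm P p (N T))%E by exact: Lnorm_ge0.
have D0 := doob_const_ge0 p1.
have -> : (2 + doob_const p)%:E = (1 + (1 + (doob_const p)%:E))%E by rewrite -!EFinD addrA.
rewrite !ge0_muleDl ?adde_ge0 ?lee_fin// !mul1e.
apply: leeD => //; apply: le_trans bM _; exact: leeD2r.
Qed.

End rcll_martingales.

(** * Pathwise integrals of progressively measurable processes *)

Section vector_integral.
Context (R : realType) (d : nat).
Notation mu := (@lebesgue_measure R).
Implicit Types (v : R -> 'rV[R]_d) (t T : R).

Let mitv (a b : R) : @measurable _ (measurableTypeR R) `[a, b]%classic.
Proof. exact: measurable_itv. Qed.

Definition path_integrable T v :=
  forall i, mu.-integrable `[0, T] (fun s => (v s ord0 i)%:E).

Definition path_integral v t : 'rV[R]_d :=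
  \row_i \int[mu]_(s in `[0, t]) v s ord0 i.

Lemma path_integrableW s t v : s <= t -> path_integrable t v -> path_integrable s v.
Proof.
move=> st iv i; apply: integrableS (iv i) => //.
by apply: subset_itvl; rewrite bnd_simp.
Qed.

Lemma path_integrableB t v v' : path_integrable t v -> path_integrable t v' ->
  path_integrable t (fun s => v s - v' s).
Proof.
move=> iv iv' i; rewrite (_ : (fun s => _) =
    (fun s => (v s ord0 i)%:E) \- (fun s => (v' s ord0 i)%:E))%E.
  exact: integrableB.
by apply/funext => s; rewrite !mxE.
Qed.

Lemma path_integralB t v v' : path_integrable t v -> path_integrable t v' ->
  path_integral (fun s => v s - v' s) t = path_integral v t - path_integral v' t.
Proof.
move=> iv iv'; apply/rowP => i; rewrite !mxE -RintegralB//; [|exact: iv|exact: iv'].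
by apply: eq_Rintegral => s _; rewrite !mxE.
Qed.

Lemma path_integrable_enorm t v :
  (forall i, measurable_fun `[0, t] (fun s : measurableTypeR R => v s ord0 i)) ->
  (\int[mu]_(s in `[0%R, t]) (enorm (v s))%:E < +oo)%E -> path_integrable t v.
Proof.
move=> mv fin i; apply/integrableP; split.
  by apply/measurable_EFinP; exact: mv.
apply: le_lt_trans fin; apply: ge0_le_integral => //.
- by apply: measurableT_comp => //; apply/measurable_EFinP; exact: mv.
- by apply/measurable_EFinP; exact: (measurable_enorm mv).
- by move=> s _; rewrite lee_fin abs_le_enorm.
Qed.

(** The triangle inequality for the Euclidean norm: pair the integral x with
itself and use Cauchy-Schwarz under the integral sign. *)
Lemma enorm_path_integral t v : path_integrable t v ->
  ((enorm (path_integral v t))%:E <= \int[mu]_(s in `[0%R, t]) (enorm (v s))%:E)%E.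
Proof.
move=> iv; set x := path_integral v t.
have ie := integrable_enorm (mitv 0 t) iv.
have fe := integrable_fin_num (mitv _ _) ie.
rewrite -(fineK fe) lee_fin -/(Rintegral _ _ _).
have [x0|x0] := eqVneq (enorm x) 0.
  by rewrite x0; apply: Rintegral_ge0 => s _; rewrite enorm_ge0.
have {}x0 : 0 < enorm x by rewrite lt_neqAle eq_sym x0 enorm_ge0.
rewrite -(ler_pM2l x0) -expr2 sqr_enorm -RintegralZl//.
pose h i (s : R) := (x ord0 i * v s ord0 i)%:E.
have ih i : mu.-integrable `[0, t] (h i).
  rewrite (_ : h i = fun s => (x ord0 i)%:E * (v s ord0 i)%:E)%E//.
  exact: (integrableZl (mitv _ _) _ (iv i)).
have E : (\sum_i x ord0 i ^+ 2)%:E = (\int[mu]_(s in `[0%R, t]) (\sum_(i < d) x ord0 i * v s ord0 i)%:E)%E.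
  under eq_integral do rewrite -sumEFin.
  rewrite (integral_sum _ ih)// -sumEFin; apply: eq_bigr => i _.
  have -> : x ord0 i ^+ 2 = \int[mu]_(s in `[0, t]) (x ord0 i * v s ord0 i).
    by rewrite RintegralZl ?expr2//; [congr (_ * _); rewrite /x mxE|exact: iv].
  by rewrite /Rintegral fineK//; exact: (integrable_fin_num (mitv _ _) (ih i)).
rewrite (_ : \sum_i _ = \int[mu]_(s in `[0, t]) (\sum_(i < d) x ord0 i * v s ord0 i)); last first.
  by rewrite /Rintegral -E.
apply: le_Rintegral => //.
- rewrite (_ : EFin \o _ = fun s => \sum_i (h i s))%E; last first.
    by apply/funext => s; rewrite /h/= sumEFin.
  exact: integrable_sum.
- rewrite (_ : EFin \o _ = fun s => (enorm x)%:E * (enorm (v s))%:E)%E//.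
  exact: integrableZl.
- by move=> s _; exact: dot_le_enorm.
Qed.

Lemma rcll_path_integral T v : 0 < T -> path_integrable T v -> rcll T (path_integral v).
Proof.
move=> T0 iv.
have c i : {within `[0, T], continuous (fun t => \int[mu]_(s in `[0, t]) v s ord0 i)}.
  exact: (@parameterized_integral_continuous R 0 T _ (ltW T0) (iv i)).
split=> t t0 tT.
  apply/cvg_rowP => i; rewrite /path_integral mxE; under eq_cvg do rewrite mxE.
  have /(continuous_within_itvP _ T0)[cin c0 _] := c i.
  move: t0; rewrite le_eqVlt => /predU1P[<-|t0]; first exact: c0.
  by apply: cvg_at_right_filter; apply: cin; rewrite in_itv/= t0.
apply/cvg_ex; exists (path_integral v t).
apply/cvg_rowP => i; rewrite /path_integral mxE; under eq_cvg do rewrite mxE.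
have /(continuous_within_itvP _ T0)[cin _ cT] := c i.
move: tT; rewrite le_eqVlt => /predU1P[->|tT]; first exact: cT.
by apply: cvg_at_left_filter; apply: cin; rewrite in_itv/= t0.
Qed.

Lemma path_integral0 v : path_integral v 0 = 0.
Proof. by apply/rowP => i; rewrite !mxE set_itv1 Rintegral_set1. Qed.

Lemma path_integral_split T v t : path_integrable T v -> t \in `[0, T] ->
  \row_i (\int[mu]_(s in `[t, T]) v s ord0 i) = path_integral v T - path_integral v t.
Proof.
move=> iv; rewrite in_itv/= => /andP[t0 tT]; apply/rowP => i; rewrite !mxE.
rewrite (Rintegral_itvB (iv i)) ?bnd_simp//.
rewrite Rintegral_itv_obnd_cbnd//; apply: integrableS (iv i) => //.
by apply: subset_itvr; rewrite bnd_simp.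
Qed.

End vector_integral.

Section progressive.
Context (disp : measure_display) (Omega : measurableType disp) (R : realType).
Context (P : probability Omega R) (T : R) (F : R -> set (set Omega)).
Hypotheses (T0 : 0 < T) (hF : is_filtration T F).
Context (d : nat) (p : \bar R).
Hypothesis p1 : (1 < p)%E.
Notation mu := (@lebesgue_measure R).
Implicit Types (g W : process Omega R d).

Let sF (t : R) : t \in `[0, T] -> sigma_algebra [set: Omega] (F t).
Proof. by case: hF => H _ _; exact: H. Qed.
Let mF (t : R) : t \in `[0, T] -> F t `<=` measurable.
Proof. by case: hF => _ H _; exact: H. Qed.
Let hT : T \in `[0, T]. Proof. by rewrite in_itv/= lexx ltW. Qed.
Let mitv (a b : R) : @measurable _ (measurableTypeR R) `[a, b]%classic.
Proof. exact: measurable_itv. Qed.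

(** Extension by zero outside [0, t]: Tonelli's theorem concerns functions
measurable on the whole product. *)
Lemma progressive_restrict g (t : R) i : progressively_measurable T F g -> t \in `[0, T] ->
  measurable_fun [set: measurableTypeR R * g_sigma_algebraType (F t)]
    ((fun sw => g sw.1 sw.2 ord0 i) \_ (`[0, t]%classic `*` [set: Omega])).
Proof.
move=> mg ht.
have mD : measurable (`[0, t]%classic `*` [set: g_sigma_algebraType (F t)]
    : set (measurableTypeR R * g_sigma_algebraType (F t))) := measurableX (mitv _ _) measurableT.
apply: ((measurable_restrictT _ mD).1 _).
exact: (mg t ht i).
Qed.

Lemma progressive_joint g i : progressively_measurable T F g ->
  measurable_fun [set: measurableTypeR R * Omega]
    ((fun sw => g sw.1 sw.2 ord0 i) \_ (`[0, T]%classic `*` [set: Omega])).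
Proof.
move=> mg; have m := progressive_restrict i mg hT.
pose id_F (w : Omega) : g_sigma_algebraType (F T) := w.
have mid : measurable_fun [set: Omega] id_F by exact: (measurable_id_G (sF hT) (mF hT)).
have mpair : measurable_fun [set: measurableTypeR R * Omega]
    (fun sw : measurableTypeR R * Omega => (sw.1, id_F sw.2)).
  apply: measurable_fun_pair; first exact: measurable_fst.
  exact: (measurableT_comp mid (@measurable_snd _ _ _ _)).
exact: (measurableT_comp m mpair).
Qed.

Lemma progressive_at g (t : R) : progressively_measurable T F g -> t \in `[0, T] ->
  measurable_wrt (F t) (g t).
Proof.
move=> mg ht i; have := measurable_fun_pair2 t (progressive_restrict i mg ht).
rewrite (_ : (fun _ => _) = (fun w => g t w ord0 i))//.
apply/funext => w; rewrite patchE mem_set//=; split => //=.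
by move: ht; rewrite !in_itv/= => /andP[-> _]/=.
Qed.

Lemma progressive_path g w i : progressively_measurable T F g ->
  measurable_fun `[0, T] (fun s : measurableTypeR R => g s w ord0 i).
Proof.
move=> mg; apply: ((measurable_restrictT _ (mitv 0 T)).2 _).
have := measurable_fun_pair1 w (progressive_joint i mg).
rewrite (_ : (fun _ => _) = (fun s : measurableTypeR R => g s w ord0 i) \_ `[0, T])//.
by apply/funext => s; rewrite !patchE in_setX/= in_setT andbT.
Qed.

Lemma path_integral_mwrt g (t : R) : progressively_measurable T F g -> t \in `[0, T] ->
  measurable_wrt (F t) (fun w => path_integral (g^~ w) t).
Proof.
move=> mg ht i.
pose h (sw : measurableTypeR R * g_sigma_algebraType (F t)) : \bar R :=
  (((fun sw => g sw.1 sw.2 ord0 i) \_ (`[0, t]%classic `*` [set: Omega])) sw)%:E.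
have mh : measurable_fun setT h by apply/measurable_EFinP; exact: progressive_restrict.
have hE w : (fun s => h (s, w)) = (fun s => (g s w ord0 i)%:E) \_ `[0, t].
  by apply/funext => s; rewrite /h !patchE in_setX/= in_setT andbT; case: ifP.
rewrite (_ : (fun w => _) = fine \o (fun w => fubini_G mu h^\+%E w - fubini_G mu h^\-%E w)%E); last first.
  apply/funext => w; rewrite mxE /Rintegral/= integral_mkcond -hE integralE.
  rewrite /fubini_G; congr (fine (_ - _)%E); apply: eq_integral => s _.
    by rewrite !funeposE.
  by rewrite !funenegE.
apply: measurableT_comp => //; apply: emeasurable_funB.
- apply: measurable_fun_fubini_tonelli_G; first exact: measurable_funepos.
  by move=> x; rewrite funepos_ge0.
- apply: measurable_fun_fubini_tonelli_G; first exact: measurable_funeneg.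
  by move=> x; rewrite funeneg_ge0.
Qed.

Lemma Lnorm_time_integral g (t : R) : progressively_measurable T F g -> t \in `[0, T] ->
  measurable_fun [set: Omega] (fun w => \int[mu]_(s in `[0%R, t]) (enorm (g s w))%:E)%E /\
  (Lnorm P p (fun w => \int[mu]_(s in `[0%R, t]) (enorm (g s w))%:E) <=
   \int[mu]_(s in `[0%R, t]) Lp_norm P p (g s))%E.
Proof.
move=> mg ht; have tT : t <= T by move: ht; rewrite in_itv/= => /andP[].
pose h (sw : measurableTypeR R * Omega) : \bar R :=
  (enorm (\row_i ((fun sw => g sw.1 sw.2 ord0 i) \_ (`[0, T]%classic `*` [set: Omega])) sw))%:E.
have mh : measurable_fun setT h.
  apply/measurable_EFinP; apply: measurable_enorm => i; under eq_fun do rewrite mxE.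
  exact: progressive_joint.
have h0 z : (0 <= h z)%E by rewrite lee_fin enorm_ge0.
have hE s w : s \in `[0, t]%classic -> h (s, w) = (enorm (g s w))%:E.
  rewrite inE/= in_itv/= => /andP[s0 st].
  congr (enorm _)%:E; apply/rowP => i; rewrite mxE patchE mem_set//=; split => //=.
  by rewrite in_itv/= s0 (le_trans st).
have E w : (\int[mu]_(s in `[0%R, t]) (enorm (g s w))%:E = \int[mu]_(s in `[0%R, t]) h (s, w))%E.
  by apply: eq_integral => s hs; rewrite hE.
under eq_fun do rewrite E; split.
  rewrite (_ : (fun _ => _) = fubini_G mu (h \_ (`[0, t]%classic `*` [set: Omega]))); last first.
    apply/funext => w; rewrite /fubini_G [LHS]integral_mkcond.
    rewrite (_ : ((fun s => h (s, w)) \_ `[0, t]) =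
      fun s => (h \_ (`[0, t]%classic `*` [set: Omega])) (s, w))//.
    by apply/funext => s; rewrite !patchE in_setX/= in_setT andbT.
  apply: measurable_fun_fubini_tonelli_G.
    apply: ((measurable_restrictT _ (measurableX (mitv _ _) measurableT)).1 _).
    exact: measurable_funTS.
  by move=> z; rewrite patchE; case: ifP.
apply: le_trans (@Lnorm_minkowski_integral _ _ _ P _ _ mu _ _ h p1 (mitv 0 t) mh h0) _.
rewrite le_eqVlt; apply/orP; left; apply/eqP; apply: eq_integral => s hs.
by apply: eq_Lnorm => w; rewrite hE.
Qed.

Lemma ae_path_integrable g : progressively_measurable T F g ->
  (\int[mu]_(s in `[0%R, T]) Lp_norm P p (g s) < +oo)%E ->
  {ae P, forall w, path_integrable T (g^~ w)}.
Proof.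
move=> mg fin; have [m le] := Lnorm_time_integral mg hT.
have ge0 w : (0 <= \int[mu]_(s in `[0%R, T]) (enorm (g s w))%:E)%E.
  by apply: integral_ge0 => s _; rewrite lee_fin enorm_ge0.
have := Lnorm_fin_ae p1 m ge0 (le_lt_trans le fin); apply: filterS => w.
apply: path_integrable_enorm => i; exact: progressive_path.
Qed.

(** Minkowski's integral inequality, applied to the increasing majorant
int_0^t |g(s)| ds of the paths. *)
Lemma sup_norm_path_integral_le g W (t : R) : progressively_measurable T F g ->
  rcll_adapted T F W -> t \in `[0, T] ->
  {ae P, forall w, path_integrable T (g^~ w) /\
    forall s : R, s \in `[0, T] -> enorm (W s w) <= enorm (path_integral (g^~ w) s)} ->
  (sup_norm P p t W <= \int[mu]_(s in `[0%R, t]) Lp_norm P p (g s))%E.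
Proof.
move=> mg [aW rW] ht ae; have [m le] := Lnorm_time_integral mg ht.
have /andP[t0 tT] : 0 <= t <= T by move: ht; rewrite in_itv/=.
apply: le_trans le; apply: ge0_ae_le_Lnorm => //.
- exact: (measurable_rcll_sup T0 hF aW rW ht).
- by move=> w; exact: sup_path_ge0.
- by move=> w; apply: integral_ge0 => s _; rewrite lee_fin enorm_ge0.
apply: filterS ae => w [ig hW]; apply: ge_ereal_sup => _ [s /= + <-].
rewrite in_itv/= => /andP[s0 st].
have hs : s \in `[0, T] by rewrite in_itv/= s0 (le_trans st).
apply: (@le_trans _ _ (enorm (path_integral (g^~ w) s))%:E); first by rewrite lee_fin hW.
apply: le_trans (enorm_path_integral (path_integrableW (le_trans st tT) ig)) _.
apply: ge0_subset_integral => //.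
- have := integrable_enorm (mitv 0 t) (path_integrableW tT ig); exact: measurable_int.
- by move=> u _; rewrite lee_fin enorm_ge0.
- by apply: subset_itvl; rewrite bnd_simp.
Qed.

End progressive.

(** * The equation with a frozen driver *)

Section frozen_driver.
Context (disp : measure_display) (Omega : measurableType disp) (R : realType).
Context (P : probability Omega R) (T : R) (F : R -> set (set Omega)).
Hypotheses (T0 : 0 < T) (hF : is_filtration T F) (hFuc : usual_conditions P T F).
Context (d : nat) (p : \bar R).
Hypothesis p1 : (1 < p)%E.
Context (xi : rvec Omega R d).
Hypothesis hxi : Lp P p (F T) xi.
Notation mu := (@lebesgue_measure R).
Implicit Types (g Y M : process Omega R d).

Let sF (t : R) : t \in `[0, T] -> sigma_algebra [set: Omega] (F t).
Proof. by case: hF => H _ _; exact: H. Qed.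
Let mF (t : R) : t \in `[0, T] -> F t `<=` measurable.
Proof. by case: hF => _ H _; exact: H. Qed.
Let h0 : 0 \in `[0, T]. Proof. by rewrite in_itv/= lexx ltW. Qed.
Let hT : T \in `[0, T]. Proof. by rewrite in_itv/= lexx ltW. Qed.

Definition frozen_solution g Y M := bsde_solution P p T F xi (fun t w _ _ => g t w) Y M.

Lemma Lp_normD (X X' : rvec Omega R d) :
  (forall i, measurable_fun setT (fun w => X w ord0 i)) ->
  (forall i, measurable_fun setT (fun w => X' w ord0 i)) ->
  (Lp_norm P p (fun w => X w + X' w)%R <= Lp_norm P p X + Lp_norm P p X')%E.
Proof.
move=> mX mX'.
apply: le_trans (@Lnorm_triangle _ _ _ P p (fun w => (enorm (X w))%:E) (fun w => (enorm (X' w))%:E) p1 _ _ _ _); last 4 first.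
- by apply/measurable_EFinP; exact: measurable_enorm.
- by apply/measurable_EFinP; exact: measurable_enorm.
- by move=> w; rewrite lee_fin enorm_ge0.
- by move=> w; rewrite lee_fin enorm_ge0.
apply: ge0_ae_le_Lnorm => //.
- apply/measurable_EFinP; apply: measurable_enorm => i; under eq_fun do rewrite mxE.
  exact: measurable_funD.
- by apply: emeasurable_funD; apply/measurable_EFinP; exact: measurable_enorm.
- by move=> w; rewrite lee_fin enorm_ge0.
- by move=> w; rewrite -EFinD lee_fin addr_ge0// enorm_ge0.
- by apply: nearW => w; rewrite -EFinD lee_fin enormD.
Qed.

(** Paths that are not integrable form a negligible set, where X is set to 0; this
is where completeness keeps X adapted. *)
Lemma frozen_exists g : progressively_measurable T F g ->
  (\int[mu]_(s in `[0%R, T]) Lp_norm P p (g s) < +oo)%E ->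
  exists Y M, frozen_solution g Y M.
Proof.
move=> mg fin; have aeg := ae_path_integrable T0 hF p1 mg fin.
pose X (t : R) w : 'rV[R]_d :=
  if pselect (path_integrable T (g^~ w)) then - path_integral (g^~ w) t else 0.
have raX : rcll_adapted T F X.
  split=> [t ht i|w].
    apply: (@ae_eq_mwrt _ _ _ P T F T0 hF hFuc _ _ t _ (fun w => (- path_integral (g^~ w) t) ord0 i) ht).
      by apply: filterS aeg => w Gw; rewrite /X; case: pselect.
    have := path_integral_mwrt mg ht i.
    rewrite (_ : (fun w => (- path_integral (g^~ w) t) ord0 i) = -%R \o (fun w => path_integral (g^~ w) t ord0 i)).
      by move=> m; apply: measurableT_comp.
    by apply/funext => w; rewrite /= mxE.
  rewrite /X; case: pselect => Gw; last exact: rcll_cst.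
  exact: (rcllN (rcll_path_integral T0 Gw)).
have supX : (sup_norm P p T X < +oo)%E.
  apply: le_lt_trans fin; apply: (sup_norm_path_integral_le T0 hF p1 mg raX hT).
  apply: filterS aeg => w Gw; split => // s _; rewrite /X; case: pselect => // ?.
  by rewrite enormN.
have [mxi Nxi] := hxi.
pose V w := xi w - X T w.
have mX i : measurable_fun [set: Omega] (fun w => X T w ord0 i) by exact: (measurable_adapted hF raX.1 hT).
have mV : measurable_wrt (F T) V.
  move=> i; rewrite /V; under eq_fun do rewrite !mxE.
  by apply: measurable_funB; [exact: mxi|exact: (raX.1 T hT)].
have NV : (Lp_norm P p V < +oo)%E.
  apply: le_lt_trans (Lp_normD (X' := fun w => - X T w) _ _) _.
  - by move=> i; exact: (mwrt_measurable (sF hT) (mF hT) (mxi i)).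
  - by move=> i; under eq_fun do rewrite mxE; exact: measurableT_comp.
  rewrite /Lp_norm; under [X in (_ + Lnorm _ _ X)%E]eq_fun do rewrite enormN.
  rewrite lte_add_pinfty//; apply: le_lt_trans supX.
  exact: (Lp_norm_le_sup_norm P T0 hF p1 hT hT raX).
have iV := Lp_integrable T0 hF p1 mV NV.
have [N [raN cN NT]] := rcll_version T0 hF hFuc p1 mV NV.
have mN := cond_exp_martingale hF raN.1 cN.
have iN (t : R) : t \in `[0, T] -> integrable_rvec P (N t) by move=> /cN[].
have supN : (sup_norm P p T N < +oo)%E.
  apply: le_lt_trans (sup_norm_cond_exp T0 hF p1 iV raN cN) _.
  by rewrite lte_mul_pinfty// lee_fin doob_const_ge0.
have raN0 := rcll_adapted_cst0 T0 hF raN.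
pose M (t : R) w := N 0 w - N t w.
have raM : rcll_adapted T F M by exact: (rcll_adaptedB raN0 raN).
have cM (t : R) : t \in `[0, T] -> is_cond_exp P (F t) (M T) (M t).
  move=> ht; apply: (is_cond_expB (mF ht) (iN 0 h0) (iN T hT)).
  - exact: (is_cond_exp_id (iN 0 h0) (raN0.1 t ht)).
  - exact: (martingale_cond_exp mN ht).
have SN : Sp P p T F N by exact: SpP.
have SX : Sp P p T F X by exact: SpP.
exists (fun t w => N t w + X t w), M; split.
- exact: (SpD T0 hF p1 SN SX).
- split; last exact: (cond_exp_martingale hF raM.1 cM).
  split; last by apply: nearW => w; rewrite /M subrr.
  exact: (SpB T0 hF p1 (Sp_cst0 T0 hF p1 SN) SN).
- by apply: filterS aeg.
- apply: filterS2 aeg NT => w Gw NTw t ht.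
  rewrite (path_integral_split Gw ht) /M NTw /V /X; case: pselect => // ?.
  by apply/rowP => i; rewrite !mxE; ring.
Qed.

Lemma frozen_increment g Y M : frozen_solution g Y M ->
  {ae P, forall w, [/\ path_integrable T (g^~ w), Y T w = xi w &
    forall t : R, t \in `[0, T] -> Y t w - Y 0 w + M t w = - path_integral (g^~ w) t]}.
Proof.
move=> [hY [[hM M0] mM] ig eqn].
move: ig; apply: filterS3 eqn M0 => w eqn M0 ig; split => //.
  by rewrite (eqn T hT) path_integral_split// addrK subrr addr0.
move=> t ht; rewrite (eqn t ht) (eqn 0 h0) !path_integral_split// path_integral0 M0.
by apply/rowP => i; rewrite !mxE; ring.
Qed.

(** The combination of Y and M that enters the Lipschitz condition locally in
time; for a solution it has bounded variation. *)
Definition increment Y M : process Omega R d := fun t w => Y t w - Y 0 w + M t w.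

Lemma rcll_adapted_increment Y M : Sp P p T F Y -> Mp0 P p T F M ->
  rcll_adapted T F (increment Y M).
Proof.
move=> /Sp_rcll_adapted hY [[/Sp_rcll_adapted hM _] _].
exact: (rcll_adaptedD (rcll_adaptedB hY (rcll_adapted_cst0 T0 hF hY)) hM).
Qed.

Lemma progressively_measurableB g g' : progressively_measurable T F g ->
  progressively_measurable T F g' -> progressively_measurable T F (fun t w => g t w - g' t w).
Proof.
move=> mg mg' t ht i; rewrite (_ : (fun sw => _) =
    (fun sw : R * g_sigma_algebraType (F t) => g sw.1 sw.2 ord0 i - g' sw.1 sw.2 ord0 i)).
  by apply: measurable_funB; [exact: mg|exact: mg'].
by apply/funext => sw; rewrite !mxE.
Qed.

(** The martingale parts cancel in the increments, leaving the integral of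
g' - g.  At time T both solutions take the value xi, so that the difference of
Y 0 - M T between them is the opposite of the increment at T, and
[martingale_decomposition_bound] applies. *)
Theorem frozen_contraction g g' Y M Y' M' :
  progressively_measurable T F g -> progressively_measurable T F g' ->
  frozen_solution g Y M -> frozen_solution g' Y' M' ->
  (forall t : R, t \in `[0, T] ->
    (sup_norm P p t (fun t w => increment Y M t w - increment Y' M' t w)%R <=
    \int[mu]_(s in `[0%R, t]) Lp_norm P p (fun w => g s w - g' s w)%R)%E) /\
  (Lp_norm P p (fun w => Y 0%R w - Y' 0%R w)%R + sup_norm P p T (fun s w => M s w - M' s w)%R <=
   (2 + doob_const p)%:E * \int[mu]_(s in `[0%R, T]) Lp_norm P p (fun w => g s w - g' s w)%R)%E.
Proof.
move=> mg mg' sol sol'.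
have [hY hM _ _] := sol; have [hY' hM' _ _] := sol'.
have raI : rcll_adapted T F (increment Y M) by exact: (rcll_adapted_increment hY hM).
have raI' : rcll_adapted T F (increment Y' M') by exact: (rcll_adapted_increment hY' hM').
have raD := rcll_adaptedB raI raI'.
have mgg : progressively_measurable T F (fun t w => g t w - g' t w).
  exact: progressively_measurableB.
have bound (t : R) : t \in `[0, T] ->
    (sup_norm P p t (fun t w => increment Y M t w - increment Y' M' t w)%R <=
     \int[mu]_(s in `[0%R, t]) Lp_norm P p (fun w => g s w - g' s w)%R)%E.
  move=> ht; apply: (sup_norm_path_integral_le T0 hF p1 mgg raD ht).
  apply: filterS2 (frozen_increment sol) (frozen_increment sol') => w [ig _ E] [ig' _ E'].
  split=> [|s hs]; first exact: path_integrableB.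
  have sT : s <= T by move: hs; rewrite in_itv/= => /andP[].
  rewrite (path_integralB (path_integrableW sT ig) (path_integrableW sT ig')).
  by rewrite /increment (E s hs) (E' s hs) -opprD enormN.
split=> //; apply: le_trans (martingale_decomposition_bound T0 hF p1 hY hM hY' hM') _.
apply: lee_pmul => //; [by rewrite lee_fin addr_ge0// doob_const_ge0|exact: Lnorm_ge0|].
apply: le_trans (bound T hT); apply: le_trans (Lp_norm_le_sup_norm P T0 hF p1 hT hT raD).
have m1 (U : rvec Omega R d) : measurable_wrt (F T) U ->
    measurable_fun [set: Omega] (fun w => (enorm (U w))%:E).
  move=> mU; apply/measurable_EFinP/measurable_enorm => i.
  exact: (mwrt_measurable (sF hT) (mF hT) (mU i)).
have raB Z N : Sp P p T F Z -> Mp0 P p T F N -> rcll_adapted T F (fun t w => Z 0 w - N t w).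
  move=> /Sp_rcll_adapted hZ [[/Sp_rcll_adapted hN _] _].
  exact: (rcll_adaptedB (rcll_adapted_cst0 T0 hF hZ) hN).
apply: ge0_ae_le_Lnorm => //.
- have [aYM _] := rcll_adaptedB (raB _ _ _ hY hM) (raB _ _ _ hY' hM').
  exact: (m1 (fun w => Y 0 w - M T w - (Y' 0 w - M' T w)) (aYM T hT)).
- exact: (m1 (fun w => increment Y M T w - increment Y' M' T w) (raD.1 T hT)).
- by move=> w; rewrite lee_fin enorm_ge0.
- by move=> w; rewrite lee_fin enorm_ge0.
apply: filterS2 (frozen_increment sol) (frozen_increment sol') => w [_ E _] [_ E' _].
rewrite -[in leRHS]enormN lee_fin /increment E E'.
rewrite (_ : - (xi w - Y 0 w + M T w - (xi w - Y' 0 w + M' T w)) =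
  Y 0 w - M T w - (Y' 0 w - M' T w))//.
by apply/rowP => i; rewrite !mxE; ring.
Qed.

End frozen_driver.

(** * Lower integrals, exponential weights, geometric series *)

Section lower_integral.
Context (d1 : measure_display) (T1 : measurableType d1) (R : realType).
Context (m : {measure set T1 -> \bar R}) (D : set T1).
Hypothesis mD : measurable D.
Local Open Scope ereal_scope.
Import HBNNSimple.

(** For nonmeasurable a the integral is a lower integral, in general only
superadditive.  With a constant c equality persists: the excess over c of a
simple function below a + c is a measurable function below a. *)
Lemma lower_integralD_cst_le (a : T1 -> \bar R) (c : R) : (0 <= c)%R ->
  (forall x, 0 <= a x) ->
  \int[m]_(x in D) (a x + c%:E) <= \int[m]_(x in D) a x + c%:E * m D.
Proof.
move=> c0 a0; rewrite integral_mkcond ge0_integralTE; last first.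
  by move=> x; rewrite patchE; case: ifP => // _; rewrite adde_ge0.
apply: ge_ereal_sup => _ [k /= kle <-]; rewrite -integralT_nnsfun.
pose b x := maxe 0 ((k x)%:E - c%:E).
have mk : measurable_fun [set: T1] (fun x => (k x)%:E) by exact/measurable_EFinP.
have mb : measurable_fun [set: T1] b.
  by apply: measurable_maxe => //; exact: emeasurable_funB.
have b0 x : 0 <= b x by rewrite le_max lexx.
have mc : measurable_fun [set: T1] (fun x => c%:E * (\1_D x)%:E).
  by apply: emeasurable_funM => //; apply/measurable_EFinP.
apply: (@le_trans _ _ (\int[m]_x (b x + c%:E * (\1_D x)%:E))).
  apply: ge0_le_integral => //.
  - by move=> x _; rewrite lee_fin.
  - exact: emeasurable_funD.
  move=> x _; have := kle x; rewrite patchE indicE; case: (x \in D) => /= kx.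
    by rewrite mule1 -leeBlDr// le_max lexx orbT.
  by rewrite mule0 adde0 (le_trans kx).
rewrite ge0_integralD//; last by move=> x _; rewrite mule_ge0// lee_fin.
rewrite ge0_integralZl//; last exact/measurable_EFinP.
rewrite integral_indic// setIT leeD2r//.
rewrite [leRHS]integral_mkcond; apply: ge0_le_integral_nomeas => // x _.
have := kle x; rewrite /b !patchE; case: (x \in D) => kx.
  by rewrite ge_max a0 andTb leeBlDr.
by rewrite ge_max lexx andTb leeBlDr// add0e (le_trans kx)// lee_fin.
Qed.

End lower_integral.

Section exponential_weight.
Context (R : realType).

Lemma integral_exp_weight (B lam t : R) : 0 <= t ->
  (\int[@lebesgue_measure R]_(s in `[0%R, t]) (B * lam * expR (lam * s))%:E =
   (B * (expR (lam * t) - 1))%:E)%E.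
Proof.
rewrite le_eqVlt => /predU1P[<-|t0].
  by rewrite set_itv1 integral_set1 mulr0 expR0 subrr mulr0.
have cE : continuous (fun s : R => expR (lam * s)).
  by move=> s; apply: continuous_comp; [exact: mulrl_continuous|exact: continuous_expR].
have dE s : derivable (fun s : R => expR (lam * s)) s 1.
  exact: ex_derive.
have cF : continuous (fun s : R => B * expR (lam * s)).
  by move=> s; apply: cvgM; [exact: cvg_cst|exact: cE].
rewrite (@continuous_FTC2 _ _ (fun s => B * expR (lam * s)) _ _ t0).
- by rewrite mulr0 expR0 -EFinB mulrBr.
- apply: continuous_subspaceT => s; apply: cvgM; [exact: cvg_cst|exact: cE].
- split=> [s _||]; first by apply: derivableM => //; exact: derivable_cst.
  + by apply: cvg_at_right_filter; exact: cF.
  + by apply: cvg_at_left_filter; exact: cF.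
- move=> s _; rewrite derive1Ml// derive1_comp// derive1E.
  by have /funeqP -> := @derive_expR R; rewrite derive1Ml// derive1_id mulr1 mulrCA mulrC.
Qed.

(** The function lam |-> C2 K (e^(lam T) - 1) is at most C1 slightly beyond C1,
because C2 K (e^(C1 T) - 1) < C1.  Replacing C2 K by the larger q, the
midpoint of C2 K and its upper bound, makes the case C2 = 0 uniform and lets
lam be solved from q (e^(lam T) - 1) = C1. *)
Lemma weight_exponent_exists (C1 C2 K c T : R) : 0 < T -> 0 < C1 -> 0 <= C2 ->
  0 < K -> K * c <= 1 -> C2 < c * C1 / (expR (C1 * T) - 1) ->
  exists2 lam, C1 < lam & C2 * K * (expR (lam * T) - 1) <= C1.
Proof.
move=> T0 C10 C20 K0 Kc C2lt.
have e0 : 0 < expR (C1 * T) - 1 by rewrite subr_gt0 expR_gt1 mulr_gt0.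
have KC2 : C2 * K < C1 / (expR (C1 * T) - 1).
  rewrite -(ltr_pM2r K0) in C2lt; apply: (lt_le_trans C2lt).
  rewrite (_ : _ * K = K * c * (C1 / (expR (C1 * T) - 1))); last by ring.
  by rewrite ler_piMl// ltW// divr_gt0.
pose q := (C2 * K + C1 / (expR (C1 * T) - 1)) / 2.
have r0 : 0 < C1 / (expR (C1 * T) - 1) by rewrite divr_gt0.
have [q0 C2q qr] : [/\ 0 < q, C2 * K <= q & q < C1 / (expR (C1 * T) - 1)].
  have C2K : 0 <= C2 * K by rewrite mulr_ge0// ltW.
  by rewrite /q; split; lra.
exists (ln (1 + C1 / q) / T).
  rewrite ltr_pdivlMr// -ltr_expR lnK; last by rewrite posrE addr_gt0// divr_gt0.
  by rewrite addrC -ltrBlDr ltr_pdivlMr// mulrC -ltr_pdivlMr.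
rewrite divfK ?gt_eqF// lnK; last by rewrite posrE addr_gt0// divr_gt0.
by rewrite addrAC subrr add0r mulrA ler_pdivrMr// mulrC ler_wpM2l ?(ltW C10).
Qed.

(** The product is (3p - 2)/(4p - 1) in general, 4/5 for p = 2, 3/4 for
p = +oo. *)
Lemma bsde_const_bound (p : \bar R) : (1 < p)%E ->
  (2 + doob_const p) * bsde_const p <= 1.
Proof.
rewrite /doob_const /bsde_const; case: p => // [r|_]; last by lra.
rewrite lte_fin => r1; case: eqP => [->|_].
  by rewrite (_ : 2 - 1 = 1) ?divr1; lra.
have r10 : 0 < r - 1 by rewrite subr_gt0.
rewrite mulrA ler_pdivrMr ?mul1r; last by lra.
rewrite mulrDl divfK ?gt_eqF//; lra.
Qed.

End exponential_weight.

Section summable_increments.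
Context (R : realType) (d : nat).

(** Applied to a shifted sequence, the bound controls the tail of the
approximation. *)
Lemma summable_increments_cvg (x : nat -> 'rV[R]_d) :
  (\sum_(k <oo) (enorm (x k.+1 - x k))%:E < +oo)%E ->
  exists l : 'rV[R]_d, (forall i, x n ord0 i @[n --> \oo] --> l ord0 i) /\
    ((enorm (l - x 0%N))%:E <= \sum_(k <oo) (enorm (x k.+1 - x k))%:E)%E.
Proof.
set S := (\sum_(k <oo) _)%E => Sfin.
have S0 : (0 <= S)%E by apply: nneseries_ge0 => k _ _; rewrite lee_fin enorm_ge0.
have SE : S = (fine S)%:E by rewrite fineK// ge0_fin_numE.
have partial n : \sum_(0 <= k < n) enorm (x k.+1 - x k) <= fine S.
  rewrite -lee_fin -SE -sumEFin; apply: nneseries_lim_ge => k _ _.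
  by rewrite lee_fin enorm_ge0.
have dist n : enorm (x n - x 0%N) <= fine S.
  apply: le_trans (partial n); elim: n => [|n IH]; first by rewrite subrr enorm0 big_geq.
  rewrite big_nat_recr//= (_ : x n.+1 - x 0%N = (x n - x 0%N) + (x n.+1 - x n)).
    by apply: le_trans (enormD _ _) _; rewrite lerD2r.
  by apply/rowP => i; rewrite !mxE; ring.
have cvgi i : cvgn (fun n => x n ord0 i).
  have cs : cvgn [normed series (fun k => x k.+1 ord0 i - x k ord0 i)].
    apply: nondecreasing_is_cvgn.
      by apply: nondecreasing_series => k _ _; exact: normr_ge0.
    exists (fine S) => _ [n _ <-]; apply: le_trans (partial n); apply: ler_sum => k _.
    by have := abs_le_enorm (x k.+1 - x k) i; rewrite !mxE.
  have /cvg_ex[l hl] := normed_cvg cs; apply/cvg_ex; exists (l + x 0%N ord0 i).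
  rewrite (_ : (fun n => x n ord0 i) =
    (fun n => series (fun k => x k.+1 ord0 i - x k ord0 i) n + x 0%N ord0 i)).
    by apply: cvgD => //; exact: cvg_cst.
  by apply/funext => n; rewrite /series/= telescope_sumr// subrK.
exists (\row_i limn (fun n => x n ord0 i)).
have cl i : x n ord0 i @[n --> \oo] --> (\row_i limn (fun n => x n ord0 i)) ord0 i.
  by rewrite mxE; exact: cvgi.
split => //; rewrite SE lee_fin.
have /enorm_cvg c : (x n - x 0%N) @[n --> \oo] --> \row_i limn (fun n => x n ord0 i) - x 0%N.
  by apply: cvgB; [apply/cvg_rowP|exact: cvg_cst].
by rewrite -(cvg_lim _ c)//; apply: limr_le; [apply/cvg_ex; eexists; exact: c|exact: nearW].
Qed.

End summable_increments.

Lemma Lnorm_nneseries (disp : measure_display) (Omega : measurableType disp) (R : realType)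
    (P : probability Omega R) (p : \bar R) (u : nat -> Omega -> \bar R) (a : nat -> \bar R) :
  (1 < p)%E -> (forall k, measurable_fun [set: Omega] (u k)) ->
  (forall k w, (0 <= u k w)%E) -> (forall k, (Lnorm P p (u k) <= a k)%E) ->
  (Lnorm P p (fun w => \sum_(k <oo) u k w) <= \sum_(k <oo) a k)%E.
Proof.
move=> p1 mu u0 ua.
have a0 k : (0 <= a k)%E by apply: le_trans (ua k); exact: Lnorm_ge0.
have ms n : measurable_fun [set: Omega] (fun w => \sum_(0 <= k < n) u k w)%E.
  exact: emeasurable_sum.
have s0 n w : (0 <= \sum_(0 <= k < n) u k w)%E by exact: sume_ge0.
apply: (Lnorm_fatou p1 ms s0).
- by apply: ge0_emeasurable_sum => // k w _ _.
- by move=> w; apply: nneseries_ge0.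
- by apply: nearW => w; apply: is_cvg_nneseries.
move=> n; apply: (@le_trans _ _ (\sum_(0 <= k < n) a k)%E); last exact: nneseries_lim_ge.
elim: n => [|n IH].
  rewrite big_geq//; under [X in Lnorm _ _ X]eq_fun do rewrite big_geq//.
  by rewrite Lnorm0// gt_eqF// (lt_trans _ p1).
rewrite big_nat_recr//=; under [X in Lnorm _ _ X]eq_fun do rewrite big_nat_recr//=.
by apply: le_trans (Lnorm_triangle P p1 _ _ _ _) _ => //; exact: leeD.
Qed.

(** * The fixed point *)

Section fixed_point.
Context (disp : measure_display) (Omega : measurableType disp) (R : realType).
Context (P : probability Omega R) (T : R) (F : R -> set (set Omega)).
Hypotheses (T0 : 0 < T) (hF : is_filtration T F) (hFuc : usual_conditions P T F).
Context (d : nat) (p : \bar R).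
Hypothesis p1 : (1 < p)%E.
Context (xi : rvec Omega R d).
Hypothesis hxi : Lp P p (F T) xi.
Context (f : driver Omega R d).
Hypothesis hf_meas : forall Y M : process Omega R d,
  Sp P p T F Y -> Mp0 P p T F M -> progressively_measurable T F (driver_at f Y M).
Hypothesis hf_int : (\int[@lebesgue_measure R]_(t in `[0%R, T])
  Lp_norm P p (driver_at f (zero_process Omega R d) (zero_process Omega R d) t) < +oo)%E.
Context (C1 C2 lam : R).
Hypotheses (C1_gt0 : 0 < C1) (C2_ge0 : 0 <= C2).
Hypothesis hf_lip : forall (t : R) (Y M Y' M' : process Omega R d), t \in `[0, T] ->
  Sp P p T F Y -> Mp0 P p T F M -> Sp P p T F Y' -> Mp0 P p T F M' ->
  (Lp_norm P p (fun w => f t w Y M - f t w Y' M')%R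
   <= C1%:E * sup_norm P p t (fun s w => increment Y M s w - increment Y' M' s w)%R
      + C2%:E * (Lp_norm P p (fun w => Y 0 w - Y' 0 w)%R
                 + sup_norm P p T (fun s w => M s w - M' s w)%R))%E.
Hypotheses (C1_lt_lam : C1 < lam)
  (hlam : C2 * (2 + doob_const p) * (expR (lam * T) - 1) <= C1).
Notation mu := (@lebesgue_measure R).
Implicit Types (g Y M : process Omega R d).

Let sF (t : R) : t \in `[0, T] -> sigma_algebra [set: Omega] (F t).
Proof. by case: hF => H _ _; exact: H. Qed.
Let mF (t : R) : t \in `[0, T] -> F t `<=` measurable.
Proof. by case: hF => _ H _; exact: H. Qed.
Let h0 : 0 \in `[0, T]. Proof. by rewrite in_itv/= lexx ltW. Qed.
Let hT : T \in `[0, T]. Proof. by rewrite in_itv/= lexx ltW. Qed.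
Let mitv (a b : R) : @measurable _ (measurableTypeR R) `[a, b]%classic.
Proof. exact: measurable_itv. Qed.
Let lam0 : 0 < lam. Proof. exact: lt_trans C1_lt_lam. Qed.
Let weight0 s : 0 <= lam * expR (lam * s).
Proof. by rewrite mulr_ge0 ?expR_ge0// ltW. Qed.

Local Notation solves := (frozen_solution P T F p xi).
Let rho := C1 / lam.
Let rho_ge0 : 0 <= rho. Proof. by rewrite divr_ge0// ltW. Qed.
Let rho_lt1 : rho < 1. Proof. by rewrite ltr_pdivrMr// mul1r. Qed.

Let progressive_meas g s i : progressively_measurable T F g -> s \in `[0, T] ->
  measurable_fun [set: Omega] (fun w => g s w ord0 i).
Proof.
by move=> mg hs; exact: (mwrt_measurable (sF hs) (mF hs) (progressive_at mg hs i)).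
Qed.

Let progressive_measB g g' s i : progressively_measurable T F g ->
  progressively_measurable T F g' -> s \in `[0, T] ->
  measurable_fun [set: Omega] (fun w => (g s w - g' s w) ord0 i).
Proof.
by move=> mg mg' hs; exact: (progressive_meas i (progressively_measurableB mg mg') hs).
Qed.

(** The distance of the contraction: p-norms at each time, with the weight
lam e^(lam s), whose integral over [0, t] is e^(lam t) - 1. *)
Definition close (B : R) g g' := forall s : R, s \in `[0, T] ->
  (Lp_norm P p (fun w => g s w - g' s w)%R <= (B * lam * expR (lam * s))%:E)%E.

Lemma closeC B g g' : close B g g' -> close B g' g.
Proof.
move=> H s hs; apply: le_trans (H s hs); rewrite le_eqVlt; apply/orP; left; apply/eqP.
by apply: eq_Lnorm => w; rewrite -[in RHS]enormN opprB.
Qed.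

Lemma close_trans B B' g g' g'' : progressively_measurable T F g ->
  progressively_measurable T F g' -> progressively_measurable T F g'' ->
  close B g g' -> close B' g' g'' -> close (B + B') g g''.
Proof.
move=> mg mg' mg'' H H' s hs.
rewrite (_ : (fun w => g s w - g'' s w) =
  fun w => (g s w - g' s w) + (g' s w - g'' s w)); last first.
  by apply/funext => w; rewrite addrA subrK.
apply: le_trans (Lp_normD P p1 _ _) _; try (by move=> i; exact: progressive_measB).
by rewrite !mulrDl EFinD leeD//; [exact: H|exact: H'].
Qed.

Lemma close_eq0 B g g' : (forall n, close (B * rho ^+ n) g g') ->
  forall s : R, s \in `[0, T] -> (Lp_norm P p (fun w => g s w - g' s w)%R <= 0)%E.
Proof.
move=> H s hs.
have c : (B * rho ^+ n * lam * expR (lam * s))%:E @[n --> \oo] --> (B * 0 * lam * expR (lam * s))%:E.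
  apply: cvg_EFin; first exact: nearW.
  apply: cvgM; last exact: cvg_cst.
  apply: cvgM; last exact: cvg_cst.
  apply: cvgM; first exact: cvg_cst.
  by apply: cvg_expr; rewrite ger0_norm.
move: c; rewrite mulr0 !mul0r => c.
by apply: (cvge_ge _ c); apply: nearW => n; exact: H.
Qed.

Lemma close_integral B g g' (t : R) : 0 <= B -> close B g g' -> t \in `[0, T] ->
  (\int[mu]_(s in `[0%R, t]) Lp_norm P p (fun w => g s w - g' s w)%R <=
   (B * (expR (lam * t) - 1))%:E)%E.
Proof.
move=> B0 H; rewrite in_itv/= => /andP[t0 tT]; rewrite -integral_exp_weight//.
apply: ge0_le_integral_nomeas => // s; first by move=> _; exact: Lnorm_ge0.
rewrite /= in_itv/= => /andP[s0 st]; apply: H.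
by rewrite in_itv/= s0 (le_trans st).
Qed.

Lemma close_integrable B g g' : progressively_measurable T F g ->
  progressively_measurable T F g' -> 0 <= B -> close B g g' ->
  (\int[mu]_(s in `[0%R, T]) Lp_norm P p (g' s) < +oo)%E ->
  (\int[mu]_(s in `[0%R, T]) Lp_norm P p (g s) < +oo)%E.
Proof.
move=> mg mg' B0 H fin.
have c0 : 0 <= B * lam * expR (lam * T) by rewrite -mulrA mulr_ge0.
have le : (\int[mu]_(s in `[0%R, T]) Lp_norm P p (g s) <=
    \int[mu]_(s in `[0%R, T]) (Lp_norm P p (g' s) + (B * lam * expR (lam * T))%:E))%E.
  apply: ge0_le_integral_nomeas => // s; first by move=> _; exact: Lnorm_ge0.
  move=> /= hs; rewrite (_ : g s = fun w => g' s w + (g s w - g' s w)); last first.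
    by apply/funext => w; rewrite addrC subrK.
  apply: le_trans (Lp_normD P p1 _ _) _.
  - by move=> i; exact: progressive_meas.
  - by move=> i; exact: progressive_measB.
  rewrite leeD2l//; apply: le_trans (H s hs) _; rewrite lee_fin ler_wpM2l ?mulr_ge0 ?(ltW lam0)//.
  by rewrite ler_expR ler_pM2l//; move: hs; rewrite in_itv/= => /andP[].
apply: (le_lt_trans le).
apply: le_lt_trans (lower_integralD_cst_le mu (mitv 0 T) c0 _) _.
  by move=> s; exact: Lnorm_ge0.
have fin' : ((B * lam * expR (lam * T))%:E * mu `[0%R, T]%classic < +oo)%E.
  by rewrite lebesgue_measure_itv/= lte_fin T0 -EFinB -EFinM ltry.
exact: lte_add_pinfty.
Qed.

(** The contraction, with ratio rho = C1 / lam. *)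
Lemma close_driver B g g' Y M Y' M' : progressively_measurable T F g ->
  progressively_measurable T F g' -> solves g Y M -> solves g' Y' M' ->
  0 <= B -> close B g g' -> close (B * rho) (driver_at f Y M) (driver_at f Y' M').
Proof.
move=> mg mg' sol sol' B0 H s hs.
have [hY hM _ _] := sol; have [hY' hM' _ _] := sol'.
have [c1 c2] := frozen_contraction T0 hF p1 mg mg' sol sol'.
apply: le_trans (hf_lip hs hY hM hY' hM') _.
apply: (@le_trans _ _ (C1%:E * (B * (expR (lam * s) - 1))%:E +
    C2%:E * ((2 + doob_const p)%:E * (B * (expR (lam * T) - 1))%:E))%E).
  apply: leeD; apply: lee_wpmul2l; rewrite ?lee_fin//; first exact: ltW.
    by apply: le_trans (c1 s hs) _; exact: close_integral.
  apply: le_trans c2 _; apply: lee_wpmul2l; first by rewrite lee_fin addr_ge0 ?doob_const_ge0.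
  exact: close_integral.
rewrite -!EFinM -EFinD lee_fin /rho.
rewrite (_ : B * (C1 / lam) * lam = B * C1); last by field; rewrite gt_eqF.
have := ler_wpM2l B0 hlam; set E := expR _; set E' := expR _; set K := 2 + _.
by lra.
Qed.

(** The Lipschitz bound at time T, which is finite, bounds the difference of the
drivers at all times; the weight is at least lam. *)
Lemma close_exists Y M Y' M' : Sp P p T F Y -> Mp0 P p T F M ->
  Sp P p T F Y' -> Mp0 P p T F M' ->
  exists2 B, 0 <= B & close B (driver_at f Y M) (driver_at f Y' M').
Proof.
move=> hY hM hY' hM'.
have [[sM _] _] := hM; have [[sM' _] _] := hM'.
have Sinc (X N : process Omega R d) : Sp P p T F X -> Sp P p T F N -> Sp P p T F (increment X N).
  by move=> hX hN; exact: (SpD T0 hF p1 (SpB T0 hF p1 hX (Sp_cst0 T0 hF p1 hX)) hN).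
have hD := SpB T0 hF p1 (Sinc _ _ hY sM) (Sinc _ _ hY' sM').
have hYB := SpB T0 hF p1 hY hY'.
set S1 := sup_norm P p T (fun s w => increment Y M s w - increment Y' M' s w).
set S2 := (Lp_norm P p (fun w => Y 0%R w - Y' 0%R w)%R +
                 sup_norm P p T (fun s w => M s w - M' s w)%R)%E.
have S2fin : (S2 < +oo)%E.
  rewrite lte_add_pinfty//; last by case: (SpB T0 hF p1 sM sM').
  have [_ _] := hYB; apply: le_lt_trans.
  exact: (Lp_norm_le_sup_norm P T0 hF p1 h0 hT (Sp_rcll_adapted hYB)).
have S1fin : (S1 < +oo)%E by case: hD.
have S10 : (0 <= S1)%E by exact: Lnorm_ge0.
have S20 : (0 <= S2)%E by rewrite adde_ge0//; exact: Lnorm_ge0.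
pose A := C1 * fine S1 + C2 * fine S2.
have A0 : 0 <= A by rewrite addr_ge0// mulr_ge0 ?fine_ge0// ltW.
exists (A / lam); first by rewrite divr_ge0// ltW.
move=> s hs; rewrite divfK ?gt_eqF//; apply: le_trans (hf_lip hs hY hM hY' hM') _.
have s0 : 0 <= s by move: hs; rewrite in_itv/= => /andP[].
apply: (@le_trans _ _ A%:E); last first.
  by rewrite lee_fin ler_peMr// -[leLHS]expR0 ler_expR mulr_ge0// ltW.
rewrite /A EFinD !EFinM !fineK ?ge0_fin_numE//; apply: leeD => //.
apply: lee_wpmul2l; first by rewrite lee_fin ltW.
apply: (sup_norm_mono P T0 hF p1 hs hT _ (Sp_rcll_adapted hD)).
by move: hs; rewrite in_itv/= => /andP[].
Qed.

Lemma zero_Sp : Sp P p T F (zero_process Omega R d).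
Proof.
have ra : rcll_adapted T F (zero_process Omega R d).
  by split=> [t ht i|w]; [exact: measurable_cst|exact: rcll_cst].
apply: SpP => //.
apply: (@le_lt_trans _ _ (Lnorm P p (cst 0%E))); last first.
  by rewrite Lnorm0// gt_eqF// (lt_trans _ p1).
apply: ge0_ae_le_Lnorm => //.
- exact: (measurable_rcll_sup T0 hF ra.1 ra.2 hT).
- by move=> w; rewrite -/(sup_path (zero_process Omega R d) T w) sup_path_ge0// ltW.
by apply: nearW => w; apply: ge_ereal_sup => _ [s _ <-]; rewrite /zero_process enorm0.
Qed.

Lemma zero_Mp0 : Mp0 P p T F (zero_process Omega R d).
Proof.
have [a _ _] := zero_Sp; split; first by split; [exact: zero_Sp|exact: nearW].
have i0 : integrable_rvec P (fun _ : Omega => 0 : 'rV[R]_d).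
  by move=> i; rewrite (_ : (fun _ => _) = cst 0%E); [exact: integrable0|apply/funext => w; rewrite mxE].
split => // s t s0 st tT; apply: is_cond_exp_id => //.
Qed.

Lemma driver_integrable Y M : Sp P p T F Y -> Mp0 P p T F M ->
  (\int[mu]_(s in `[0%R, T]) Lp_norm P p (driver_at f Y M s) < +oo)%E.
Proof.
move=> hY hM; have [B B0 H] := close_exists hY hM zero_Sp zero_Mp0.
exact: (close_integrable (hf_meas hY hM) (hf_meas zero_Sp zero_Mp0) B0 H hf_int).
Qed.

(** Drivers that agree almost surely at each time have the same pathwise integrals
almost surely: the p-norm of int_0^T |g' - g| is at most the integral of
p-norms, which vanishes. *)
Lemma frozen_solution_transfer g g' Y M : progressively_measurable T F g ->
  progressively_measurable T F g' ->
  (\int[mu]_(s in `[0%R, T]) Lp_norm P p (g' s) < +oo)%E ->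
  (forall s : R, s \in `[0, T] -> (Lp_norm P p (fun w => g' s w - g s w)%R <= 0)%E) ->
  solves g Y M -> solves g' Y M.
Proof.
move=> mg mg' fin' gg' [hY hM ig eqn].
have aeg' := ae_path_integrable T0 hF p1 mg' fin'.
have mB := progressively_measurableB mg' mg.
have [m le] := Lnorm_time_integral P T0 hF p1 mB hT.
have I0 : (\int[mu]_(s in `[0%R, T]) Lp_norm P p (fun w => g' s w - g s w)%R <= 0)%E.
  rewrite -[leRHS](integral0 mu `[0, T]%classic).
  by apply: ge0_le_integral_nomeas => // s _; exact: Lnorm_ge0.
have ge0 w : (0 <= \int[mu]_(s in `[0%R, T]) (enorm (g' s w - g s w))%:E)%E.
  by apply: integral_ge0 => s _; rewrite lee_fin enorm_ge0.
have ae0 := Lnorm_eq0_ae p1 m ge0 (le_trans le I0).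
split=> //.
move: aeg' ae0; apply: filterS3 (filterI ig eqn) => w [igw eqw] ig'w w0 t ht.
have tT : t <= T by move: ht; rewrite in_itv/= => /andP[].
have E s : s \in `[0, T] -> path_integral (g'^~ w) s = path_integral (g^~ w) s.
  rewrite in_itv/= => /andP[s0 sT]; apply/eqP; rewrite -subr_eq0; apply/eqP/enorm_eq0.
  have i1 := path_integrableW sT ig'w; have i2 := path_integrableW sT igw.
  rewrite -path_integralB//; apply/eqP; rewrite eq_le enorm_ge0 andbT -lee_fin.
  rewrite -[leRHS]w0; apply: le_trans (enorm_path_integral (path_integrableB i1 i2)) _.
  apply: ge0_subset_integral => //.
  - exact: (measurable_int mu (integrable_enorm (mitv 0 T) (path_integrableB ig'w igw))).
  - by move=> u _; rewrite lee_fin enorm_ge0.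
  - by apply: subset_itvl; rewrite bnd_simp.
rewrite (eqw t ht) (path_integral_split igw ht).
by rewrite (path_integral_split ig'w ht) !E.
Qed.

(** At each time the increments have summable p-norms, hence are almost surely
summable.  The upper limit exists everywhere and is jointly measurable, which
makes g progressively measurable. *)
Lemma close_limit (g_ : nat -> process Omega R d) B : 0 <= B ->
  (forall n, progressively_measurable T F (g_ n)) ->
  (forall n, close (B * rho ^+ n) (g_ n.+1) (g_ n)) ->
  exists2 g, progressively_measurable T F g &
    forall n, close (B / (1 - rho) * rho ^+ n) g (g_ n).
Proof.
move=> B0 mg_ H.
pose g (t : R) w : 'rV[R]_d := \row_i fine (limn_esup (fun n => (g_ n t w ord0 i)%:E)).
have mg : progressively_measurable T F g.
  move=> t ht i; rewrite (_ : (fun sw => _) = fine \o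
    (fun sw : R * g_sigma_algebraType (F t) => limn_esup (fun n => (g_ n sw.1 sw.2 ord0 i)%:E))).
    apply: measurableT_comp => //; apply: measurable_fun_limn_esup => n.
    by apply/measurable_EFinP; exact: mg_.
  by apply/funext => sw; rewrite mxE.
exists g => // n s hs.
pose u k w := (enorm (g_ (n + k).+1 s w - g_ (n + k)%N s w))%:E.
have mu_ k : measurable_fun [set: Omega] (u k).
  by apply/measurable_EFinP/measurable_enorm => i; exact: progressive_measB.
have u0 k w : (0 <= u k w)%E by rewrite lee_fin enorm_ge0.
have Nu : (Lnorm P p (fun w => \sum_(k <oo) u k w) <=
    (B / (1 - rho) * rho ^+ n * lam * expR (lam * s))%:E)%E.
  apply: le_trans (Lnorm_nneseries p1 mu_ u0 (fun k => H (n + k)%N s hs)) _.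
  have a0 k : 0 <= B * rho ^+ (n + k) * lam * expR (lam * s).
    by rewrite -mulrA mulr_ge0// mulr_ge0// exprn_ge0.
  apply: lime_le; first by apply: is_cvg_nneseries => k _ _; rewrite lee_fin.
  apply: nearW => N; rewrite sumEFin lee_fin.
  have geo : (\sum_(0 <= k < N) rho ^+ k) * (1 - rho) = 1 - rho ^+ N.
    elim: N => [|N IH]; first by rewrite big_geq// mul0r expr0 subrr.
    by rewrite big_nat_recr//= mulrDl IH exprS; ring.
  have geo_le : \sum_(0 <= k < N) rho ^+ k <= (1 - rho)^-1.
    rewrite -[leRHS]mul1r ler_pdivlMr ?subr_gt0// geo.
    by rewrite gerBl exprn_ge0.
  rewrite (_ : \sum_(0 <= k < N) _ =
    B * rho ^+ n * (lam * expR (lam * s)) * \sum_(0 <= k < N) rho ^+ k); last first.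
    by rewrite big_distrr/=; apply: eq_bigr => k _; rewrite exprD; ring.
  rewrite (_ : B / _ * _ * _ * _ = B * rho ^+ n * (lam * expR (lam * s)) * (1 - rho)^-1); last by ring.
  by rewrite ler_wpM2l// mulr_ge0// mulr_ge0// exprn_ge0.
apply: (le_trans _ Nu).
have mS : measurable_fun [set: Omega] (fun w => \sum_(k <oo) u k w)%E.
  exact: ge0_emeasurable_sum.
have S0 w : (0 <= \sum_(k <oo) u k w)%E by exact: nneseries_ge0.
have Sfin : {ae P, forall w, (\sum_(k <oo) u k w < +oo)%E}.
  by apply: (Lnorm_fin_ae p1 mS S0); apply: le_lt_trans Nu _; rewrite ltry.
apply: ge0_ae_le_Lnorm => //.
- by apply/measurable_EFinP/measurable_enorm => i; exact: progressive_measB.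
- by move=> w; rewrite lee_fin enorm_ge0.
apply: filterS Sfin => w Sw.
have inc : (\sum_(k <oo) (enorm (g_ (n + k.+1)%N s w - g_ (n + k)%N s w))%:E =
    \sum_(k <oo) u k w)%E.
  by apply: eq_eseriesr => k _; rewrite /u addnS.
have [|l [hl]] := @summable_increments_cvg _ _ (fun k => g_ (n + k)%N s w); first by rewrite inc.
rewrite inc addn0 (_ : l = g s w)//; apply/rowP => i; rewrite mxE.
have c : (g_ m s w ord0 i)%:E @[m --> \oo] --> (l ord0 i)%:E.
  apply: cvg_EFin; first exact: nearW.
  have := hl i; rewrite (_ : (fun k => _) = (fun k => g_ (k + n)%N s w ord0 i)); last first.
    by apply/funext => k; rewrite addnC.
  by rewrite (cvg_shiftn n (fun m => g_ m s w ord0 i)).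
by rewrite (cvg_limn_einf_sup c).2.
Qed.

Theorem fixed_point_unique Y M Y' M' :
  bsde_solution P p T F xi f Y M -> bsde_solution P p T F xi f Y' M' ->
  indistinguishable P T Y Y' /\ indistinguishable P T M M'.
Proof.
move=> sol sol'.
have [hY hM _ _] := sol; have [hY' hM' _ _] := sol'.
have mg := hf_meas hY hM; have mg' := hf_meas hY' hM'.
have [B B0 H] := close_exists hY hM hY' hM'.
have Hn n : close (B * rho ^+ n) (driver_at f Y M) (driver_at f Y' M').
  elim: n => [|n IH]; first by rewrite expr0 mulr1.
  rewrite exprSr mulrA; apply: (close_driver mg mg' sol sol') => //.
  by rewrite mulr_ge0// exprn_ge0.
have D0 := close_eq0 Hn.
have [c1 c2] := frozen_contraction T0 hF p1 mg mg' sol sol'.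
have I0 : (\int[mu]_(s in `[0%R, T]) Lp_norm P p (fun w => driver_at f Y M s w - driver_at f Y' M' s w)%R <= 0)%E.
  rewrite -[leRHS](integral0 mu `[0, T]%classic).
  by apply: ge0_le_integral_nomeas => // s _; exact: Lnorm_ge0.
have zero (X X' : process Omega R d) : rcll_adapted T F X -> rcll_adapted T F X' ->
    (sup_norm P p T (fun t w => X t w - X' t w)%R <= 0)%E ->
    {ae P, forall w, forall t : R, t \in `[0, T] -> X t w = X' t w}.
  move=> raX raX' N0; have raB := rcll_adaptedB raX raX'.
  have := Lnorm_eq0_ae p1 (measurable_rcll_sup T0 hF raB.1 raB.2 hT) _ N0.
  move=> /(_ (fun w => sup_path_ge0 _ w (ltW T0))); apply: filterS => w w0 t ht.
  apply/eqP; rewrite -subr_eq0; apply/eqP/enorm_eq0/eqP.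
  rewrite eq_le enorm_ge0 andbT -lee_fin -[leRHS]w0.
  by apply: ereal_sup_ubound; exists t.
have /Sp_rcll_adapted raM : Sp P p T F M by case: hM => -[].
have /Sp_rcll_adapted raM' : Sp P p T F M' by case: hM' => -[].
have raY := Sp_rcll_adapted hY; have raY' := Sp_rcll_adapted hY'.
have K0 : 0 <= 2 + doob_const p by rewrite addr_ge0// doob_const_ge0.
have c2' := le_trans c2 (mule_ge0_le0 _ I0).
have {c2'} : (Lp_norm P p (fun w => Y 0%R w - Y' 0%R w)%R +
    sup_norm P p T (fun s w => M s w - M' s w)%R <= 0)%E by apply: c2'; rewrite lee_fin.
move=> N0.
have N1 : (Lp_norm P p (fun w => Y 0%R w - Y' 0%R w)%R <= 0)%E.
  by apply: le_trans N0; rewrite leeDl// Lnorm_ge0.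
have N2 : (sup_norm P p T (fun s w => M s w - M' s w)%R <= 0)%E.
  by apply: le_trans N0; rewrite leeDr// Lnorm_ge0.
have aeM := zero _ _ raM raM' N2.
have aeI := zero _ _ (rcll_adapted_increment T0 hF hY hM) (rcll_adapted_increment T0 hF hY' hM')
  (le_trans (c1 T hT) I0).
have mY0 : measurable_fun [set: Omega] (fun w => (enorm (Y 0 w - Y' 0 w))%:E).
  apply/measurable_EFinP/measurable_enorm => i.
  exact: (measurable_adapted hF (rcll_adaptedB raY raY').1 h0 i).
have aeY : {ae P, forall w, (enorm (Y 0 w - Y' 0 w))%:E = 0%E}.
  by apply: (Lnorm_eq0_ae p1 mY0 _ N1) => w; rewrite lee_fin enorm_ge0.
split => //; apply: filterS3 aeM aeI aeY => w eM eI [/enorm_eq0/eqP eY] t ht.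
move: eY; rewrite subr_eq0 => /eqP eY; have := eI t ht.
by rewrite /increment (eM t ht) eY => /addIr /addIr.
Qed.

Theorem fixed_point_exists : exists Y M, bsde_solution P p T F xi f Y M.
Proof.
have /choice[next hnext] : forall q : process Omega R d * process Omega R d,
    exists q' : process Omega R d * process Omega R d,
    Sp P p T F q.1 -> Mp0 P p T F q.2 -> solves (driver_at f q.1 q.2) q'.1 q'.2.
  move=> [Y M] /=.
  have [[hY hM]|n] := pselect (Sp P p T F Y /\ Mp0 P p T F M); last first.
    by exists (Y, M) => hY hM; exfalso; apply: n.
  have [Y' [M' sol]] := frozen_exists T0 hF hFuc p1 hxi (hf_meas hY hM) (driver_integrable hY hM).
  by exists (Y', M').
pose q n := iter n next (zero_process Omega R d, zero_process Omega R d).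
have hq n : Sp P p T F (q n).1 /\ Mp0 P p T F (q n).2.
  elim: n => [|n [h1 h2]]; first by split; [exact: zero_Sp|exact: zero_Mp0].
  by have [] := hnext (q n) h1 h2.
pose g_ n := driver_at f (q n).1 (q n).2.
have mg_ n : progressively_measurable T F (g_ n) by have [h1 h2] := hq n; exact: hf_meas.
have sol_ n : solves (g_ n) (q n.+1).1 (q n.+1).2 by have [h1 h2] := hq n; exact: hnext.
have [B B0 H0] := close_exists (hq 1%N).1 (hq 1%N).2 (hq 0%N).1 (hq 0%N).2.
have Hn n : close (B * rho ^+ n) (g_ n.+1) (g_ n).
  elim: n => [|n IH]; first by rewrite expr0 mulr1.
  rewrite exprSr mulrA; apply: (close_driver (mg_ n.+1) (mg_ n)) => //.
  by rewrite mulr_ge0// exprn_ge0.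
have [g mg Hg] := close_limit B0 mg_ Hn.
set B' := B / (1 - rho) in Hg.
have B'0 : 0 <= B' by rewrite divr_ge0// subr_ge0 ltW.
have fin : (\int[mu]_(s in `[0%R, T]) Lp_norm P p (g s) < +oo)%E.
  have := Hg 0%N; rewrite expr0 mulr1 => H.
  by apply: (close_integrable mg (mg_ 0%N) B'0 H); have [h1 h2] := hq 0%N; exact: driver_integrable.
have [Y [M sol]] := frozen_exists T0 hF hFuc p1 hxi mg fin.
have [hY hM _ _] := sol; exists Y, M.
have mf := hf_meas hY hM.
apply: (@frozen_solution_transfer g _ Y M) => //; first exact: driver_integrable.
apply: (@close_eq0 ((B' + B') * rho)) => n.
rewrite (_ : _ * rho ^+ n = B' * rho ^+ n * rho + B' * rho ^+ n.+1); last by rewrite exprS; ring.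
apply: (close_trans mf (mg_ n.+1) mg); last exact/closeC/Hg.
apply: (close_driver mg (mg_ n) sol (sol_ n) _ (Hg n)).
by rewrite mulr_ge0// exprn_ge0.
Qed.

End fixed_point.

Theorem proposition3p3 (disp : measure_display) (Omega : measurableType disp)
    (R : realType) (P : probability Omega R) (d : nat)
    (T : R) (hT : 0 < T)
    (F : R -> set (set Omega))
    (hF : is_filtration T F) (hFuc : usual_conditions P T F)
    (p : \bar R) (hp : (1 < p)%E)
    (xi : rvec Omega R d) (hxi : Lp P p (F T) xi)
    (f : driver Omega R d)
    (hf_meas : forall Y M : process Omega R d,
       Sp P p T F Y -> Mp0 P p T F M ->
       progressively_measurable T F (driver_at f Y M))
    (hf_int : (\int[@lebesgue_measure R]_(t in `[0%R, T])
       Lp_norm P p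
         (driver_at f (zero_process Omega R d) (zero_process Omega R d) t) < +oo)%E)
    (hf_lip : exists C1 C2 : R,
       [/\ 0 < C1, 0 <= C2,
           C2 < bsde_const p * C1 / (expR (C1 * T) - 1)
         & forall (t : R) (Y M Y' M' : process Omega R d),
             t \in `[0, T] ->
             Sp P p T F Y -> Mp0 P p T F M ->
             Sp P p T F Y' -> Mp0 P p T F M' ->
             (Lp_norm P p (fun w => f t w Y M - f t w Y' M')%R
              <= C1%:E * sup_norm P p t
                   (fun s w => Y s w - Y 0 w + M s w
                               - (Y' s w - Y' 0 w + M' s w))%R
                 + C2%:E * (Lp_norm P p (fun w => Y 0 w - Y' 0 w)%R
                            + sup_norm P p T (fun s w => M s w - M' s w)%R))%E]) :
  exists Y M : process Omega R d,
    bsde_solution P p T F xi f Y M /\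
    (forall Y' M' : process Omega R d,
       bsde_solution P p T F xi f Y' M' ->
       indistinguishable P T Y Y' /\ indistinguishable P T M M').
Proof.
have [C1 [C2 [C10 C20 C2lt lip]]] := hf_lip.
have K0 : 0 < 2 + doob_const p by rewrite ltr_wpDr ?doob_const_ge0.
have [lam C1lam hlam] := weight_exponent_exists hT C10 C20 K0 (bsde_const_bound hp) C2lt.
have [Y [M sol]] := fixed_point_exists hT hF hFuc hp hxi hf_meas hf_int C10 C20 lip C1lam hlam.
exists Y, M; split=> // Y' M' sol'.
exact: (fixed_point_unique hT hF hp hf_meas C10 C20 lip C1lam hlam sol sol').
Qed.
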